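(* Let $\kappa\in\{-1,0,1\}$, let $I\subset\mathbb{R}$ be an open interval and let $f:I\to\mathbb{R}$ be a smooth function such that $f''(t)+\kappa e^{-2f(t)}\neq 0$ for all $t\in I$. Let $\Sigma$ be a connected totally umbilical surface immersed in the warped product $\mathbb{M}(\kappa)_f\times I$. Then $\Sigma$ is contained in a totally umbilical surface of $\mathbb{M}(\kappa)_f\times I$ which is invariant by a one-parameter group of isometries of $\mathbb{M}(\kappa)_f\times I$.
   Context: $\mathbb{M}(\kappa)$ is the complete, connected, simply connected 2-dimensional Riemannian manifold of constant curvature $\kappa\in\{-1,0,1\}$ (the hyperbolic plane $\mathbb{H}^2$, the Euclidean plane $\mathbb{R}^2$, or the unit sphere $\mathbb{S}^2$), with metric $g_2$. The warped product $\mathbb{M}(\kappa)_f\times I$ is the product manifold $\mathbb{M}(\kappa)\times I$ endowed with the Riemannian metric $\overline{g}=e^{2f(t)}g_2+dt^2$, where $t$ is the coordinate on $I$; $\overline{\nabla}$ is its Levi-Civita connection. A smooth surface $\Sigma$ isometrically immersed in $\mathbb{M}(\kappa)_f\times I$ is totally umbilical if there is a function $\varrho\in C^\infty(\Sigma)$ such that $SX=-\overline{\nabla}_XN=\varrho X$ for every vector field $X$ tangent to $\Sigma$, where $N$ is a smooth unit normal field along the immersion and $S$ is the associated Weingarten operator. A one-parameter group of isometries is understood to be non-trivial. For an immersed surface, ''contained in'' refers to the image of the immersion. *)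

(* Defs.v *)
From HB Require Import structures.
From mathcomp Require Import all_boot all_order all_algebra.
From mathcomp Require Import all_classical all_reals all_analysis.
Set Implicit Arguments.
Unset Strict Implicit.
Unset Printing Implicit Defensive.
Import Order.TTheory GRing.Theory Num.Theory.
Import numFieldNormedType.Exports.
Local Open Scope classical_set_scope.
Local Open Scope ring_scope.

(** * Smooth maps between Euclidean spaces *)

Definition partial {R : realType} {n : nat} {V : normedModType R}
    (i : 'I_n) (F : 'rV[R]_n -> V) : 'rV[R]_n -> V :=
  fun x => 'D_(delta_mx 0 i) F x.

Definition partials {R : realType} {n : nat} {V : normedModType R}
    (s : seq 'I_n) (F : 'rV[R]_n -> V) : 'rV[R]_n -> V :=
  foldr partial F s.

(* C^oo on an open set [U]: all iterated partial derivatives are (Frechet)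
   differentiable, hence continuous, on [U]. *)
Definition smooth_on {R : realType} {n : nat} {V : normedModType R}
    (U : set 'rV[R]_n) (F : 'rV[R]_n -> V) : Prop :=
  forall (s : seq 'I_n) (x : 'rV[R]_n), U x -> differentiable (partials s F) x.

(** * Smooth manifolds *)

(* A space with a family of charts. The inverse [chart_inv j] of a chart is a
   total function, only meaningful on the image [chart_image j]. *)
Record manifold (R : realType) (n : nat) := Manifold {
  carrier :> topologicalType ;
  idx : Type ;
  chart_dom : idx -> set carrier ;
  chart_map : idx -> carrier -> 'rV[R]_n ;
  chart_inv : idx -> 'rV[R]_n -> carrier }.

Definition chart_image {R : realType} {n : nat} {M : manifold R n}
    (i : idx M) : set 'rV[R]_n :=
  chart_map i @` chart_dom i.

Definition smooth_manifold {R : realType} {n : nat} (M : manifold R n) : Prop :=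
  [/\ hausdorff_space M /\ @second_countable M,
      forall p : M, exists i : idx M, chart_dom i p,
      forall i : idx M,
        open (chart_dom i) /\ open (chart_image i),
      forall i : idx M,
        [/\ forall p, chart_dom i p -> chart_inv i (chart_map i p) = p,
            forall p, chart_dom i p -> {for p, continuous (chart_map i)} &
            forall u, chart_image i u -> {for u, continuous (chart_inv i)}] &
      forall i j : idx M,
        smooth_on (chart_map i @` (chart_dom i `&` chart_dom j))
          (chart_map j \o chart_inv i)].

Definition overlap {R : realType} {m n : nat} {M : manifold R m}
    {N : manifold R n} (phi : M -> N) (i : idx M) (j : idx N) : set 'rV[R]_m :=
  [set u | chart_image i u /\ chart_dom j (phi (chart_inv i u))].

Definition local_rep {R : realType} {m n : nat} {M : manifold R m}
    {N : manifold R n} (phi : M -> N) (i : idx M) (j : idx N) :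
    'rV[R]_m -> 'rV[R]_n :=
  fun u => chart_map j (phi (chart_inv i u)).

Definition smooth_map {R : realType} {m n : nat} {M : manifold R m}
    {N : manifold R n} (phi : M -> N) : Prop :=
  continuous phi /\
  forall (i : idx M) (j : idx N),
    smooth_on (overlap phi i j) (local_rep phi i j).

Definition smooth_fun {R : realType} {m : nat} {M : manifold R m}
    (h : M -> R) : Prop :=
  forall i : idx M,
    smooth_on (chart_image i) (fun u => h (chart_inv i u) : R^o).

Definition immersion {R : realType} {m n : nat} {M : manifold R m}
    {N : manifold R n} (phi : M -> N) : Prop :=
  smooth_map phi /\
  forall (i : idx M) (j : idx N) (u X : 'rV[R]_m), overlap phi i j u ->
    'D_X (local_rep phi i j) u = 0 -> X = 0.

Definition prod_manifold {R : realType} {m n : nat}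
    (M : manifold R m) (N : manifold R n) : manifold R (m + n) :=
  @Manifold R (m + n) (M * N)%type (idx M * idx N)%type
    (fun k => chart_dom k.1 `*` chart_dom k.2)
    (fun k p => row_mx (chart_map k.1 p.1) (chart_map k.2 p.2))
    (fun k u => (chart_inv k.1 (lsubmx u), chart_inv k.2 (rsubmx u))).

Definition line (R : realType) : manifold R 1 :=
  @Manifold R 1 R unit (fun=> setT) (fun _ t => const_mx t) (fun _ u => u 0 0).

(** * Riemannian metrics and the Levi-Civita connection *)

(* [metric j x] is the Gram matrix of the coordinate frame of the chart [j] at
   the point with coordinates [x] (for [x] in [chart_image j]). *)
Record riemannian (R : realType) (n : nat) := Riemannian {
  space :> manifold R n ;
  metric : idx space -> 'rV[R]_n -> 'M[R]_n }.

Definition inner {R : realType} {n : nat} (G : 'M[R]_n) (v w : 'rV[R]_n) : R :=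
  (v *m G *m w^T) 0 0.

Definition christoffel {R : realType} {n : nat} (g : 'rV[R]_n -> 'M[R]_n)
    (x : 'rV[R]_n) (k a b : 'I_n) : R :=
  2^-1 * \sum_(l < n) invmx (g x) k l *
    (partial a (fun y => g y b l : R^o) x +
     partial b (fun y => g y a l : R^o) x -
     partial l (fun y => g y a b : R^o) x).

(* A vector field along [phi : M -> N]: [V j p] is the vector of components of
   the value at [p] in the chart [j] of [N], for [phi p] in [chart_dom j]. *)
Definition field_along {R : realType} {m n : nat} {M : manifold R m}
    {N : manifold R n} (phi : M -> N) (V : idx N -> M -> 'rV[R]_n) : Prop :=
  (forall (j k : idx N) (p : M), chart_dom j (phi p) -> chart_dom k (phi p) ->
     V k p = 'D_(V j p) (chart_map k \o chart_inv j) (chart_map j (phi p))) /\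
  (forall (i : idx M) (j : idx N),
     smooth_on (overlap phi i j) (fun u => V j (chart_inv i u))).

(* Components, in the chart [j] of [P], of the covariant derivative of the
   field [V] along [phi] in the direction of the tangent vector of [M] which
   has components [X] in the chart [i] at the point with coordinates [u]. *)
Definition covariant {R : realType} {m n : nat} {M : manifold R m}
    {P : riemannian R n} (phi : M -> P) (V : idx P -> M -> 'rV[R]_n)
    (i : idx M) (j : idx P) (u X : 'rV[R]_m) : 'rV[R]_n :=
  'D_X (fun u' => V j (chart_inv i u')) u +
  \row_(k < n) \sum_(a < n) \sum_(b < n)
    christoffel (metric j) (local_rep phi i j u) k a b *
    'D_X (local_rep phi i j) u 0 a * V j (chart_inv i u) 0 b.

Definition unit_normal {R : realType} {m n : nat} {M : manifold R m}
    {P : riemannian R n} (phi : M -> P) (N : idx P -> M -> 'rV[R]_n) : Prop :=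
  field_along phi N /\
  forall (i : idx M) (j : idx P) (u : 'rV[R]_m), overlap phi i j u ->
    let G := metric j (local_rep phi i j u) in
    inner G (N j (chart_inv i u)) (N j (chart_inv i u)) = 1 /\
    forall X : 'rV[R]_m,
      inner G (N j (chart_inv i u)) ('D_X (local_rep phi i j) u) = 0.

Definition totally_umbilical {R : realType} {m n : nat} {M : manifold R m}
    {P : riemannian R n} (phi : M -> P) : Prop :=
  immersion phi /\
  exists (N : idx P -> M -> 'rV[R]_n) (rho : M -> R),
    [/\ unit_normal phi N, smooth_fun rho &
      forall (i : idx M) (j : idx P) (u X : 'rV[R]_m), overlap phi i j u ->
        - covariant phi N i j u X =
        rho (chart_inv i u) *: 'D_X (local_rep phi i j) u].

(** * Isometries *)

Definition isometry {R : realType} {n : nat} {P : riemannian R n}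
    (h : P -> P) : Prop :=
  [/\ smooth_map h,
      exists h' : P -> P, [/\ cancel h h', cancel h' h & smooth_map h'] &
      forall (i j : idx P) (u v w : 'rV[R]_n), overlap h i j u ->
        inner (metric j (local_rep h i j u))
          ('D_v (local_rep h i j) u) ('D_w (local_rep h i j) u) =
        inner (metric i u) v w].

Definition one_parameter_group_of_isometries {R : realType} {n : nat}
    {P : riemannian R n} (Phi : R -> P -> P) : Prop :=
  [/\ forall s : R, isometry (Phi s),
      Phi 0 =1 id,
      forall s t : R, Phi (s + t) =1 Phi s \o Phi t,
      smooth_map (fun q : prod_manifold (line R) P => (Phi q.1 q.2 : P)) &
      exists (s : R) (p : P), Phi s p <> p].

(** * The surfaces of constant curvature *)

(* The quadric [kappa (x^2 + y^2) + z^2 = 1], with [0 < z] if [kappa <= 0], and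
   the bilinear form [dx^2 + dy^2 + kappa dz^2]: the unit sphere of Euclidean
   space for [kappa = 1], the plane [z = 1] for [kappa = 0], and the hyperboloid
   model in Minkowski space for [kappa = -1]. *)
Definition quadric {R : realType} (kappa : R) : set 'rV[R]_3 :=
  [set p | kappa * (p 0 0 ^+ 2 + p 0 1 ^+ 2) + p 0 2%:R ^+ 2 = 1 /\
           (kappa <= 0 -> 0 < p 0 2%:R)].

Definition ambient_form {R : realType} (kappa : R) (v w : 'rV[R]_3) : R :=
  v 0 0 * w 0 0 + v 0 1 * w 0 1 + kappa * (v 0 2%:R * w 0 2%:R).

Definition row3 {R : realType} (x y z : R) : 'rV[R]_3 :=
  \row_(i < 3) [:: x; y; z]`_i.

Lemma quadric_pole {R : realType} (kappa : R) :
  row3 0 0 1 \in quadric kappa.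
Proof.
by apply/mem_set; rewrite /quadric /= !mxE /= expr0n addr0 mulr0 add0r expr1n.
Qed.

Definition pole {R : realType} (kappa : R) : quadric kappa :=
  Sub (row3 0 0 1) (quadric_pole kappa).

(* Stereographic projection from [(0, 0, - eps)], with [eps = 1] for [true] and
   [eps = -1] for [false]; the second chart is empty unless [0 < kappa]. The
   first argument of [insubd] is a junk value. *)
Definition stereo_sign {R : realType} (b : bool) : R := if b then 1 else -1.

Definition stereo_inv {R : realType} (kappa : R) (b : bool) (u : 'rV[R]_2) :
    'rV[R]_3 :=
  let q := kappa * (u 0 0 ^+ 2 + u 0 1 ^+ 2) / 4 in
  row3 (u 0 0 / (1 + q)) (u 0 1 / (1 + q))
    (stereo_sign b * ((1 - q) / (1 + q))).

Definition quadric_manifold {R : realType} (kappa : R) : manifold R 2 :=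
  @Manifold R 2 (quadric kappa) bool
    (fun b => [set p | 0 < 1 + stereo_sign b * (\val p : 'rV[R]_3) 0 2%:R])
    (fun b p => \row_(i < 2)
       (2 * (\val p : 'rV[R]_3) 0 (widen_ord (leqnSn 2) i) /
        (1 + stereo_sign b * (\val p : 'rV[R]_3) 0 2%:R)))
    (fun b u => insubd (pole kappa) (stereo_inv kappa b u)).

(* The metric induced by [ambient_form] through the inclusion in [R^3]. *)
Definition space_form {R : realType} (kappa : R) : riemannian R 2 :=
  @Riemannian R 2 (quadric_manifold kappa)
    (fun b u =>
       let incl v : 'rV[R]_3 :=
         \val (@chart_inv R 2 (quadric_manifold kappa) b v) in
       \matrix_(i, j)
         ambient_form kappa (partial i incl u) (partial j incl u)).

(** * Warped products over an interval *)

Definition interval_point {R : realType} {I : set R} (I0 : I !=set0) : I :=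
  let t0 := cid I0 in Sub (projT1 t0) (mem_set (projT2 t0)).

(* An open interval with its global coordinate; [I0] only serves to make
   [chart_inv] total. *)
Definition interval_manifold {R : realType} (I : set R) (I0 : I !=set0) :
    manifold R 1 :=
  @Manifold R 1 I unit (fun=> setT) (fun _ t => const_mx (\val t))
    (fun _ u => insubd (interval_point I0) (u 0 0)).

Definition warped_product {R : realType} {n : nat} (M : riemannian R n)
    (f : R -> R) (I : set R) (I0 : I !=set0) : riemannian R (n + 1) :=
  @Riemannian R (n + 1) (prod_manifold M (interval_manifold I0))
    (fun k u =>
       block_mx (expR (2 * f (rsubmx u 0 0)) *: metric k.1 (lsubmx u)) 0
                0 1%:M).

Definition smooth_on_interval {R : realType} (I : set R) (f : R -> R) : Prop :=
  forall (n : nat) (t : R), I t -> derivable (f^`(n))%classic t 1.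

(* Main.v *)
Require Import Defs.
From HB Require Import structures.
From mathcomp Require Import all_boot all_order all_algebra.
From mathcomp Require Import all_classical all_reals all_analysis.
From mathcomp Require Import ring lra.
Set Implicit Arguments.
Unset Strict Implicit.
Unset Printing Implicit Defensive.
Import Order.TTheory GRing.Theory Num.Theory.
Import numFieldNormedType.Exports.
Local Open Scope classical_set_scope.
Local Open Scope ring_scope.

(** Put [ds = e^(-f) dt]. The metric [e^(2f) g_2 + dt^2] is conformal to the
    product metric [g_2 + ds^2], and umbilicity is invariant under conformal
    changes. Let [P] be the position of the surface on the quadric, in a linear
    space of dimension three, and let [(n, nu)] be the components of its unit
    normal for the product metric. In these terms the surface is umbilical when,
    for some function [lam],
      [dn = lam dP + kappa nu ds P]   and   [d nu = lam ds]
    ([umbilical_at], [umbilical_data_of], [umbilical_of_data]). The symmetry of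
    second derivatives then gives [d lam = kappa nu ds] ([codazzi]), so that the
    vector [A = n - lam P] is constant ([derive_axis]), and that [lam] and [nu]
    solve a linear differential equation with constant coefficients in [s].
    Hence the surface lies in a hypersurface
      [height_fun A P + c0 + c1 S(s) + c2 C(s) = 0],
    where [S] and [C] are trigonometric functions, linear and quadratic
    polynomials, or hyperbolic functions ([first_integral]).

    This equation is invariant under a one-parameter group of isometries of the
    factor [M(kappa)]: the isometries that fix [A] if [kappa] is not zero, the
    rotations around the center of the circles [height_fun A = cst] or the
    translations along these lines if [kappa] is zero, and arbitrary rotations if
    [A = 0] ([rot_height_fun], [act_group]). The derivative of its left-hand
    side along the unit normal is one ([level_regular]), so that the surface
    fills the hypersurface near each of its points ([level_set_filled]): the
    orbit of a point of the surface stays in it for a short time. It follows that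
    the union of the images of the surface under the rational times of the group
    is invariant under the whole group ([act_dense]). This union is the image of
    an immersion of countably many disjoint copies of the surface, which is
    umbilical because each of the images is ([umbilical_spread]). *)

(** * Calculus of scalar functions *)

(** Hiding the class [is_derive] leaves the derivative to be found by the rules
    below instead of by instance resolution. *)
Definition has_derive {R : realType} {V : normedModType R} (x v : V) (F : V -> R)
  (a : R) := is_derive x v F a.

Lemma has_derive_comp {R : realType} {V : normedModType R} (h : R -> R)
    (F : V -> R) (x v : V) (dh dF : R) :
  has_derive (F x) 1 h dh -> has_derive x v F dF ->
  has_derive x v (fun y => h (F y)) (dh * dF).
Proof.
rewrite /has_derive => hh hF.
have hF1 : is_derive (0 : R) 1 (fun t : R => F (t *: v + x)) dF.
  case: hF => dF1 dF2; split; first by apply: (derivable1P F x v).1.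
  rewrite -dF2 /derive; apply: congr1; apply: (congr1 (fun g : R -> R => g x0 @[x0 --> 0^'])).
  by apply/funext => t /=; rewrite addr0 scale0r add0r [_%:A]mulr1.
have hh1 : is_derive (F (0 *: v + x)) 1 h dh by rewrite scale0r add0r.
have [d1 d2] := is_derive1_comp hh1 hF1.
split; first by apply: (derivable1P (fun y => h (F y)) x v).2.
rewrite -[RHS]d2 /derive; apply: congr1; apply: (congr1 (fun g : R -> R => g x0 @[x0 --> 0^'])).
by apply/funext => t /=; rewrite addr0 scale0r add0r [_%:A]mulr1.
Qed.

Section is_derive_pointwise.
Context {R : realType} {V : normedModType R}.
Implicit Types (F G : V -> R) (x v : V).

Lemma has_deriveD F G x v a b :
  has_derive x v F a -> has_derive x v G b ->
  has_derive x v (fun y => F y + G y) (a + b).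
Proof. by rewrite /has_derive => hF hG; exact: is_deriveD. Qed.

Lemma has_deriveB F G x v a b :
  has_derive x v F a -> has_derive x v G b ->
  has_derive x v (fun y => F y - G y) (a - b).
Proof. by rewrite /has_derive => hF hG; exact: is_deriveB. Qed.

Lemma has_deriveN F x v a :
  has_derive x v F a -> has_derive x v (fun y => - F y) (- a).
Proof. by rewrite /has_derive => hF; exact: is_deriveN. Qed.

Lemma has_deriveM F G x v a b :
  has_derive x v F a -> has_derive x v G b ->
  has_derive x v (fun y => F y * G y) (a * G x + F x * b).
Proof.
rewrite /has_derive => hF hG; have := is_deriveM hF hG.
by rewrite /GRing.scale /= addrC [G x * a]mulrC.
Qed.

Lemma has_deriveX F n x v a :
  has_derive x v F a ->
  has_derive x v (fun y => F y ^+ n) (a * (n%:R * F x ^+ n.-1)).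
Proof.
rewrite /has_derive => hF; have := is_deriveX n hF.
by rewrite fctE /GRing.scale /= mulrC -mulr_natl.
Qed.

Lemma has_deriveV F x v a : F x != 0 ->
  has_derive x v F a -> has_derive x v (fun y => (F y)^-1) (- a / F x ^+ 2).
Proof.
rewrite /has_derive => F0 hF.
have hV : is_derive (F x) 1 (fun y : R => y^-1) (- (F x) ^- 2 *: 1).
  exact: (@is_deriveV R id (F x) 1 1 F0).
have := has_derive_comp hV hF.
by rewrite /GRing.scale /= mulr1 mulNr mulrC mulNr.
Qed.

Lemma has_derive_cst (c : R) x v : has_derive x v (fun=> c) 0.
Proof. exact: is_derive_cst. Qed.

(** The rules above compute a derivative in their own form, which is then
    compared with the expected one. *)
Lemma has_derive_conv F x v a :
  (exists2 b, has_derive x v F b & b = a) -> has_derive x v F a.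
Proof. by case=> b hF <-. Qed.

Lemma differentiable_has_derive F x v : differentiable F x ->
  has_derive x v F ('D_v F x).
Proof. by move=> dF; apply: derivableP; exact: diff_derivable. Qed.

End is_derive_pointwise.

Lemma has_derive_coord {R : realType} n (i : 'I_n) (x v : 'rV[R]_n) :
  has_derive x v (fun y : 'rV[R]_n => y 0 i : R) (v 0 i).
Proof.
apply: DeriveDef; first exact/diff_derivable/differentiable_coord.
have := @derive_mx R 'rV[R]_n 1 n id x v (@derivable_id R _ x v).
by rewrite derive_id => /rowP/(_ i); rewrite mxE.
Qed.

Lemma differentiable_rowP {R : realType} m n (F : 'rV[R]_m -> 'rV[R]_n) x :
  differentiable F x <-> forall j, differentiable (fun y => F y 0 j : R) x.
Proof.
split=> [dF j|dF].
  have := @differentiable_comp R _ _ _ F (fun M : 'rV[R]_n => M 0 j : R) x dF.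
  by apply; exact: differentiable_coord.
have -> : F = \sum_(j < n) (fun y => F y 0 j *: delta_mx 0 j).
  apply/funext => y; rewrite fct_sumE.
  by rewrite {1}[F y]row_sum_delta.
by apply: differentiable_sum => j; apply: differentiableZl.
Qed.

Lemma derive_row {R : realType} {V : normedModType R} n (F : V -> 'rV[R]_n) x v :
  derivable F x v ->
  forall j, ('D_v F x) 0 j = 'D_v (fun y => F y 0 j : R) x.
Proof. by move=> dF j; rewrite derive_mx// mxE. Qed.

Lemma has_derive_row {R : realType} m n (F : 'rV[R]_m -> 'rV[R]_n)
    x v j : differentiable F x ->
  has_derive x v (fun y => F y 0 j : R) (('D_v F x) 0 j).
Proof.
move=> dF; rewrite derive_row; last exact: diff_derivable.
by apply: differentiable_has_derive; move/differentiable_rowP: dF.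
Qed.

Lemma derive_partialE {R : realType} n (V : normedModType R) (F : 'rV[R]_n -> V)
    x v : differentiable F x -> 'D_v F x = \sum_i v 0 i *: partial i F x.
Proof.
move=> dF; rewrite deriveE// {1}(row_sum_delta v) linear_sum.
apply: eq_bigr => i _; rewrite linearZ /partial deriveE//.
Qed.

(** * Smoothness *)

Lemma near_eq_differentiable {R : realType} (V W : normedModType R)
    (f g : V -> W) x :
  (\near x, f x = g x) -> differentiable f x -> differentiable g x.
Proof.
move=> fg df.
have hx : f x = g x by exact: nbhs_singleton fg.
have ho : (g - f) \o shift x = cst ((g - f) x) + (\0 : {linear V -> W}) +o_ 0 id.
  apply/eqaddoP => e e0; rewrite !fctE /= hx subrr.
  have : \forall h \near 0, f (h + x) = g (h + x).
    by move: fg; rewrite (near_shift 0) subr0.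
  apply: filterS => h /= fgh.
  by rewrite /= fgh subrr addr0 subr0 normr0 mulr_ge0// ltW.
have h0 : 'd (g - f) x = (\0 : {linear V -> W}) :> (V -> W).
  by apply: diff_unique => //; exact: cst_continuous.
have dgf : differentiable (g - f) x.
  apply/diff_locallyP; rewrite h0; split=> //; exact: cst_continuous.
have -> : g = f + (g - f) by rewrite addrC subrK.
exact: differentiableD.
Qed.

(** Iterating derivatives one at a time gives a notion to which induction
    applies, and which coincides with the one that asks for all the iterated
    partial derivatives at once. *)
Fixpoint Cn {R : realType} {n : nat} {V : normedModType R} (k : nat)
    (U : set 'rV[R]_n) (F : 'rV[R]_n -> V) : Prop :=
  (forall x, U x -> differentiable F x) /\
  if k is k'.+1 then forall i, Cn k' U (partial i F) else True.

Section Cn_theory.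
Context {R : realType} {n : nat} {V : normedModType R}.
Implicit Types (F G : 'rV[R]_n -> V) (U : set 'rV[R]_n).

Lemma Cn_differentiable k U F : Cn k U F -> forall x, U x -> differentiable F x.
Proof. by case: k => [|k] []. Qed.

Lemma partials_rcons s i F : partials (rcons s i) F = partials s (partial i F).
Proof. by rewrite /partials -cats1 foldr_cat. Qed.

Lemma smooth_onP U F : smooth_on U F <-> forall k, Cn k U F.
Proof.
split=> [sF k|CF s].
  elim: k F sF => [|k IH] F sF /=; first by split=> // x; exact: (sF [::]).
  split=> [x|i]; first exact: (sF [::]).
  by apply: IH => s x Ux; rewrite -partials_rcons; exact: sF.
have {CF} := CF (size s).
elim/last_ind: s F => [|s i IH] F /=; first by case.
by rewrite size_rcons => -[_ /(_ i)/IH]; rewrite partials_rcons.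
Qed.

Lemma Cn_pred k U F : Cn k.+1 U F -> Cn k U F.
Proof.
elim: k F => [|k IH] F; first by case.
by case=> dF CF; split=> // i; exact: IH.
Qed.

Lemma partial_eq_on U F G : open U -> (forall x, U x -> F x = G x) ->
  forall i x, U x -> partial i F x = partial i G x.
Proof.
move=> Uo FG i x Ux; apply: near_eq_derive.
by apply: filterS (open_nbhs_nbhs (conj Uo Ux)).
Qed.

Lemma Cn_eq k U F G : open U -> (forall x, U x -> F x = G x) ->
  Cn k U F -> Cn k U G.
Proof.
move=> Uo; elim: k F G => [|k IH] F G FG [dF CF]; split.
- move=> x Ux; apply: near_eq_differentiable (dF x Ux).
  by apply: filterS (open_nbhs_nbhs (conj Uo Ux)).
- by [].
- move=> x Ux; apply: near_eq_differentiable (dF x Ux).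
  by apply: filterS (open_nbhs_nbhs (conj Uo Ux)).
- by move=> i; apply: IH (CF i) => x Ux; exact: (partial_eq_on Uo FG).
Qed.

Lemma smooth_on_eq U F G : open U -> (forall x, U x -> F x = G x) ->
  smooth_on U F -> smooth_on U G.
Proof.
by move=> Uo FG /smooth_onP CF; apply/smooth_onP => k; exact: Cn_eq (CF k).
Qed.

Lemma smooth_on_sub U U' F : U' `<=` U -> smooth_on U F -> smooth_on U' F.
Proof. by move=> U'U sF s x /U'U; exact: sF. Qed.

(** Smoothness is local, and only needs to be checked on a function that agrees
    with the given one near each point. *)
Lemma smooth_on_locally U F :
  (forall x, U x -> exists2 O, open O /\ O x &
     exists2 G, smooth_on O G & forall y, O y -> F y = G y) ->
  smooth_on U F.
Proof.
move=> H s x Ux; have [W [Wo Wx] [G sG FG]] := H x Ux.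
by apply: (smooth_on_eq Wo _ sG) => // y Wy; rewrite FG.
Qed.

Lemma smooth_on_differentiable U F : smooth_on U F ->
  forall x, U x -> differentiable F x.
Proof. by move=> sF x; exact: (sF [::]). Qed.

Lemma smooth_on_partial U F i : smooth_on U F -> smooth_on U (partial i F).
Proof. by move=> sF s x Ux; rewrite -partials_rcons; exact: sF. Qed.

End Cn_theory.

Section Cn_scalar.
Context {R : realType} {n : nat}.
Variable (U : set 'rV[R]_n).
Hypothesis Uo : open U.
Implicit Types (F G : 'rV[R]_n -> R).

Let has_derive_on k F x v : Cn k U F -> U x -> has_derive x v F ('D_v F x).
Proof. by move=> /Cn_differentiable dF Ux; apply/differentiable_has_derive/dF. Qed.

Lemma Cn_cst k (c : R) : Cn k U (fun=> c).
Proof.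
elim: k c => [|k IH] c; (split; first by move=> x _; exact: differentiable_cst).
  by [].
move=> i; apply: Cn_eq (IH 0) => // x _; rewrite /partial.
  by have [_ ->] := has_derive_cst c x (delta_mx 0 i).
Qed.

Lemma Cn_coord k (j : 'I_n) : Cn k U (fun x => x 0 j : R).
Proof.
case: k => [|k]; (split; first by move=> x _; exact: differentiable_coord).
  by [].
move=> i; apply: Cn_eq (Cn_cst k ((delta_mx 0 i : 'rV[R]_n) 0 j)) => // x _.
by rewrite /partial; have [_ ->] := has_derive_coord j x (delta_mx 0 i).
Qed.

Lemma CnD k F G : Cn k U F -> Cn k U G -> Cn k U (fun x => F x + G x).
Proof.
elim: k F G => [|k IH] F G CF CG; split=> //.
- by move=> x Ux; apply: differentiableD; [exact: (Cn_differentiable CF)|exact: (Cn_differentiable CG)].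
- by move=> x Ux; apply: differentiableD; [exact: (Cn_differentiable CF)|exact: (Cn_differentiable CG)].
move=> i; apply: Cn_eq (IH _ _ (CF.2 i) (CG.2 i)) => // x Ux.
rewrite /partial; symmetry.
by have [_ ->] := has_deriveD (has_derive_on (delta_mx 0 i) CF Ux)
  (has_derive_on (delta_mx 0 i) CG Ux).
Qed.

Lemma CnM k F G : Cn k U F -> Cn k U G -> Cn k U (fun x => F x * G x).
Proof.
elim: k F G => [|k IH] F G CF CG; split=> //.
- by move=> x Ux; apply: differentiableM; [exact: (Cn_differentiable CF)|exact: (Cn_differentiable CG)].
- by move=> x Ux; apply: differentiableM; [exact: (Cn_differentiable CF)|exact: (Cn_differentiable CG)].
move=> i.
apply: Cn_eq (CnD (IH _ _ (CF.2 i) (Cn_pred CG)) (IH _ _ (Cn_pred CF) (CG.2 i)));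
  first exact: Uo.
move=> x Ux; rewrite /partial; symmetry.
by have [_ ->] := has_deriveM (has_derive_on (delta_mx 0 i) CF Ux)
  (has_derive_on (delta_mx 0 i) CG Ux).
Qed.

(** One more derivative of a composite: the chain rule reduces it to the
    composite with the derivative. *)
Lemma Cn_compS k (h g : R -> R) F :
  (forall x, U x -> has_derive (F x) 1 h (g (F x))) ->
  Cn k.+1 U F -> Cn k U (fun x => g (F x)) -> Cn k.+1 U (fun x => h (F x)).
Proof.
move=> hg CF Cg; split=> [x Ux|i].
  apply: (@differentiable_comp _ _ _ _ F h); first exact: CF.1.
  by apply/derivable1_diffP; case: (hg x Ux).
apply: Cn_eq (CnM Cg (CF.2 i)) => // x Ux; rewrite /partial; symmetry.
by have [_ ->] := has_derive_comp (hg x Ux)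
  (has_derive_on (delta_mx 0 i) CF Ux).
Qed.

Lemma Cn_comp0 (h : R -> R) F :
  (forall x, U x -> derivable h (F x) 1) -> Cn 0 U F -> Cn 0 U (fun x => h (F x)).
Proof.
move=> hg CF; split=> // x Ux.
apply: (@differentiable_comp _ _ _ _ F h); first exact: CF.1.
exact/derivable1_diffP/hg.
Qed.

Lemma smooth_on_cst (c : R) : smooth_on U (fun=> c : R).
Proof. by apply/smooth_onP => k; exact: Cn_cst. Qed.

Lemma smooth_on_coord (j : 'I_n) : smooth_on U (fun x => x 0 j : R).
Proof. by apply/smooth_onP => k; exact: Cn_coord. Qed.

Lemma smooth_onD F G :
  smooth_on U F -> smooth_on U G -> smooth_on U (fun x => F x + G x).
Proof.
by move=> /smooth_onP CF /smooth_onP CG; apply/smooth_onP => k; exact: CnD.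
Qed.

Lemma smooth_onM F G :
  smooth_on U F -> smooth_on U G -> smooth_on U (fun x => F x * G x).
Proof.
by move=> /smooth_onP CF /smooth_onP CG; apply/smooth_onP => k; exact: CnM.
Qed.

Lemma smooth_onN F : smooth_on U F -> smooth_on U (fun x => - F x).
Proof.
move=> sF; apply: (smooth_on_eq Uo _ (smooth_onM (smooth_on_cst (-1)) sF)).
by move=> x _; rewrite mulN1r.
Qed.

Lemma smooth_onB F G :
  smooth_on U F -> smooth_on U G -> smooth_on U (fun x => F x - G x).
Proof. by move=> sF sG; apply: smooth_onD => //; exact: smooth_onN. Qed.

Lemma smooth_onX F k : smooth_on U F -> smooth_on U (fun x => F x ^+ k).
Proof.
move=> sF; elim: k => [|k IH].
  by apply: (smooth_on_eq Uo _ (smooth_on_cst 1)) => x _; rewrite expr0.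
by apply: (smooth_on_eq Uo _ (smooth_onM sF IH)) => x _; rewrite exprS.
Qed.

Lemma smooth_onV F : (forall x, U x -> F x != 0) ->
  smooth_on U F -> smooth_on U (fun x => (F x)^-1).
Proof.
move=> F0 /smooth_onP CF.
have hV x : U x -> has_derive (F x) 1 (GRing.inv : R -> R) (- ((F x)^-1 * (F x)^-1)).
  move=> Ux; have := @has_deriveV R R id (F x) 1 1 (F0 x Ux) (is_derive_id _ _).
  by rewrite mulN1r expr2 invfM.
apply/smooth_onP; elim=> [|k IH].
  by apply: (@Cn_comp0 GRing.inv) => // x Ux; case: (hV x Ux).
apply: (@Cn_compS k GRing.inv (fun y => - (y^-1 * y^-1))) => //.
have /smooth_onP := smooth_on_cst (-1).
move=> /(_ k) C1; apply: Cn_eq (CnM C1 (CnM IH IH)) => // x _.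
by rewrite mulN1r.
Qed.

Lemma smooth_on_expR F : smooth_on U F -> smooth_on U (fun x => expR (F x)).
Proof.
move=> /smooth_onP CF; apply/smooth_onP; elim=> [|k IH].
  by apply: (@Cn_comp0 expR) => // x _; exact: derivable_expR.
by apply: (@Cn_compS k expR expR) => // x _; exact: is_derive_expR.
Qed.

Lemma smooth_on_comp_interval (I : set R) (f : R -> R) F m :
  smooth_on_interval I f -> (forall x, U x -> I (F x)) ->
  smooth_on U F -> smooth_on U (fun x => (f^`(m))%classic (F x)).
Proof.
move=> sf IF /smooth_onP CF; apply/smooth_onP => k.
elim: k m => [|k IH] m.
  by apply: (@Cn_comp0 (f^`(m))%classic) => // x Ux; exact/sf/IF.
apply: (@Cn_compS k (f^`(m))%classic (f^`(m.+1))%classic) => // x Ux.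
rewrite derive1nS derive1E; apply: derivableP; exact/sf/IF.
Qed.

(** The primitive of a function is as smooth as the function, and one more. *)
Lemma smooth_on_comp_primitive (h g : R -> R) F :
  (forall x, U x -> has_derive (F x) 1 h (g (F x))) ->
  smooth_on U F -> smooth_on U (fun x => g (F x)) -> smooth_on U (fun x => h (F x)).
Proof.
move=> hg /smooth_onP CF /smooth_onP Cg; apply/smooth_onP => k.
by apply: Cn_pred; exact: (Cn_compS hg).
Qed.

End Cn_scalar.

Section smooth_row.
Context {R : realType} {m n : nat}.
Implicit Types (U : set 'rV[R]_m) (F : 'rV[R]_m -> 'rV[R]_n).

Lemma smooth_on_rowP U F : open U ->
  smooth_on U F <-> forall j, smooth_on U (fun x => F x 0 j : R).
Proof.
move=> Uo; split=> [/smooth_onP CF j|CF].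
  apply/smooth_onP => k; elim: k F {CF}(CF k) => [|k IH] F [dF CF].
    by split=> // x /dF/differentiable_rowP.
  split=> [x /dF/differentiable_rowP//|i].
  apply: Cn_eq (IH _ (CF i)) => // x Ux; rewrite /partial.
  by rewrite derive_row//; apply/diff_derivable/dF.
apply/smooth_onP => k.
have {}CF j : Cn k U (fun x => F x 0 j : R) by move/smooth_onP: (CF j).
elim: k F CF => [|k IH] F CF; split=> //.
- by move=> x Ux; apply/differentiable_rowP => j; exact: (Cn_differentiable (CF j)).
- by move=> x Ux; apply/differentiable_rowP => j; exact: (Cn_differentiable (CF j)).
move=> i; apply: IH => j; apply: Cn_eq ((CF j).2 i) => // x Ux.
rewrite /partial derive_row//; apply/diff_derivable/differentiable_rowP => l.
by exact: (Cn_differentiable (CF l)).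
Qed.

End smooth_row.

(** * Stereographic coordinates *)

Lemma ord2_cases (i : 'I_2) : i = 0 \/ i = 1.
Proof. by case: i; case=> [|[|//]] Hi; [left|right]; apply/val_inj. Qed.

Lemma ord3_cases (i : 'I_3) : i = 0 \/ i = 1 \/ i = 2%:R.
Proof.
by case: i; case=> [|[|[|//]]] Hi; [left|right; left|right; right]; apply/val_inj.
Qed.

Lemma row3E {R : realType} (x y z : R) :
  (row3 x y z 0 0 = x) * (row3 x y z 0 1 = y) * (row3 x y z 0 2%:R = z).
Proof. by rewrite /row3 !mxE. Qed.

Lemma row3P {R : realType} (p q : 'rV[R]_3) :
  p 0 0 = q 0 0 -> p 0 1 = q 0 1 -> p 0 2%:R = q 0 2%:R -> p = q.
Proof.
move=> h0 h1 h2; apply/rowP; case; case=> [|[|[|//]]] Hi.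
- by rewrite (_ : Ordinal Hi = 0) ?h0//; apply/val_inj.
- by rewrite (_ : Ordinal Hi = 1) ?h1//; apply/val_inj.
- by rewrite (_ : Ordinal Hi = 2%:R) ?h2//; apply/val_inj.
Qed.

Lemma row2P {R : realType} (p q : 'rV[R]_2) :
  p 0 0 = q 0 0 -> p 0 1 = q 0 1 -> p = q.
Proof.
move=> h0 h1; apply/rowP; case; case=> [|[|//]] Hi.
- by rewrite (_ : Ordinal Hi = 0) ?h0//; apply/val_inj.
- by rewrite (_ : Ordinal Hi = 1) ?h1//; apply/val_inj.
Qed.

Definition row2 {R : realType} (x y : R) : 'rV[R]_2 := \row_(i < 2) [:: x; y]`_i.

Lemma row2E {R : realType} (x y : R) :
  (row2 x y 0 0 = x) * (row2 x y 0 1 = y).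
Proof. by rewrite /row2 !mxE. Qed.

Section stereo.
Context {R : realType}.
Variable kappa : R.
Hypothesis hkappa : kappa = -1 \/ kappa = 0 \/ kappa = 1.
Implicit Types (u a c : 'rV[R]_2) (p v : 'rV[R]_3) (b : bool).

Definition sqn u : R := u 0 0 ^+ 2 + u 0 1 ^+ 2.
Definition dot2 u a : R := u 0 0 * a 0 0 + u 0 1 * a 0 1.

(** The differential of [stereo_inv] is [conf u] times an isometry. *)
Definition conf u : R := (1 + kappa * sqn u / 4)^-1.

(** The second chart is empty unless [kappa = 1]. *)
Definition stereo_region b : set 'rV[R]_2 :=
  [set u | 0 < 1 + kappa * sqn u / 4 /\ (b \/ kappa = 1)].

Definition stereo_dom b : set 'rV[R]_3 :=
  [set p | quadric kappa p /\ 0 < 1 + stereo_sign b * p 0 2%:R].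

Definition stereo_proj b p : 'rV[R]_2 :=
  row2 (2 * p 0 0 / (1 + stereo_sign b * p 0 2%:R))
       (2 * p 0 1 / (1 + stereo_sign b * p 0 2%:R)).

Definition tangent p v : Prop :=
  kappa * (p 0 0 * v 0 0 + p 0 1 * v 0 1) + p 0 2%:R * v 0 2%:R = 0.

(** The differentials of [stereo_inv] and of [stereo_proj]. *)
Definition dstereo b u a : 'rV[R]_3 :=
  row3 (conf u * a 0 0 - conf u ^+ 2 * kappa * dot2 u a / 2 * u 0 0)
       (conf u * a 0 1 - conf u ^+ 2 * kappa * dot2 u a / 2 * u 0 1)
       (- (stereo_sign b * conf u ^+ 2 * kappa * dot2 u a)).

Definition dproj b p v : 'rV[R]_2 :=
  let d := 1 + stereo_sign b * p 0 2%:R in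
  row2 (2 * v 0 0 / d - 2 * p 0 0 * (stereo_sign b * v 0 2%:R) / d ^+ 2)
       (2 * v 0 1 / d - 2 * p 0 1 * (stereo_sign b * v 0 2%:R) / d ^+ 2).

Lemma stereo_regionE b u : stereo_region b u ->
  exists2 w, conf u = w & [/\ 1 + kappa * sqn u / 4 = w^-1, 0 < w &
   kappa * sqn u = 4 * (w^-1 - 1)].
Proof.
move=> [h _]; exists (conf u) => //; split.
- by rewrite /conf invrK.
- by rewrite invr_gt0.
- by rewrite /conf invrK; lra.
Qed.

Lemma stereo_invE b u : stereo_inv kappa b u =
  row3 (u 0 0 * conf u) (u 0 1 * conf u)
    (stereo_sign b * ((1 - kappa * sqn u / 4) * conf u)).
Proof. by []. Qed.

Lemma stereo_signX b : stereo_sign b ^+ 2 = 1 :> R.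
Proof. by case: b; rewrite /stereo_sign ?sqrrN expr1n. Qed.

Lemma stereo_signK b (x : R) : stereo_sign b * (stereo_sign b * x) = x.
Proof. by rewrite mulrA -expr2 stereo_signX mul1r. Qed.

Lemma stereo_signNK b (x y z : R) :
  stereo_sign b * - (stereo_sign b * x * y * z) = - (x * y * z).
Proof. by rewrite mulrN -!mulrA stereo_signK. Qed.

Lemma stereo_inv_quadric b u :
  stereo_region b u -> quadric kappa (stereo_inv kappa b u).
Proof.
move=> ru; have [w wE [_ w0 sE]] := stereo_regionE ru.
rewrite /quadric stereo_invE /= !row3E wE; split.
  rewrite !exprMn stereo_signX mul1r -mulrDl.
  rewrite mulrA -[_ ^+ 2 + _]/(sqn u) sE.
  by field; rewrite gt_eqF.
move=> k0; case: ru => _ []; last by lra.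
move=> ->; rewrite /stereo_sign mul1r mulr_gt0// sE.
case: hkappa sE => [k|[k|k]]; rewrite ?k; last by rewrite k in k0; lra.
  rewrite mulN1r => sE.
  have : 0 <= sqn u by rewrite /sqn addr_ge0 ?sqr_ge0.
  by have := invr_gt0 w; rewrite w0; lra.
by rewrite mul0r => sE; lra.
Qed.

Lemma stereo_inv_conf b u : stereo_region b u ->
  1 + stereo_sign b * stereo_inv kappa b u 0 2%:R = 2 * conf u.
Proof.
move=> ru; have [w wE [_ w0 sE]] := stereo_regionE ru.
by rewrite stereo_invE row3E stereo_signK wE sE; field; rewrite gt_eqF.
Qed.

Lemma conf_gt0 b u : stereo_region b u -> 0 < conf u.
Proof. by move=> ru; have [w -> []] := stereo_regionE ru. Qed.

Lemma stereo_inv_dom b u :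
  stereo_region b u -> stereo_dom b (stereo_inv kappa b u).
Proof.
move=> ru; split; first exact: stereo_inv_quadric.
by rewrite stereo_inv_conf// mulr_gt0// (conf_gt0 ru).
Qed.

Lemma stereo_projK b u :
  stereo_region b u -> stereo_proj b (stereo_inv kappa b u) = u.
Proof.
move=> ru; have w0 := conf_gt0 ru.
apply: row2P; rewrite row2E stereo_inv_conf// stereo_invE row3E;
  by move: w0; set w := conf u => w0; field; rewrite gt_eqF.
Qed.

Lemma stereo_dom_sign b p : stereo_dom b p -> b \/ kappa = 1.
Proof.
case: b => [|[[Q pos]]]; first by left.
rewrite /stereo_sign mulN1r => z1; right.
case: hkappa => [k|[k|//]]; rewrite k in Q pos.
  have zp : 0 < p 0 2%:R by apply: pos; rewrite lerN10.
  have : 0 < (1 - p 0 2%:R) * (1 + p 0 2%:R) by rewrite mulr_gt0// addr_gt0.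
  rewrite -subr_sqr expr1n => H.
  have := sqr_ge0 (p 0 0); have := sqr_ge0 (p 0 1).
  by move: Q H; set X := _ ^+ 2; set Y := _ ^+ 2; set Z := _ ^+ 2; lra.
have zp : 0 < p 0 2%:R by apply: pos; rewrite lexx.
have : 0 < (1 - p 0 2%:R) * (1 + p 0 2%:R) by rewrite mulr_gt0// addr_gt0.
by move: Q; rewrite -subr_sqr expr1n mul0r add0r => ->; rewrite subrr ltxx.
Qed.

Lemma stereo_proj_conf b p : stereo_dom b p ->
  1 + kappa * sqn (stereo_proj b p) / 4 = 2 / (1 + stereo_sign b * p 0 2%:R).
Proof.
move=> [[Q _] d0]; rewrite /sqn !row2E.
have e2 := @stereo_signX b; move: d0 e2; set e := stereo_sign b => d0 e2.
rewrite (_ : kappa * _ / 4 = kappa * (p 0 0 ^+ 2 + p 0 1 ^+ 2) / (1 + e * p 0 2%:R) ^+ 2);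
  last by field; rewrite gt_eqF.
rewrite (_ : kappa * _ = (1 - e * p 0 2%:R) * (1 + e * p 0 2%:R)); last first.
  by apply: (addIr (p 0 2%:R ^+ 2)); rewrite Q -subr_sqr expr1n exprMn e2 mul1r subrK.
by field; rewrite gt_eqF.
Qed.

Lemma stereo_proj_region b p : stereo_dom b p -> stereo_region b (stereo_proj b p).
Proof.
move=> dp; split; last exact: stereo_dom_sign dp.
by rewrite stereo_proj_conf// divr_gt0//; case: dp.
Qed.

Lemma stereo_invK b p : stereo_dom b p -> stereo_inv kappa b (stereo_proj b p) = p.
Proof.
move=> dp; have cE := stereo_proj_conf dp.
have kE : kappa * sqn (stereo_proj b p) / 4 = 2 / (1 + stereo_sign b * p 0 2%:R) - 1.
  by rewrite -cE; ring.
have d0 : 1 + stereo_sign b * p 0 2%:R != 0 by rewrite gt_eqF//; case: dp.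
have e2 := @stereo_signX b.
apply: row3P; rewrite stereo_invE /conf !row3E kE ?row2E.
- by field; rewrite d0 /=; apply/eqP; lra.
- by field; rewrite d0 /=; apply/eqP; lra.
- rewrite -[RHS](stereo_signK b); congr (_ * _).
  by field; rewrite d0 /=; apply/eqP; lra.
Qed.

Lemma dprojK b u a : stereo_region b u ->
  dproj b (stereo_inv kappa b u) (dstereo b u a) = a.
Proof.
move=> ru; have w0 := conf_gt0 ru; have [w wE [_ _ sE]] := stereo_regionE ru.
apply: row2P; rewrite /dproj /= row2E stereo_inv_conf// stereo_invE !row3E
  stereo_signNK wE; by move: w0; rewrite wE => w0; field; rewrite gt_eqF.
Qed.

Lemma dstereo_inj b u : stereo_region b u -> injective (dstereo b u).
Proof. by move=> ru a c ac; rewrite -(dprojK a ru) ac dprojK. Qed.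

Lemma dstereo_tangent b u a : stereo_region b u ->
  tangent (stereo_inv kappa b u) (dstereo b u a).
Proof.
move=> ru; have w0 := conf_gt0 ru; have [w wE [_ _ sE]] := stereo_regionE ru.
have {}sE : kappa * sqn u * w = 4 * (1 - w).
  by rewrite sE; field; rewrite -wE gt_eqF.
rewrite /tangent stereo_invE !row3E wE.
rewrite -(mulrA (stereo_sign b)) [X in _ + X](_ : _ =
  (1 - kappa * sqn u / 4) * w * (stereo_sign b * - (stereo_sign b * w ^+ 2 * kappa * dot2 u a)));
  last by ring.
rewrite stereo_signNK.
rewrite (_ : _ + _ = kappa * dot2 u a * w ^+ 2 * (1 - (kappa * sqn u * w) / 4 - w)).
  by rewrite sE; field.
by rewrite /dot2 /sqn; field.
Qed.

Lemma dstereo_dproj b p v : stereo_dom b p -> tangent p v ->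
  dstereo b (stereo_proj b p) (dproj b p v) = v.
Proof.
move=> dp; have [[Q pos] d0] := dp.
have cE : conf (stereo_proj b p) = (1 + stereo_sign b * p 0 2%:R) / 2.
  by rewrite /conf stereo_proj_conf// invf_div.
rewrite /tangent => tv.
have e2 := @stereo_signX b; have eK := @stereo_signK b.
have := stereo_proj_conf dp.
rewrite /dproj /dstereo cE; move: d0 e2 eK; set e := stereo_sign b => d0 e2 eK.
have dn0 : 1 + e * p 0 2%:R != 0 by rewrite gt_eqF.
have Q1 : kappa * (p 0 0 ^+ 2 + p 0 1 ^+ 2) = (1 - e * p 0 2%:R) * (1 + e * p 0 2%:R).
  apply: (addIr (p 0 2%:R ^+ 2)).
  by rewrite Q -subr_sqr expr1n exprMn e2 mul1r subrK.
have tv1 : kappa * (p 0 0 * v 0 0 + p 0 1 * v 0 1) = - (e * p 0 2%:R * (e * v 0 2%:R)).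
  by rewrite mulrACA -expr2 e2 mul1r; lra.
move=> _; set a := row2 _ _.
have aE : kappa * dot2 (stereo_proj b p) a = - (4 * (e * v 0 2%:R)) / (1 + e * p 0 2%:R) ^+ 2.
  rewrite /dot2 !row2E /=.
  rewrite (_ : kappa * _ = 4 * (kappa * (p 0 0 * v 0 0 + p 0 1 * v 0 1)) / (1 + e * p 0 2%:R) ^+ 2
    - 4 * (kappa * (p 0 0 ^+ 2 + p 0 1 ^+ 2)) * (e * v 0 2%:R) / (1 + e * p 0 2%:R) ^+ 3);
    last by rewrite -/e; field.
  by rewrite Q1 tv1; field.
have aE' : ((1 + e * p 0 2%:R) / 2) ^+ 2 * kappa * dot2 (stereo_proj b p) a = - (e * v 0 2%:R).
  by rewrite -mulrA aE; field.
apply: row3P; rewrite !row3E ?aE'.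
- by rewrite /a !row2E -/e; field.
- by rewrite /a !row2E -/e; field.
- by rewrite -!mulrA; move: aE'; rewrite -!mulrA => ->; rewrite mulrN eK opprK.
Qed.

Lemma dstereo_form b u a c : stereo_region b u ->
  ambient_form kappa (dstereo b u a) (dstereo b u c) = conf u ^+ 2 * dot2 a c.
Proof.
move=> ru; have w0 := conf_gt0 ru; have [w wE [_ _ sE]] := stereo_regionE ru.
have {}sE : kappa * sqn u * w = 4 * (1 - w).
  by rewrite sE; field; rewrite -wE gt_eqF.
have k3 : kappa ^+ 3 = kappa.
  by case: hkappa => [k|[k|k]]; rewrite k; ring.
rewrite /ambient_form !row3E wE.
have -> : kappa * (- (stereo_sign b * w ^+ 2 * kappa * dot2 u a) *
   - (stereo_sign b * w ^+ 2 * kappa * dot2 u c)) =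
   stereo_sign b ^+ 2 * kappa ^+ 3 * w ^+ 4 * dot2 u a * dot2 u c by ring.
rewrite stereo_signX k3.
have z0 : kappa * sqn u * w / 4 - 1 + w = 0 by rewrite sE; field.
rewrite -[RHS]addr0 -(mulr0 (w ^+ 3 * kappa * dot2 u a * dot2 u c)) -z0.
by rewrite /dot2 /sqn; field.
Qed.

End stereo.

Section stereo_calculus.
Context {R : realType}.
Variable kappa : R.
Hypothesis hkappa : kappa = -1 \/ kappa = 0 \/ kappa = 1.
Implicit Types (b : bool).

(** The Christoffel symbols of the round metric contracted with two vectors:
    the metric is conformal to the Euclidean one, with factor [conf ^+ 2]. *)
Definition round_christoffel (u a w : 'rV[R]_2) : 'rV[R]_2 :=
  let g := - (kappa * conf kappa u / 2) in
  row2 (g * (dot2 u a * w 0 0 + dot2 u w * a 0 0 - dot2 a w * u 0 0))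
       (g * (dot2 u a * w 0 1 + dot2 u w * a 0 1 - dot2 a w * u 0 1)).

Section along.
Context {V : normedModType R}.
Variables (c W : V -> 'rV[R]_2) (x v : V) (a W' : 'rV[R]_2).
Hypothesis hc : forall j, has_derive x v (fun y => c y 0 j : R) (a 0 j).
Hypothesis hW : forall j, has_derive x v (fun y => W y 0 j : R) (W' 0 j).
Variable b : bool.
Hypothesis rc : stereo_region kappa b (c x).

Lemma has_derive_sqn : has_derive x v (fun y => sqn (c y)) (2 * dot2 (c x) a).
Proof.
rewrite /sqn; apply: has_derive_conv; eexists.
  by apply: has_deriveD; apply: has_deriveX; exact: hc.
by rewrite /dot2 /=; ring.
Qed.

Lemma has_derive_conf : has_derive x v (fun y => conf kappa (c y))
  (- (conf kappa (c x) ^+ 2 * kappa * dot2 (c x) a / 2)).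
Proof.
apply: has_derive_conv; eexists.
  apply: (@has_deriveV R V (fun y => 1 + kappa * sqn (c y) / 4)).
    by rewrite gt_eqF//; case: rc.
  apply: has_deriveD; first exact: has_derive_cst.
  apply: has_deriveM; last exact: has_derive_cst.
  by apply: has_deriveM; [exact: has_derive_cst|exact: has_derive_sqn].
have : 1 + kappa * sqn (c x) / 4 != 0 by rewrite gt_eqF//; case: rc.
by rewrite /conf; set d := 1 + _ => d0; field.
Qed.

Lemma has_derive_dot2 (F G : V -> 'rV[R]_2) (dF dG : 'rV[R]_2) :
  (forall j, has_derive x v (fun y => F y 0 j : R) (dF 0 j)) ->
  (forall j, has_derive x v (fun y => G y 0 j : R) (dG 0 j)) ->
  has_derive x v (fun y => dot2 (F y) (G y)) (dot2 dF (G x) + dot2 (F x) dG).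
Proof.
move=> hF hG; rewrite {1}/dot2; apply: has_derive_conv; eexists.
  by apply: has_deriveD; apply: has_deriveM; [exact: hF|exact: hG|exact: hF|exact: hG].
by rewrite /dot2; ring.
Qed.

Lemma has_derive_stereo k :
  has_derive x v (fun y => stereo_inv kappa b (c y) 0 k : R)
    (dstereo kappa b (c x) a 0 k).
Proof.
have w0 := conf_gt0 rc; have [w wE [_ _ sE]] := stereo_regionE rc.
have comp j : has_derive x v (fun y => c y 0 j * conf kappa (c y))
  (conf kappa (c x) * a 0 j
     - conf kappa (c x) ^+ 2 * kappa * dot2 (c x) a / 2 * c x 0 j).
  apply: has_derive_conv; eexists; first by apply: has_deriveM; [exact: hc|exact: has_derive_conf].
  by cbv beta; field.
have [->|[->|->]] := ord3_cases k.
- rewrite [X in has_derive _ _ X](_ : _ = (fun y => c y 0 0 * conf kappa (c y))).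
    by rewrite row3E; exact: comp.
  by apply/funext => y; rewrite stereo_invE row3E.
- rewrite [X in has_derive _ _ X](_ : _ = (fun y => c y 0 1 * conf kappa (c y))).
    by rewrite row3E; exact: comp.
  by apply/funext => y; rewrite stereo_invE row3E.
rewrite [X in has_derive _ _ X](_ : _ = (fun y => stereo_sign b *
   ((1 - kappa * sqn (c y) / 4) * conf kappa (c y)))); last first.
  by apply/funext => y; rewrite stereo_invE row3E.
rewrite row3E; apply: has_derive_conv; eexists.
  apply: has_deriveM; first exact: has_derive_cst.
  apply: has_deriveM; last exact: has_derive_conf.
  apply: has_deriveB; first exact: has_derive_cst.
  apply: has_deriveM; last exact: has_derive_cst.
  by apply: has_deriveM; [exact: has_derive_cst|exact: has_derive_sqn].
by cbv beta; rewrite sE wE; field; rewrite -wE gt_eqF.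
Qed.

(** The second derivative of the inclusion of the quadric splits into the
    tangential part, given by the Christoffel symbols, and the normal part,
    given by the second fundamental form. *)
Lemma has_derive_dstereo k :
  has_derive x v (fun y => dstereo kappa b (c y) (W y) 0 k : R)
    (dstereo kappa b (c x) (W' + round_christoffel (c x) a (W x)) 0 k
     - kappa * conf kappa (c x) ^+ 2 * dot2 a (W x)
         * stereo_inv kappa b (c x) 0 k).
Proof.
have w0 := conf_gt0 rc; have [w wE [_ _ sE]] := stereo_regionE rc.
have hdot := has_derive_dot2 hc hW.
have hcoef : has_derive x v
    (fun y => conf kappa (c y) ^+ 2 * kappa * dot2 (c y) (W y))
    (- (w ^+ 3 * kappa ^+ 2 * dot2 (c x) a) * dot2 (c x) (W x)
     + w ^+ 2 * kappa * (dot2 a (W x) + dot2 (c x) W')).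
  apply: has_derive_conv; eexists.
    apply: has_deriveM; last exact: hdot.
    apply: has_deriveM; last exact: has_derive_cst.
    by apply: has_deriveX; exact: has_derive_conf.
  by cbv beta; rewrite wE /=; field.
have {sE} : kappa * sqn (c x) * w = 4 * (1 - w).
  by rewrite sE; field; rewrite -wE gt_eqF.
set s := kappa * sqn (c x) => sE.
have z0 : s * w / 4 - 1 + w = 0 by rewrite sE; field.
have comp j : (j == 0) || (j == 1) -> has_derive x v (fun y => conf kappa (c y) * W y 0 j
   - conf kappa (c y) ^+ 2 * kappa * dot2 (c y) (W y) / 2 * c y 0 j)
  ((conf kappa (c x) * (W' + round_christoffel (c x) a (W x)) 0 j
     - conf kappa (c x) ^+ 2 * kappa * dot2 (c x) (W' + round_christoffel (c x) a (W x)) / 2 * c x 0 j)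
    - kappa * conf kappa (c x) ^+ 2 * dot2 a (W x) * (c x 0 j * conf kappa (c x))).
  move=> j01; apply: has_derive_conv; eexists.
    apply: has_deriveB.
      by apply: has_deriveM; [exact: has_derive_conf|exact: hW].
    apply: has_deriveM; last exact: hc.
    by apply: has_deriveM; [exact: hcoef|exact: has_derive_cst].
  cbv beta; rewrite wE -[RHS]addr0
    -[X in _ = _ + X](mulr0 (w ^+ 2 * kappa * dot2 a (W x) * c x 0 j)) -[X in _ = _ + _ * X]z0.
  have -> : round_christoffel (c x) a (W x) = row2
    (round_christoffel (c x) a (W x) 0 0) (round_christoffel (c x) a (W x) 0 1).
    by apply: row2P; rewrite !row2E.
  move: j01; rewrite /s /round_christoffel /= wE /sqn.
  by case/orP => /eqP ->; rewrite /dot2 ![(_ + row2 _ _) _ _]mxE !row2E; field.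
have [->|[->|->]] := ord3_cases k.
- rewrite [X in has_derive _ _ X](_ : _ = (fun y => conf kappa (c y) * W y 0 0
     - conf kappa (c y) ^+ 2 * kappa * dot2 (c y) (W y) / 2 * c y 0 0)).
    by rewrite stereo_invE !row3E; exact: comp.
  by apply/funext => y; rewrite row3E.
- rewrite [X in has_derive _ _ X](_ : _ = (fun y => conf kappa (c y) * W y 0 1
     - conf kappa (c y) ^+ 2 * kappa * dot2 (c y) (W y) / 2 * c y 0 1)).
    by rewrite stereo_invE !row3E; exact: comp.
  by apply/funext => y; rewrite row3E.
rewrite [X in has_derive _ _ X](_ : _ = (fun y => - (stereo_sign b *
   (conf kappa (c y) ^+ 2 * kappa * dot2 (c y) (W y))))); last first.
  by apply/funext => y; rewrite row3E; ring.
rewrite stereo_invE !row3E; apply: has_derive_conv; eexists.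
  apply: has_deriveN; apply: has_deriveM; first exact: has_derive_cst.
  exact: hcoef.
cbv beta; rewrite wE.
have -> : round_christoffel (c x) a (W x) = row2
    (round_christoffel (c x) a (W x) 0 0) (round_christoffel (c x) a (W x) 0 1).
  by apply: row2P; rewrite !row2E.
rewrite -[RHS]addr0
  -[X in _ = _ + X](mulr0 (stereo_sign b * w ^+ 2 * kappa * dot2 a (W x)))
  -[X in _ = _ + _ * X]z0.
by rewrite /s /round_christoffel /= wE /sqn /dot2 ![(_ + row2 _ _) _ _]mxE !row2E; field.
Qed.

End along.
End stereo_calculus.

(** * The ambient space in coordinates *)

Lemma continuous_at_set_type {X Y : topologicalType} (A : set X) (G : Y -> A) y :
  {for y, continuous (fun z => \val (G z) : X)} -> {for y, continuous G}.
Proof.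
move=> cG U; rewrite /continuous_at nbhsE => -[W [[V Vo VW] WGy] WU].
have VG : V (\val (G y)) by move: WGy; rewrite -VW.
have : nbhs y [set z | V (\val (G z))] by exact: cG _ (open_nbhs_nbhs (conj Vo VG)).
by rewrite /=; apply: (@filterS _ (nbhs y)) => z Vz; apply: WU; rewrite -VW.
Qed.

Lemma continuous_rowP {R : realType} {X : topologicalType} n (F : X -> 'rV[R]_n) x :
  (forall j, {for x, continuous (fun y => F y 0 j : R)}) -> {for x, continuous F}.
Proof.
move=> cF; rewrite (_ : F = \sum_(j < n) (fun y => F y 0 j *: delta_mx 0 j)); last first.
  by apply/funext => y; rewrite fct_sumE {1}[F y]row_sum_delta.
apply: (big_ind (fun g : X -> 'rV[R]_n => {for x, continuous g})).
- exact: cst_continuous.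
- by move=> g h cg ch; exact: continuousD.
- by move=> j _; apply: cvgZr_tmp; exact: cF.
Qed.

(** Charts with open images and continuous inverses suffice to compare
    functions on the manifold with their expressions in the charts. *)
Definition good_charts {R : realType} {m : nat} (M : manifold R m) : Prop :=
  forall i : idx M, open (chart_image i) /\
    forall u, chart_image i u -> {for u, continuous (chart_inv i)}.

Lemma smooth_manifold_good {R : realType} {m : nat} (M : manifold R m) :
  smooth_manifold M -> good_charts M.
Proof. by case=> _ _ ho hc _ i; split; [case: (ho i)|case: (hc i)]. Qed.

Section ambient.
Context {R : realType}.
Variable kappa : R.
Hypothesis hkappa : kappa = -1 \/ kappa = 0 \/ kappa = 1.
Variables (I : set R) (I0 : I !=set0) (f : R -> R).
Hypothesis I_open : open I.
Notation P := (warped_product (space_form kappa) f I0).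
Implicit Types (p : P) (k : idx P).

Definition pos p : 'rV[R]_3 := \val p.1.
Definition height p : R := \val p.2.

Lemma pos_quadric p : quadric kappa (pos p).
Proof. by rewrite /pos; case: p.1 => x /= /set_mem. Qed.

Lemma height_in p : I (height p).
Proof. by rewrite /height; case: p.2 => x /= /set_mem. Qed.

Lemma ambient_eq p q : pos p = pos q -> height p = height q -> p = q.
Proof.
case: p q => [p1 p2] [q1 q2]; rewrite /pos /height /= => h1 h2.
by congr (_, _); apply: val_inj.
Qed.

Definition hor (v : 'rV[R]_(2 + 1)) : 'rV[R]_2 := lsubmx v.
Definition ver (v : 'rV[R]_(2 + 1)) : R := rsubmx v 0 0.

Lemma horE v j : hor v 0 j = v 0 (lshift 1 j).
Proof. by rewrite /hor mxE. Qed.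

Lemma verE v : ver v = v 0 (rshift 2 0).
Proof. by rewrite /ver mxE. Qed.

Lemma chart_domE k p : chart_dom k p <-> stereo_dom kappa k.1 (pos p).
Proof.
split=> [[d _]|[_ d]]; first by split; [exact: pos_quadric|exact: d].
by split.
Qed.

Lemma chart_mapE k p :
  chart_map k p = row_mx (stereo_proj k.1 (pos p)) (const_mx (height p)).
Proof.
rewrite /=; congr row_mx.
apply: row2P; rewrite !mxE /=; congr (2 * (\val p.1) 0 _ / _); exact/val_inj.
Qed.

Lemma hor_row (a : 'rV[R]_2) (s : R) : hor (row_mx a (const_mx s)) = a.
Proof. by rewrite /hor row_mxKl. Qed.

Lemma ver_row (a : 'rV[R]_2) (s : R) : ver (row_mx a (const_mx s)) = s.
Proof. by rewrite /ver row_mxKr mxE. Qed.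

Lemma row_hor_ver v : row_mx (hor v) (const_mx (ver v)) = v.
Proof.
rewrite -[RHS]hsubmxK; congr row_mx.
by apply/rowP => j; rewrite !ord1 mxE.
Qed.

(** The image of the chart [k]. *)
Definition ambient_region k : set 'rV[R]_(2 + 1) :=
  [set v | stereo_region kappa k.1 (hor v) /\ I (ver v)].

Lemma pos_chart_inv k v : ambient_region k v ->
  pos (chart_inv k v) = stereo_inv kappa k.1 (hor v).
Proof.
move=> [rv _]; rewrite /pos /=.
have q : stereo_inv kappa k.1 (hor v) \in quadric kappa.
  exact/mem_set/stereo_inv_quadric.
by rewrite val_insubd q.
Qed.

Lemma height_chart_inv k v : ambient_region k v -> height (chart_inv k v) = ver v.
Proof.
by move=> [_ Iv]; rewrite /height /= val_insubd mem_set.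
Qed.

Lemma chart_imageE k v : chart_image k v <-> ambient_region k v.
Proof.
split=> [[p dp <-]|rv].
  rewrite chart_mapE; split; rewrite ?hor_row ?ver_row.
    exact/(stereo_proj_region hkappa)/chart_domE.
  exact: height_in.
exists (chart_inv k v).
  by apply/chart_domE; rewrite pos_chart_inv//; apply: stereo_inv_dom => //; case: rv.
rewrite chart_mapE pos_chart_inv// height_chart_inv// stereo_projK ?row_hor_ver//.
by case: rv.
Qed.

Lemma chart_invK k p : chart_dom k p -> chart_inv k (chart_map k p) = p.
Proof.
move=> dp; have im : chart_image k (chart_map k p) by exists p.
move/chart_imageE: im => im.
apply: ambient_eq.
  rewrite pos_chart_inv// chart_mapE hor_row stereo_invK//.
  exact/chart_domE.
by rewrite height_chart_inv// chart_mapE ver_row.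
Qed.

Lemma has_derive_hor (v x : 'rV[R]_(2 + 1)) j :
  has_derive x v (fun y => hor y 0 j) (hor v 0 j).
Proof.
rewrite [X in has_derive _ _ X](_ : _ = (fun y : 'rV_(2 + 1) => y 0 (lshift 1 j))).
  by rewrite /hor mxE; exact: has_derive_coord.
by apply/funext => y; rewrite /hor mxE.
Qed.

Lemma has_derive_ver (v x : 'rV[R]_(2 + 1)) :
  has_derive x v (fun y => ver y) (ver v).
Proof.
rewrite [X in has_derive _ _ X](_ : _ = (fun y : 'rV_(2 + 1) => y 0 (rshift 2 0))).
  by rewrite /ver mxE; exact: has_derive_coord.
by apply/funext => y; rewrite /ver mxE.
Qed.

Lemma smooth_on_stereo_region n (U : set 'rV[R]_n) b (c : 'rV[R]_n -> 'rV[R]_2) :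
  open U -> (forall x, U x -> stereo_region kappa b (c x)) ->
  (forall j, smooth_on U (fun y => c y 0 j : R)) ->
  forall j, smooth_on U (fun y => stereo_inv kappa b (c y) 0 j : R).
Proof.
move=> Uo rc sc.
have ssq : smooth_on U (fun y => kappa * sqn (c y) / 4).
  apply: smooth_onM => //; last exact: smooth_on_cst.
  apply: smooth_onM => //; first exact: smooth_on_cst.
  by apply: smooth_onD => //; apply: smooth_onX.
have sconf : smooth_on U (fun y => conf kappa (c y)).
  apply: smooth_onV => // [x /rc [h _]|]; first by rewrite gt_eqF.
  by apply: smooth_onD => //; exact: smooth_on_cst.
move=> k.
have [->|[->|->]] := ord3_cases k.
- apply: (smooth_on_eq Uo _ (smooth_onM Uo (sc 0) sconf)) => x _.
  by rewrite stereo_invE row3E.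
- apply: (smooth_on_eq Uo _ (smooth_onM Uo (sc 1) sconf)) => x _.
  by rewrite stereo_invE row3E.
have s1 := smooth_onB Uo (smooth_on_cst Uo 1) ssq.
apply: (smooth_on_eq Uo _ (smooth_onM Uo (smooth_on_cst Uo (stereo_sign b))
  (smooth_onM Uo s1 sconf))) => x _.
by rewrite stereo_invE row3E.
Qed.

Lemma open_stereo_region b : open (stereo_region kappa b).
Proof.
have [bk|nbk] := pselect (b \/ kappa = 1); last first.
  rewrite (_ : stereo_region _ _ = set0); first exact: open0.
  by rewrite -subset0 => u [_ /nbk].
rewrite (_ : stereo_region _ _ = [set u | 0 < 1 + kappa * sqn u / 4]); last first.
  by apply/seteqP; split=> u // [].
apply: (@open_comp _ _ (fun u : 'rV[R]_2 => 1 + kappa * sqn u / 4) [set y | 0 < y]);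
  last exact: open_gt.
move=> u _; apply: differentiable_continuous.
have s : smooth_on setT (fun u : 'rV[R]_2 => 1 + kappa * sqn u / 4).
  apply: smooth_onD; [exact: openT|exact: smooth_on_cst openT _|].
  apply: smooth_onM; [exact: openT| |exact: smooth_on_cst openT _].
  apply: smooth_onM; [exact: openT|exact: smooth_on_cst openT _|].
  by apply: smooth_onD; [exact: openT| |];
    apply: smooth_onX; [exact: openT|exact: smooth_on_coord openT _|exact: openT|exact: smooth_on_coord openT _].
exact: (smooth_on_differentiable s).
Qed.

Lemma open_ambient_region k : open (ambient_region k).
Proof.
apply: openI.
  apply: (@open_comp _ _ hor (stereo_region kappa k.1)); last exact: open_stereo_region.
  by move=> v _; apply: continuous_lsubmx.
apply: (@open_comp _ _ ver I) => //.
move=> v _; apply: differentiable_continuous.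
rewrite (_ : ver = (fun y : 'rV_(2 + 1) => y 0 (rshift 2 0))).
  exact: differentiable_coord.
by apply/funext => y; rewrite /ver mxE.
Qed.

Lemma smooth_on_hor (U : set 'rV[R]_(2 + 1)) j : open U ->
  smooth_on U (fun y => hor y 0 j : R).
Proof.
move=> Uo; apply: (smooth_on_eq Uo _ (smooth_on_coord Uo (lshift 1 j))) => x _.
by rewrite /hor mxE.
Qed.

Lemma smooth_on_ver (U : set 'rV[R]_(2 + 1)) : open U -> smooth_on U (fun y => ver y : R).
Proof.
move=> Uo; apply: (smooth_on_eq Uo _ (smooth_on_coord Uo (rshift 2 0))) => x _.
by rewrite /ver mxE.
Qed.

Lemma smooth_on_pos_chart_inv k j :
  smooth_on (ambient_region k) (fun v => pos (chart_inv k v) 0 j : R).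
Proof.
have Uo := @open_ambient_region k.
apply: (smooth_on_eq Uo (F := fun v => stereo_inv kappa k.1 (hor v) 0 j)).
  by move=> v rv; rewrite pos_chart_inv.
apply: smooth_on_stereo_region => //; first by move=> v [].
by move=> i; exact: smooth_on_hor.
Qed.

Lemma smooth_on_height_chart_inv k :
  smooth_on (ambient_region k) (fun v => height (chart_inv k v) : R).
Proof.
have Uo := @open_ambient_region k.
apply: (smooth_on_eq Uo (F := fun v => ver v)); last exact: smooth_on_ver.
by move=> v rv; rewrite height_chart_inv.
Qed.

(** A map into the ambient space is continuous as soon as its position and its
    height are. *)
Lemma continuous_ambient (X : topologicalType) (G : X -> P) x :
  (forall j, {for x, continuous (fun y => pos (G y) 0 j : R)}) ->
  {for x, continuous (fun y => height (G y) : R)} -> {for x, continuous G}.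
Proof.
move=> cp ch.
have c1 : {for x, continuous (fun y => (G y).1)}.
  by apply: continuous_at_set_type; exact: continuous_rowP.
have c2 : {for x, continuous (fun y => (G y).2)}.
  by apply: continuous_at_set_type; exact: ch.
rewrite (_ : G = (fun y => ((G y).1, (G y).2))); first exact: cvg_pair c1 c2.
by apply/funext => y; case: (G y).
Qed.

Lemma continuous_pos j : continuous (fun p => pos p 0 j : R).
Proof.
move=> p; apply: (@continuous_comp _ _ _ (fun p : P => \val p.1 : 'rV[R]_3)
  (fun y => y 0 j)); last exact: coord_continuous.
apply: (@continuous_comp _ _ _ (fun p : P => p.1)); first exact: cvg_fst.
exact: initial_continuous.
Qed.

Lemma continuous_height : continuous (fun p => height p : R).
Proof.
move=> p; apply: (@continuous_comp _ _ _ (fun p : P => p.2)); first exact: cvg_snd.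
exact: initial_continuous.
Qed.

Lemma open_ambient_dom k : open (chart_dom k : set P).
Proof.
rewrite (_ : chart_dom k = [set p : P | 0 < 1 + stereo_sign k.1 * pos p 0 2%:R]); last first.
  by apply/seteqP; split=> p; [case/chart_domE|move=> h; apply/chart_domE; split=> //; exact: pos_quadric].
apply: (@open_comp _ _ (fun p : P => 1 + stereo_sign k.1 * pos p 0 2%:R) [set y | 0 < y]);
  last exact: open_gt.
move=> p _; apply: cvgD; first exact: cvg_cst.
by apply: cvgM; [exact: cvg_cst|exact: continuous_pos].
Qed.

Lemma ambient_cover p : exists k : idx P, chart_dom k p.
Proof.
have [z|z] := ltP 0 (1 + pos p 0 2%:R).
  by exists (true, tt); apply/chart_domE; split; [exact: pos_quadric|rewrite mul1r].
exists (false, tt); apply/chart_domE; split; first exact: pos_quadric.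
by rewrite /stereo_sign /= mulN1r; lra.
Qed.

Lemma ambient_good : good_charts P.
Proof.
move=> k; have -> : chart_image k = ambient_region k.
  by apply/seteqP; split=> v /chart_imageE.
split; first exact: open_ambient_region.
move=> v rv; apply: continuous_ambient => [j|].
  apply: (@differentiable_continuous _ _ _ v (fun v => pos (chart_inv k v) 0 j)).
  exact: smooth_on_differentiable (@smooth_on_pos_chart_inv k j) _ rv.
apply: (@differentiable_continuous _ _ _ v (fun v => height (chart_inv k v))).
exact: smooth_on_differentiable (@smooth_on_height_chart_inv k) _ rv.
Qed.

End ambient.

Section maps.
Context {R : realType}.
Variable kappa : R.
Hypothesis hkappa : kappa = -1 \/ kappa = 0 \/ kappa = 1.
Variables (I : set R) (I0 : I !=set0) (f : R -> R).
Hypothesis I_open : open I.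
Notation P := (warped_product (space_form kappa) f I0).

Section to_ambient.
Context {m : nat} {M : manifold R m}.
Hypothesis M_good : good_charts M.
Variable phi : M -> P.

(** The position and the height of a map, read in a chart of the source only. *)
Definition pr (i : idx M) (u : 'rV[R]_m) : 'rV[R]_3 := pos (phi (chart_inv i u)).
Definition ht (i : idx M) (u : 'rV[R]_m) : R := height (phi (chart_inv i u)).

Lemma open_overlap i k : continuous phi -> open (overlap phi i k).
Proof.
move=> cphi; have [io ic] := M_good i.
rewrite openE => u [iu du]; apply: filterI.
  exact: (open_nbhs_nbhs (conj io iu)).
have c : {for u, continuous (fun u => phi (chart_inv i u))}.
  by apply: continuous_comp; [exact: ic|exact: cphi].
have dn : nbhs (phi (chart_inv i u)) (chart_dom k).
  exact: (open_nbhs_nbhs (conj (@open_ambient_dom R kappa I I0 f k) du)).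
exact: (c _ dn).
Qed.

Lemma local_rep_region i k u : overlap phi i k u ->
  ambient_region k (local_rep phi i k u).
Proof.
by move=> [_ du]; apply/(chart_imageE hkappa); exists (phi (chart_inv i u)).
Qed.

Lemma prE i k u : overlap phi i k u ->
  pr i u = stereo_inv kappa k.1 (hor (local_rep phi i k u)).
Proof.
move=> ou; rewrite -(pos_chart_inv hkappa (local_rep_region ou)).
by rewrite /pr /local_rep (chart_invK hkappa)//; case: ou.
Qed.

Lemma htE i k u : overlap phi i k u -> ht i u = ver (local_rep phi i k u).
Proof.
move=> ou; rewrite -(height_chart_inv (local_rep_region ou)).
by rewrite /ht /local_rep (chart_invK hkappa)//; case: ou.
Qed.

Lemma local_repE i k u :
  local_rep phi i k u = row_mx (stereo_proj k.1 (pr i u)) (const_mx (ht i u)).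
Proof. exact: chart_mapE. Qed.

Lemma smooth_mapP :
  smooth_map phi <-> continuous phi /\ forall i,
    (forall j, smooth_on (chart_image i) (fun u => pr i u 0 j : R)) /\
    smooth_on (chart_image i) (fun u => ht i u : R).
Proof.
split=> [[cphi sphi]|[cphi sphi]]; split=> //.
  move=> i; split=> [j|]; apply: smooth_on_locally => u iu;
    have [k dk] := ambient_cover (phi (chart_inv i u));
    exists (overlap phi i k); (try by split; [exact: open_overlap|split]).
    exists (fun u => stereo_inv kappa k.1 (hor (local_rep phi i k u)) 0 j).
      apply: smooth_on_stereo_region; first exact: open_overlap.
        by move=> x /local_rep_region[].
      move=> l; have /smooth_on_rowP : smooth_on (overlap phi i k) (local_rep phi i k) by exact: sphi.
      move=> /(_ (open_overlap cphi) (lshift 1 l)).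
      by move=> s; apply: (smooth_on_eq (open_overlap cphi) _ s) => x _; rewrite horE.
    by move=> y /prE ->.
  exists (fun u => ver (local_rep phi i k u)); last by move=> y /htE.
  have /smooth_on_rowP : smooth_on (overlap phi i k) (local_rep phi i k) by exact: sphi.
  move=> /(_ (open_overlap cphi) (rshift 2 0)).
  by move=> s; apply: (smooth_on_eq (open_overlap cphi) _ s) => x _; rewrite verE.
move=> i k; have Uo := open_overlap cphi.
have [sp sh] := sphi i.
have {}sp j : smooth_on (overlap phi i k) (fun u => pr i u 0 j : R).
  by apply: smooth_on_sub (sp j) => u [].
have {}sh : smooth_on (overlap phi i k) (fun u => ht i u : R).
  by apply: smooth_on_sub sh => u [].
have sden : smooth_on (overlap phi i k) (fun u => (1 + stereo_sign k.1 * pr i u 0 2%:R)^-1).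
  apply: smooth_onV => //.
    by move=> u [_ /chart_domE[_ d]]; rewrite gt_eqF.
  apply: smooth_onD => //; first exact: smooth_on_cst.
  by apply: smooth_onM => //; exact: smooth_on_cst.
have snum j : smooth_on (overlap phi i k)
    (fun u => 2 * pr i u 0 j / (1 + stereo_sign k.1 * pr i u 0 2%:R)).
  by apply: smooth_onM => //; apply: smooth_onM => //; exact: smooth_on_cst.
apply/smooth_on_rowP => // j.
rewrite -(fintype.splitK j); case: (fintype.split j) => l; rewrite /unsplit.
  have [->|->] := ord2_cases l.
  - apply: smooth_on_eq (snum 0) => // u _.
    by rewrite local_repE row_mxEl row2E.
  - apply: smooth_on_eq (snum 1) => // u _.
    by rewrite local_repE row_mxEl row2E.
apply: smooth_on_eq sh => // u _.
by rewrite local_repE row_mxEr mxE.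
Qed.

Section derivatives.
Hypothesis phi_smooth : smooth_map phi.

Lemma local_rep_differentiable i k u : overlap phi i k u ->
  differentiable (local_rep phi i k) u.
Proof. by case: phi_smooth => _ /(_ i k) s; exact: smooth_on_differentiable s _. Qed.

Lemma has_derive_local_rep_hor i k u X : overlap phi i k u ->
  forall j, has_derive u X (fun y => hor (local_rep phi i k y) 0 j)
    (hor ('D_X (local_rep phi i k) u) 0 j).
Proof.
move=> ou j; have := has_derive_row X (lshift 1 j) (local_rep_differentiable ou).
by rewrite horE; congr has_derive; apply/funext => y; rewrite horE.
Qed.

Lemma has_derive_local_rep_ver i k u X : overlap phi i k u ->
  has_derive u X (fun y => ver (local_rep phi i k y))
    (ver ('D_X (local_rep phi i k) u)).
Proof.
move=> ou; have := has_derive_row X (rshift 2 0) (local_rep_differentiable ou).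
by rewrite verE; congr has_derive; apply/funext => y; rewrite verE.
Qed.

Lemma near_overlap i k u : overlap phi i k u -> \near u, overlap phi i k u.
Proof.
move=> ou; apply: (open_nbhs_nbhs (conj _ ou)).
by apply: open_overlap; case: phi_smooth.
Qed.

Lemma has_derive_pr i k u X : overlap phi i k u ->
  forall j, has_derive u X (fun y => pr i y 0 j)
    (dstereo kappa k.1 (hor (local_rep phi i k u)) (hor ('D_X (local_rep phi i k) u)) 0 j).
Proof.
move=> ou j.
have [ru _] := local_rep_region ou.
have := has_derive_stereo (has_derive_local_rep_hor X ou) ru j.
apply: near_eq_is_derive; near=> y; rewrite (@prE i k)//.
by near: y; exact: near_overlap.
Unshelve. all: by end_near. Qed.

Lemma has_derive_ht i k u X : overlap phi i k u ->
  has_derive u X (ht i) (ver ('D_X (local_rep phi i k) u)).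
Proof.
move=> ou; have := has_derive_local_rep_ver X ou.
apply: near_eq_is_derive; near=> y; rewrite (@htE i k)//.
by near: y; exact: near_overlap.
Unshelve. all: by end_near. Qed.

Lemma derive_prE i k u X : overlap phi i k u -> 'D_X (pr i) u =
  dstereo kappa k.1 (hor (local_rep phi i k u)) (hor ('D_X (local_rep phi i k) u)).
Proof.
move=> ou; apply/rowP => j; rewrite derive_row.
  by have [_ ->] := has_derive_pr X ou j.
apply/derivable_mxP => a b; rewrite ord1.
by have [] := has_derive_pr X ou b.
Qed.

Lemma derive_htE i k u X : overlap phi i k u ->
  'D_X (ht i) u = ver ('D_X (local_rep phi i k) u).
Proof. by move=> ou; have [_ ->] := has_derive_ht X ou. Qed.

End derivatives.
End to_ambient.

(** ** The metric and its Christoffel symbols *)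

Lemma row_partial_incl b u i : stereo_region kappa b u ->
  partial i (fun v => \val (@chart_inv R 2 (quadric_manifold kappa) b v) : 'rV[R]_3) u =
  dstereo kappa b u (delta_mx 0 i).
Proof.
move=> ru.
have der j : has_derive u (delta_mx 0 i)
    (fun v => (\val (@chart_inv R 2 (quadric_manifold kappa) b v) : 'rV[R]_3) 0 j : R)
    (dstereo kappa b u (delta_mx 0 i) 0 j).
  have := has_derive_stereo (fun j => has_derive_coord j u (delta_mx 0 i)) ru j.
  apply: near_eq_is_derive; near=> v.
  have rv : stereo_region kappa b v.
    by near: v; exact: (open_nbhs_nbhs (conj (@open_stereo_region R kappa b) ru)).
  by rewrite /= val_insubd mem_set//; exact: stereo_inv_quadric.
apply/rowP => j; rewrite /partial derive_row.
  by have [_ ->] := der j.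
by apply/derivable_mxP => a c; rewrite ord1; case: (der c).
Unshelve. all: by end_near. Qed.

Lemma sum2E (F : 'I_2 -> R) : \sum_(i < 2) F i = F 0 + F 1.
Proof.
by rewrite big_ord_recl big_ord1; congr (_ + F _); apply/val_inj.
Qed.

Lemma round_metricE b u : stereo_region kappa b u ->
  @metric R 2 (space_form kappa) b u = (conf kappa u ^+ 2)%:M.
Proof.
move=> ru; apply/matrixP => i j; rewrite [LHS]mxE !row_partial_incl//.
rewrite dstereo_form// [RHS]mxE -mulr_natr; congr (_ * _).
by have [->|->] := ord2_cases i; have [->|->] := ord2_cases j; rewrite /dot2 !mxE /= ?mulr0 ?mul0r ?mulr1 ?addr0 ?add0r.
Qed.

(** The Gram matrix is diagonal, with entries [warp], [warp] and [1]. *)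
Definition warp (v : 'rV[R]_(2 + 1)) : R := expR (2 * f (ver v)) * conf kappa (hor v) ^+ 2.

Definition warp_diag (v : 'rV[R]_(2 + 1)) (l : 'I_(2 + 1)) : R :=
  if fintype.split l is inl _ then warp v else 1.

Lemma ambient_metricE (k : idx P) v : ambient_region k v ->
  metric k v = \matrix_(i, j) ((i == j)%:R * warp_diag v j) :> 'M[R]_(2 + 1).
Proof.
move=> [rv _]; rewrite [LHS](_ : _ = block_mx
  (expR (2 * f (ver v)) *: @metric R 2 (space_form kappa) k.1 (hor v)) 0 0 1%:M)//.
rewrite round_metricE//; apply/matrixP => i j; rewrite [RHS]mxE /warp_diag.
rewrite -[in LHS](fintype.splitK i) -[in LHS](fintype.splitK j).
rewrite -(inj_eq (can_inj (@fintype.splitK 2 1))).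
case: (fintype.split i) => a; case: (fintype.split j) => c;
  rewrite /unsplit ?(block_mxEul,block_mxEur,block_mxEdl,block_mxEdr) !mxE.
- by rewrite /warp mulrnAr [RHS]mulr_natl.
- by rewrite mul0r.
- by rewrite mul0r.
- by rewrite !ord1 mulr1.
Qed.

End maps.

Section christoffel.
Context {R : realType}.
Variable kappa : R.
Hypothesis hkappa : kappa = -1 \/ kappa = 0 \/ kappa = 1.
Variables (I : set R) (I0 : I !=set0) (f : R -> R).
Hypothesis I_open : open I.
Hypothesis f_smooth : smooth_on_interval I f.
Notation P := (warped_product (space_form kappa) f I0).

Lemma has_derive_interval s : I s -> has_derive s 1 f ((f^`(1))%classic s).
Proof.
move=> Is; rewrite derive1n1 derive1E; apply: derivableP.
by have := @f_smooth 0%N s Is; rewrite derive1n0.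
Qed.

Lemma sum_delta n (j : 'I_n) (F : 'I_n -> R) : \sum_i F i * (i == j)%:R = F j.
Proof.
rewrite (bigD1 j)//= eqxx mulr1 big1 ?addr0// => i /negbTE ->; exact: mulr0.
Qed.

Lemma sum3E (F : 'I_(2 + 1) -> R) :
  \sum_i F i = F (lshift 1 0) + F (lshift 1 1) + F (rshift 2 0).
Proof. by rewrite big_split_ord /= sum2E big_ord1. Qed.

Lemma warp_diagE v : (warp_diag kappa f v (lshift 1 0) = warp kappa f v) *
  (warp_diag kappa f v (lshift 1 1) = warp kappa f v) *
  (warp_diag kappa f v (rshift 2 0) = 1).
Proof.
have hl (a : 'I_2) : fintype.split (lshift 1 a) = inl a.
  exact: (fintype.unsplitK (inl a)).
have hr (a : 'I_1) : fintype.split (rshift 2 a) = inr a.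
  exact: (fintype.unsplitK (inr a)).
by rewrite /warp_diag !hl !hr.
Qed.

Lemma inner_ambient (k : idx P) v (a c : 'rV[R]_(2 + 1)) : ambient_region k v ->
  inner (metric k v) a c =
  expR (2 * f (ver v)) * ambient_form kappa
    (dstereo kappa k.1 (hor v) (hor a)) (dstereo kappa k.1 (hor v) (hor c))
  + ver a * ver c.
Proof.
move=> rv; have [rk _] := rv; rewrite dstereo_form// ambient_metricE// /inner.
have -> : (a *m (\matrix_(i, j) ((i == j)%:R * warp_diag kappa f v j)) *m c^T) 0 0
    = \sum_j a 0 j * warp_diag kappa f v j * c 0 j.
  rewrite mxE; apply: eq_bigr => j _; rewrite !mxE; congr (_ * _).
  rewrite -(sum_delta j (fun i => a 0 i * warp_diag kappa f v j)).
  by apply: eq_bigr => i _; rewrite mxE; ring.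
by rewrite sum3E !warp_diagE /dot2 /warp !horE !verE; ring.
Qed.

Lemma has_derive_warp (k : idx P) v X : ambient_region k v ->
  has_derive v X (warp kappa f) (warp kappa f v *
    (2 * (f^`(1))%classic (ver v) * ver X - conf kappa (hor v) * kappa * dot2 (hor v) (hor X))).
Proof.
move=> [rv Iv]; apply: has_derive_conv; eexists.
  apply: has_deriveM.
    apply: (has_derive_comp (is_derive_expR _)).
    apply: has_deriveM; first exact: has_derive_cst.
    apply: (has_derive_comp (has_derive_interval Iv)); exact: has_derive_ver.
  apply: has_deriveX; apply: (has_derive_conf _ rv) => j; exact: has_derive_hor.
by rewrite /warp /=; field.
Qed.

Definition dwarp_diag (v X : 'rV[R]_(2 + 1)) (l : 'I_(2 + 1)) : R :=
  if fintype.split l is inl _ then warp kappa f v *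
    (2 * (f^`(1))%classic (ver v) * ver X - conf kappa (hor v) * kappa * dot2 (hor v) (hor X))
  else 0.

Lemma dwarp_diagE v X (w := warp kappa f v *
    (2 * (f^`(1))%classic (ver v) * ver X - conf kappa (hor v) * kappa * dot2 (hor v) (hor X))) :
  (dwarp_diag v X (lshift 1 0) = w) *
  (dwarp_diag v X (lshift 1 1) = w) * (dwarp_diag v X (rshift 2 0) = 0).
Proof.
have hl (a : 'I_2) : fintype.split (lshift 1 a) = inl a.
  exact: (fintype.unsplitK (inl a)).
have hr (a : 'I_1) : fintype.split (rshift 2 a) = inr a.
  exact: (fintype.unsplitK (inr a)).
by rewrite /dwarp_diag !hl !hr.
Qed.

Lemma partial_metric (k : idx P) v a b c : ambient_region k v ->
  partial a (fun y => metric k y b c : R^o) v =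
  dwarp_diag v (delta_mx 0 a) c * (b == c)%:R.
Proof.
move=> rv.
have hd : has_derive v (delta_mx 0 a) (fun y => (b == c)%:R * warp_diag kappa f y c)
    (dwarp_diag v (delta_mx 0 a) c * (b == c)%:R).
  apply: has_derive_conv; eexists.
    apply: has_deriveM; first exact: has_derive_cst.
    rewrite /warp_diag -/(dwarp_diag v (delta_mx 0 a) c).
    instantiate (1 := dwarp_diag v (delta_mx 0 a) c); rewrite /dwarp_diag.
    case: (fintype.split c) => _; last exact: has_derive_cst.
    exact: has_derive_warp rv.
  by rewrite /= mul0r add0r mulrC.
have [_ <-] := hd; apply: near_eq_derive; near=> y.
rewrite ambient_metricE ?mxE//.
by near: y; exact: (open_nbhs_nbhs (conj (@open_ambient_region R kappa I I0 f I_open k) rv)).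
Unshelve. all: by end_near. Qed.

Lemma invmx_metric (k : idx P) v i j : ambient_region k v ->
  invmx (metric k v) i j = (i == j)%:R / warp_diag kappa f v j.
Proof.
move=> rv; have [rk _] := rv.
have w0 l : warp_diag kappa f v l != 0.
  rewrite /warp_diag; case: (fintype.split l) => _; last exact: oner_neq0.
  by rewrite /warp mulf_neq0 ?expf_neq0 ?gt_eqF ?expR_gt0 ?(conf_gt0 rk).
rewrite ambient_metricE//; set G := \matrix_(_, _) _.
pose H : 'M[R]_(2 + 1) := \matrix_(i, j) ((i == j)%:R / warp_diag kappa f v j).
have GH : G *m H = 1%:M.
  apply/matrixP => a c; rewrite !mxE.
  rewrite (eq_bigr (fun i => ((a == i)%:R * warp_diag kappa f v i / warp_diag kappa f v c) * (i == c)%:R)).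
    by rewrite sum_delta -mulrA divff// mulr1.
  by move=> l _; rewrite !mxE; ring.
have [Gu _] := mulmx1_unit GH.
have -> : invmx G = H by rewrite -[H]mul1mx -(mulVmx Gu) -mulmxA GH mulmx1.
by rewrite mxE.
Qed.

Lemma christoffelE (k : idx P) v c a b : ambient_region k v ->
  christoffel (metric k) v c a b =
  2^-1 / warp_diag kappa f v c *
   (dwarp_diag v (delta_mx 0 a) c * (b == c)%:R + dwarp_diag v (delta_mx 0 b) c * (a == c)%:R
    - dwarp_diag v (delta_mx 0 c) b * (a == b)%:R).
Proof.
move=> rv; rewrite /christoffel.
under eq_bigr => l _ do rewrite invmx_metric// !partial_metric//.
rewrite (eq_bigr (fun l => (1 / warp_diag kappa f v l *
  (dwarp_diag v (delta_mx 0 a) l * (b == l)%:R + dwarp_diag v (delta_mx 0 b) l * (a == l)%:R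
    - dwarp_diag v (delta_mx 0 l) b * (a == b)%:R)) * (l == c)%:R)).
  by rewrite sum_delta; ring.
by move=> l _; rewrite eq_sym; ring.
Qed.

Definition christoffel_row (k : idx P) v (X V : 'rV[R]_(2 + 1)) : 'rV[R]_(2 + 1) :=
  \row_c \sum_a \sum_b christoffel (metric k) v c a b * X 0 a * V 0 b.

Lemma hor_delta (i : 'I_2) : hor (delta_mx 0 (lshift 1 i)) = delta_mx 0 i :> 'rV[R]_2.
Proof. by apply/rowP => j; rewrite horE !mxE (inj_eq (@lshift_inj _ _)). Qed.

Lemma ver_delta (i : 'I_2) : ver (delta_mx 0 (lshift 1 i)) = 0 :> R.
Proof. by rewrite verE !mxE eq_rlshift andbF. Qed.

Lemma hor_delta_last : hor (delta_mx 0 (rshift 2 0)) = 0 :> 'rV[R]_2.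
Proof. by apply/rowP => j; rewrite horE !mxE eq_lrshift. Qed.

Lemma ver_delta_last : ver (delta_mx 0 (rshift 2 0)) = 1 :> R.
Proof. by rewrite verE !mxE !eqxx. Qed.

Lemma dot2_delta (u : 'rV[R]_2) :
  (dot2 u (delta_mx 0 0) = u 0 0) * (dot2 u (delta_mx 0 1) = u 0 1) * (dot2 u 0 = 0).
Proof.
by rewrite /dot2 !mxE /= !mulr0 !mulr1 !addr0 add0r.
Qed.

Lemma dwarp_diag_linear v (X : 'rV[R]_(2 + 1)) l :
  \sum_a dwarp_diag v (delta_mx 0 a) l * X 0 a = dwarp_diag v X l.
Proof.
rewrite sum3E /dwarp_diag; case: (fintype.split l) => _; last by rewrite !mul0r !addr0.
by rewrite !hor_delta !ver_delta hor_delta_last ver_delta_last !dot2_delta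
  /dot2 !horE !verE; ring.
Qed.

Lemma christoffel_rowE (k : idx P) v X V c : ambient_region k v ->
  christoffel_row k v X V 0 c = 2^-1 / warp_diag kappa f v c *
   (dwarp_diag v X c * V 0 c + dwarp_diag v V c * X 0 c
    - \sum_a dwarp_diag v (delta_mx 0 c) a * X 0 a * V 0 a).
Proof.
move=> rv; rewrite mxE.
rewrite -[in RHS](dwarp_diag_linear v X) -[in RHS](dwarp_diag_linear v V).
rewrite (eq_bigr (fun a => 2^-1 / warp_diag kappa f v c *
   (dwarp_diag v (delta_mx 0 a) c * X 0 a * V 0 c
   + (\sum_b dwarp_diag v (delta_mx 0 b) c * V 0 b) * (X 0 a * (a == c)%:R)
   - dwarp_diag v (delta_mx 0 c) a * X 0 a * V 0 a))).
  rewrite -mulr_sumr; congr (_ * _).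
  rewrite sumrB big_split/= mulr_suml; congr (_ + _ - _).
  by rewrite -mulr_sumr sum_delta.
move=> a _.
rewrite (eq_bigr (fun b => 2^-1 / warp_diag kappa f v c *
   (dwarp_diag v (delta_mx 0 a) c * X 0 a * (V 0 b * (b == c)%:R)
   + (dwarp_diag v (delta_mx 0 b) c * V 0 b) * (X 0 a * (a == c)%:R)
   - dwarp_diag v (delta_mx 0 c) a * X 0 a * (V 0 b * (b == a)%:R)))).
  rewrite -mulr_sumr; congr (_ * _).
  rewrite sumrB big_split/= -mulr_suml; congr (_ + _ - _).
    by rewrite -mulr_sumr sum_delta.
  by rewrite -mulr_sumr sum_delta.
move=> b _; rewrite christoffelE// [a == b]eq_sym.
have [->|_] := eqVneq b a; last by rewrite !mulr0; ring.
by rewrite !mulr1; ring.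
Qed.

Lemma christoffel_row_hor (k : idx P) v X V : ambient_region k v ->
  hor (christoffel_row k v X V) = round_christoffel kappa (hor v) (hor X) (hor V)
    + (f^`(1))%classic (ver v) *: (ver X *: hor V + ver V *: hor X).
Proof.
move=> rv; have [rk _] := rv.
have w0 : warp kappa f v != 0.
  by rewrite /warp mulf_neq0 ?expf_neq0 ?gt_eqF ?expR_gt0 ?(conf_gt0 rk).
have comb (g u w : 'rV[R]_2) (r s t : R) i :
    (g + r *: (s *: u + t *: w)) 0 i = g 0 i + r * (s * u 0 i + t * w 0 i).
  by rewrite !mxE.
apply: row2P; rewrite horE christoffel_rowE// sum3E !warp_diagE !dwarp_diagE
  !hor_delta !ver_delta !dot2_delta comb /round_christoffel row2E /dot2 -!horE;
  field; exact: w0.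
Qed.

Lemma christoffel_row_ver (k : idx P) v X V : ambient_region k v ->
  ver (christoffel_row k v X V) =
   - ((f^`(1))%classic (ver v) * warp kappa f v * dot2 (hor X) (hor V)).
Proof.
move=> rv; rewrite verE christoffel_rowE// sum3E !warp_diagE !dwarp_diagE.
rewrite hor_delta_last ver_delta_last dot2_delta /dot2 !horE.
by field.
Qed.

End christoffel.

(** * Umbilical surfaces seen in the ambient linear space *)

Section hor_ver.
Context {R : realType}.
Implicit Types (a c : 'rV[R]_(2 + 1)).

Lemma horD a c : hor (a + c) = hor a + hor c.
Proof. by rewrite /hor linearD. Qed.

Lemma horZ r a : hor (r *: a) = r *: hor a.
Proof. by rewrite /hor linearZ. Qed.

Lemma verD a c : ver (a + c) = ver a + ver c.
Proof. by rewrite !verE mxE. Qed.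

Lemma verZ r a : ver (r *: a) = r * ver a.
Proof. by rewrite !verE mxE. Qed.

Lemma hor_ver_inj a c : hor a = hor c -> ver a = ver c -> a = c.
Proof. by move=> h v; rewrite -[a]row_hor_ver -[c]row_hor_ver h v. Qed.

End hor_ver.

Section form.
Context {R : realType}.
Variable kappa : R.
Implicit Types (p v w : 'rV[R]_3).

Lemma ambient_formC v w : ambient_form kappa v w = ambient_form kappa w v.
Proof. by rewrite /ambient_form; ring. Qed.

Lemma ambient_formZl r v w :
  ambient_form kappa (r *: v) w = r * ambient_form kappa v w.
Proof. by rewrite /ambient_form !mxE; ring. Qed.

Lemma ambient_formZr r v w :
  ambient_form kappa v (r *: w) = r * ambient_form kappa v w.
Proof. by rewrite /ambient_form !mxE; ring. Qed.

Lemma tangentZ r p v : tangent kappa p v -> tangent kappa p (r *: v).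
Proof.
rewrite /tangent !mxE => h.
by rewrite -[RHS](mulr0 r) -h; ring.
Qed.

Lemma dstereoD b u a c :
  dstereo kappa b u (a + c) = dstereo kappa b u a + dstereo kappa b u c :> 'rV[R]_3.
Proof.
have E j : (a + c) 0 j = a 0 j + c 0 j by rewrite mxE.
have F (v w : 'rV[R]_3) j : (v + w) 0 j = v 0 j + w 0 j by rewrite mxE.
by apply: row3P; rewrite F !row3E /dot2 !E; field.
Qed.

Lemma dstereoZ b u r a : dstereo kappa b u (r *: a) = r *: dstereo kappa b u a :> 'rV[R]_3.
Proof.
have E j : (r *: a) 0 j = r * a 0 j by rewrite mxE.
have F (v : 'rV[R]_3) j : (r *: v) 0 j = r * v 0 j by rewrite mxE.
by apply: row3P; rewrite F !row3E /dot2 !E; field.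
Qed.

Lemma smooth_on_dstereo n (U : set 'rV[R]_n) b (c W : 'rV[R]_n -> 'rV[R]_2) :
  open U -> (forall x, U x -> stereo_region kappa b (c x)) ->
  (forall j, smooth_on U (fun y => c y 0 j : R)) ->
  (forall j, smooth_on U (fun y => W y 0 j : R)) ->
  forall j, smooth_on U (fun y => dstereo kappa b (c y) (W y) 0 j : R).
Proof.
move=> Uo rc sc sW.
have ssq : smooth_on U (fun y => kappa * sqn (c y) / 4).
  apply: smooth_onM => //; last exact: smooth_on_cst.
  apply: smooth_onM => //; first exact: smooth_on_cst.
  by apply: smooth_onD => //; apply: smooth_onX.
have sconf : smooth_on U (fun y => conf kappa (c y)).
  apply: smooth_onV => // [x /rc [h _]|]; first by rewrite gt_eqF.
  by apply: smooth_onD => //; exact: smooth_on_cst.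
have sdot : smooth_on U (fun y => dot2 (c y) (W y)).
  by apply: smooth_onD => //; apply: smooth_onM.
have scoef : smooth_on U (fun y => conf kappa (c y) ^+ 2 * kappa * dot2 (c y) (W y)).
  apply: smooth_onM => //; apply: smooth_onM => //; first exact: smooth_onX.
  exact: smooth_on_cst.
have scomp j : smooth_on U (fun y => conf kappa (c y) * W y 0 j
     - conf kappa (c y) ^+ 2 * kappa * dot2 (c y) (W y) * 2^-1 * c y 0 j).
  apply: smooth_onB => //; first exact: smooth_onM.
  apply: smooth_onM => //; apply: smooth_onM => //; exact: smooth_on_cst.
move=> k.
have [->|[->|->]] := ord3_cases k.
- by apply: (smooth_on_eq Uo _ (scomp 0)) => x _; rewrite row3E.
- by apply: (smooth_on_eq Uo _ (scomp 1)) => x _; rewrite row3E.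
have s1 := smooth_onM Uo (smooth_on_cst Uo (- stereo_sign b)) scoef.
by apply: (smooth_on_eq Uo _ s1) => x _; rewrite row3E; ring.
Qed.

End form.

Section umbilical.
Context {R : realType}.
Variable kappa : R.
Hypothesis hkappa : kappa = -1 \/ kappa = 0 \/ kappa = 1.
Variables (I : set R) (I0 : I !=set0) (f : R -> R).
Hypothesis I_open : open I.
Hypothesis f_smooth : smooth_on_interval I f.
Notation P := (warped_product (space_form kappa) f I0).
Local Notation f' := ((f^`(1))%classic).

(** ** Changes of charts of the ambient space *)

Lemma smooth_map_id : smooth_map (fun p : P => p).
Proof.
have good : good_charts P by exact: ambient_good.
apply/(smooth_mapP hkappa good); split.
  by move=> p; exact: cvg_id.
move=> k; split=> [j|]; apply: (@smooth_on_sub _ _ _ (ambient_region k));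
  try by move=> v /(chart_imageE hkappa).
- exact: smooth_on_pos_chart_inv.
- exact: smooth_on_height_chart_inv.
Qed.

Lemma has_derive_pos_chart_inv (k : idx P) v V j : ambient_region k v ->
  has_derive v V (fun y => pos (chart_inv k y) 0 j)
    (dstereo kappa k.1 (hor v) (hor V) 0 j).
Proof.
move=> rv; have [rk _] := rv.
have := has_derive_stereo (fun j => has_derive_hor V v j) rk j.
apply: near_eq_is_derive; near=> y; rewrite (pos_chart_inv hkappa)//.
by near: y; exact: (open_nbhs_nbhs (conj (@open_ambient_region R kappa I I0 f I_open k) rv)).
Unshelve. all: by end_near. Qed.

Lemma chart_map_region (k : idx P) (p : P) : chart_dom k p ->
  ambient_region k (chart_map k p).
Proof. by move=> dk; apply/(chart_imageE hkappa); exists p. Qed.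

Lemma hor_chart_map (k : idx P) (p : P) :
  hor (chart_map k p) = stereo_proj k.1 (pos p).
Proof. by rewrite chart_mapE hor_row. Qed.

Lemma chart_change (j k : idx P) (p : P) V : chart_dom j p -> chart_dom k p ->
  let W := 'D_V (chart_map k \o chart_inv j) (chart_map j p) in
  dstereo kappa k.1 (stereo_proj k.1 (pos p)) (hor W) =
  dstereo kappa j.1 (stereo_proj j.1 (pos p)) (hor V) /\ ver W = ver V.
Proof.
move=> dj dk W; have rj := chart_map_region dj.
have ov : overlap (fun p : P => p) j k (chart_map j p).
  by split; [exists p|rewrite (chart_invK hkappa)].
have good : good_charts P by exact: ambient_good.
have lrE : local_rep (fun p : P => p) j k (chart_map j p) = chart_map k p.
  by rewrite /local_rep (chart_invK hkappa).
have eW : 'D_V (local_rep (fun p : P => p) j k) (chart_map j p) = W by [].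
split.
  have := has_derive_pr hkappa good smooth_map_id V ov.
  rewrite eW lrE hor_chart_map => h.
  apply/rowP => l; have [_ <-] := h l.
  have [_ ->] := has_derive_pos_chart_inv V l rj.
  by rewrite hor_chart_map.
have := has_derive_ht hkappa good smooth_map_id V ov.
rewrite eW => -[_ <-].
have hv := has_derive_ver V (chart_map j p).
have [_ <-] := hv; apply: near_eq_derive; near=> y.
rewrite /ht height_chart_inv//; near: y.
exact: (open_nbhs_nbhs (conj (@open_ambient_region R kappa I I0 f I_open j) rj)).
Unshelve. all: by end_near. Qed.

Section one_map.
Context {m : nat} {M : manifold R m}.
Hypothesis M_good : good_charts M.
Variable phi : M -> P.
Hypothesis phi_smooth : smooth_map phi.

(** Up to sign, the principal curvature for the product metric, to which the
    metric is conformal. *)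
Definition lam (nu rho t : R) : R := - ((rho + f' t * nu) * expR (f t)).

(** The Gauss and Weingarten formulas: the covariant derivative of a field is
    the tangential part of its derivative in the ambient linear space. *)
Lemma umbilical_at i (k : idx P) u X (N : 'rV[R]_m -> 'rV[R]_(2 + 1))
    (n : 'rV[R]_m -> 'rV[R]_3) (nu : 'rV[R]_m -> R) (rho : R)
    (DX := 'D_X (local_rep phi i k) u)
    (ds := expR (- f (ht phi i u)) * 'D_X (ht phi i) u) :
  overlap phi i k u -> differentiable N u ->
  (\near u, n u = expR (f (ht phi i u)) *:
      dstereo kappa k.1 (hor (local_rep phi i k u)) (hor (N u))) ->
  (\near u, nu u = ver (N u)) ->
  ambient_form kappa (n u) ('D_X (pr phi i) u) + nu u * ds = 0 ->
  (- ('D_X N u + christoffel_row k (local_rep phi i k u) DX (N u)) = rho *: DX) <->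
  ((forall j, 'D_X (fun y => n y 0 j : R) u =
      lam (nu u) rho (ht phi i u) * 'D_X (pr phi i) u 0 j
      + kappa * nu u * ds * pr phi i u 0 j) /\
   'D_X nu u = lam (nu u) rho (ht phi i u) * ds).
Proof.
move=> ou dN nE nuE orth.
have aux (e d x s q r w B c A z g : R) :
    e * (d * x) * q + e * (s + r - g * c ^+ 2 * A * B) =
    e * (s + r + d * (x * q + z * w) - d * z * w) + - (g * B * (e * (c ^+ 2 * A))).
  by ring.
have ru := local_rep_region hkappa ou; have [rk It] := ru.
set Z := 'D_X N u + _.
set l := local_rep phi i k u; set t := ht phi i u.
have tE : t = ver l by exact: htE.
have prDE := derive_prE hkappa M_good phi_smooth X ou.
have htDE : 'D_X (ht phi i) u = ver DX by exact: (derive_htE hkappa M_good phi_smooth).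
have hNh j : has_derive u X (fun y => hor (N y) 0 j) (hor ('D_X N u) 0 j).
  rewrite horE; have := has_derive_row X (lshift 1 j) dN.
  by congr has_derive; apply/funext => y; rewrite horE.
have hNv : has_derive u X (fun y => ver (N y)) (ver ('D_X N u)).
  rewrite verE; have := has_derive_row X (rshift 2 0) dN.
  by congr has_derive; apply/funext => y; rewrite verE.
have nuN : nu u = ver (N u) by exact: nbhs_singleton nuE.
have nN : n u = expR (f t) *: dstereo kappa k.1 (hor l) (hor (N u)) by exact: nbhs_singleton nE.
have Dnu : 'D_X nu u = ver ('D_X N u).
  by have [_ <-] := hNv; exact: near_eq_derive.
have e0 : expR (f t) != 0 by rewrite gt_eqF// expR_gt0.
have dsE : expR (f t) * ds = ver DX by rewrite /ds -/t htDE expRN mulVKf.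
have dotE : expR (f t) * (conf kappa (hor l) ^+ 2 * dot2 (hor DX) (hor (N u))) = - (nu u * ds).
  rewrite -(dstereo_form hkappa _ _ rk) -/l -prDE ambient_formC -ambient_formZl -nN.
  by apply/eqP; rewrite -addr_eq0 orth.
have Zv : ver Z = 'D_X nu u + f' t * nu u * ver DX.
  rewrite verD (christoffel_row_ver hkappa I_open f_smooth)// Dnu /warp -/l -tE; congr (_ + _).
  rewrite (_ : expR (2 * f t) = expR (f t) * expR (f t)); last by rewrite -expRD; congr expR; ring.
  transitivity (- (f' t * expR (f t) *
    (expR (f t) * (conf kappa (hor l) ^+ 2 * dot2 (hor DX) (hor (N u)))))); first by ring.
  by rewrite dotE -dsE; ring.
have Zh : hor Z = (hor ('D_X N u) + round_christoffel kappa (hor l) (hor DX) (hor (N u)))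
      + f' t *: (ver DX *: hor (N u) + nu u *: hor DX).
  by rewrite horD (christoffel_row_hor hkappa I_open f_smooth)// -/l -tE nuN addrA.
have Dn j : 'D_X (fun y => n y 0 j : R) u =
   expR (f t) * (dstereo kappa k.1 (hor l) (hor Z) 0 j - f' t * nu u * 'D_X (pr phi i) u 0 j)
   + kappa * nu u * ds * pr phi i u 0 j.
  have hf : has_derive (ht phi i u) 1 f (f' t).
    by apply: (has_derive_interval f_smooth); rewrite -/t tE.
  have ht1 : has_derive u X (ht phi i) (ver DX) by exact: has_derive_ht.
  have hd : has_derive u X (fun y => expR (f (ht phi i y)) *
      dstereo kappa k.1 (hor (local_rep phi i k y)) (hor (N y)) 0 j)
      (expR (f t) * (dstereo kappa k.1 (hor l) (hor Z) 0 j - f' t * nu u * 'D_X (pr phi i) u 0 j)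
   + kappa * nu u * ds * pr phi i u 0 j).
    apply: has_derive_conv; eexists.
      apply: has_deriveM.
        apply: (has_derive_comp (is_derive_expR _)).
        exact: (has_derive_comp hf ht1).
      apply: (has_derive_dstereo _ hNh rk).
      exact: has_derive_local_rep_hor.
    cbv beta; rewrite -/t -/l -/DX Zh !(dstereoD, dstereoZ) prDE -/l -/DX (prE hkappa ou) -/l.
    have F (v w : 'rV[R]_3) : (v + w) 0 j = v 0 j + w 0 j by rewrite mxE.
    have G r (v : 'rV[R]_3) : (r *: v) 0 j = r * v 0 j by rewrite mxE.
    rewrite !(F, G).
    move: dotE; set A := dot2 _ _; set B := stereo_inv _ _ _ _ _ => dotE.
    rewrite (_ : kappa * nu u * ds * B = - (kappa * B * - (nu u * ds))); last by ring.
    by rewrite -dotE; exact: aux.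
  have [_ <-] := hd; apply: near_eq_derive.
  by apply: filterS nE => y ->; rewrite mxE.
have dinj := dstereo_inj rk.
rewrite /lam; split=> [ZE|[hn hnu]].
  have hZ : Z = - rho *: DX by rewrite scaleNr -ZE opprK.
  split=> [j|].
    rewrite Dn hZ; congr (_ + _).
    by rewrite horZ dstereoZ -prDE mxE; ring.
  have : ver Z = - rho * ver DX by rewrite hZ verZ.
  by rewrite Zv -dsE => h; apply: (addIr (f' t * nu u * (expR (f t) * ds))); rewrite h; ring.
rewrite -[RHS]opprK -scaleNr; congr (- _); apply: hor_ver_inj.
  rewrite horZ; apply: dinj; apply/rowP => j; apply: (mulfI e0).
  have := Dn j; rewrite hn => /addIr.
  rewrite mulrBr => /eqP; rewrite eq_sym subr_eq => /eqP ->.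
  by rewrite dstereoZ -prDE mxE; ring.
by rewrite verZ Zv hnu -dsE; ring.
Qed.

End one_map.
End umbilical.

Section umbilical_data.
Context {R : realType}.
Variable kappa : R.
Hypothesis hkappa : kappa = -1 \/ kappa = 0 \/ kappa = 1.
Variables (I : set R) (I0 : I !=set0) (f : R -> R).
Hypothesis I_open : open I.
Hypothesis f_smooth : smooth_on_interval I f.
Notation P := (warped_product (space_form kappa) f I0).

Section one_map.
Context {m : nat} {M : manifold R m}.
Hypothesis M_good : good_charts M.
Hypothesis M_cover : forall p : M, exists i, exists2 u, chart_image i u & chart_inv i u = p.
Variable phi : M -> P.

Definition immersed : Prop := forall i u X, chart_image i u ->
  'D_X (pr phi i) u = 0 -> 'D_X (ht phi i) u = 0 -> X = 0.

(** The derivative of the conformal coordinate [s], with [ds = e^(-f) dt], in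
    which the ambient space is conformal to a Riemannian product. *)
Definition dsc (i : idx M) (u X : 'rV[R]_m) : R :=
  expR (- f (ht phi i u)) * 'D_X (ht phi i) u.

(** The unit normal field for the product metric has components [n] and [nu],
    and [lam] is the opposite of the principal curvature for that metric. *)
Definition umbilical_data (n : M -> 'rV[R]_3) (nu rho : M -> R) : Prop :=
  [/\ forall i, [/\ forall j, smooth_on (chart_image i) (fun u => n (chart_inv i u) 0 j : R),
        smooth_on (chart_image i) (fun u => nu (chart_inv i u) : R) &
        smooth_on (chart_image i) (fun u => rho (chart_inv i u) : R)],
      forall p, tangent kappa (pos (phi p)) (n p),
      forall p, ambient_form kappa (n p) (n p) + nu p ^+ 2 = 1,
      forall i u X, chart_image i u ->
        ambient_form kappa (n (chart_inv i u)) ('D_X (pr phi i) u)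
          + nu (chart_inv i u) * dsc i u X = 0 &
      forall i u X, chart_image i u ->
        let p := chart_inv i u in
        let l := lam f (nu p) (rho p) (ht phi i u) in
        (forall j, 'D_X (fun y => n (chart_inv i y) 0 j : R) u =
          l * 'D_X (pr phi i) u 0 j + kappa * nu p * dsc i u X * pr phi i u 0 j) /\
        'D_X (fun y => nu (chart_inv i y) : R) u = l * dsc i u X].

Lemma chart_cover i u : chart_image i u ->
  exists k, overlap phi i k u.
Proof. by move=> iu; have [k dk] := ambient_cover (phi (chart_inv i u)); exists k. Qed.

Lemma immersionP : immersion phi <-> smooth_map phi /\ immersed.
Proof.
split=> -[sphi im]; split=> //.
  move=> i u X iu p0 h0; have [k ok] := chart_cover iu.
  apply: (im i k u X ok); apply: hor_ver_inj.
    have [rk _] := local_rep_region hkappa ok.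
    apply: (dstereo_inj rk); rewrite -(derive_prE hkappa M_good sphi)// p0.
    by rewrite (_ : hor 0 = 0 *: 0) ?dstereoZ ?scale0r// /hor linear0.
  by rewrite -(derive_htE hkappa M_good sphi)// h0 verE mxE.
move=> i k u X ou D0; apply: (im i u X); first by case: ou.
  rewrite (derive_prE hkappa M_good sphi _ ou) D0.
  by rewrite (_ : hor 0 = 0 *: 0) ?dstereoZ ?scale0r// /hor linear0.
by rewrite (derive_htE hkappa M_good sphi _ ou) D0 verE mxE.
Qed.

(** The components of the normal field in the charts patch together, because
    they transform as the components of a vector of the ambient linear space. *)
Lemma unit_normal_data (N : idx P -> M -> 'rV[R]_(2 + 1)) :
  smooth_map phi -> field_along phi N ->
  exists n nu, forall p k, chart_dom k (phi p) ->
    n p = expR (f (height (phi p))) *: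
      dstereo kappa k.1 (stereo_proj k.1 (pos (phi p))) (hor (N k p)) /\
    nu p = ver (N k p).
Proof.
move=> sphi [Nc _].
pose sel p := sval (cid (ambient_cover (phi p))).
have selP p : chart_dom (sel p) (phi p) by rewrite /sel; case: cid.
exists (fun p => expR (f (height (phi p))) *:
  dstereo kappa (sel p).1 (stereo_proj (sel p).1 (pos (phi p))) (hor (N (sel p) p))).
exists (fun p => ver (N (sel p) p)) => p k dk.
have [h1 h2] := chart_change hkappa I_open (N (sel p) p) (selP p) dk.
by rewrite (Nc (sel p) k p (selP p) dk) h1 h2.
Qed.

(** By the Gauss and Weingarten formulas at every point, as [n] is obtained from
    the horizontal components of the unit normal by the conformal factor. *)
Lemma umbilical_data_of : totally_umbilical phi ->
  [/\ smooth_map phi, immersed & exists n nu rho, umbilical_data n nu rho].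
Proof.
move=> [im [N [rho [[Nf Nn] rs um]]]].
have [sphi im'] := immersionP.1 im; split=> //.
have [cphi _] := sphi.
have [n [nu nnu]] := unit_normal_data sphi Nf.
exists n, nu, rho.
have lrE i k u : hor (local_rep phi i k u) = stereo_proj k.1 (pos (phi (chart_inv i u))).
  exact: hor_chart_map.
have nE i k u : overlap phi i k u -> n (chart_inv i u) = expR (f (ht phi i u)) *:
    dstereo kappa k.1 (hor (local_rep phi i k u)) (hor (N k (chart_inv i u))).
  by move=> [_ dk]; have [-> _] := nnu _ _ dk; rewrite lrE.
have nuE i k u : overlap phi i k u -> nu (chart_inv i u) = ver (N k (chart_inv i u)).
  by move=> [_ dk]; have [_ ->] := nnu _ _ dk.
have Ns i k : smooth_on (overlap phi i k) (fun u => N k (chart_inv i u)) by case: Nf.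
have oo i k : open (overlap phi i k) by exact: open_overlap.
have [sp1 sp2] := (smooth_mapP hkappa M_good phi).1 sphi.
have orth i k u X : overlap phi i k u -> ambient_form kappa (n (chart_inv i u)) ('D_X (pr phi i) u)
          + nu (chart_inv i u) * dsc i u X = 0.
  move=> ou; have [_ /(_ X)] := Nn i k u ou.
  have ru := local_rep_region hkappa ou.
  rewrite (inner_ambient hkappa)// -(derive_prE hkappa M_good sphi)//.
  rewrite -(derive_htE hkappa M_good sphi)// -(nuE _ _ _ ou) -(htE hkappa ou) => o.
  rewrite (nE _ _ _ ou) ambient_formZl /dsc.
  apply: (mulfI (lt0r_neq0 (expR_gt0 (f (ht phi i u))))).
  rewrite mulr0 -[RHS]o expRN (_ : expR (2 * _) = expR (f (ht phi i u)) * expR (f (ht phi i u))).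
    by field; rewrite gt_eqF ?expR_gt0.
  by rewrite -expRD; congr expR; ring.
split.
- move=> i; split; last exact: rs.
    move=> j; apply: smooth_on_locally => u iu; have [k ok] := chart_cover iu.
    exists (overlap phi i k) => //.
    exists (fun u => expR (f (ht phi i u)) *
      dstereo kappa k.1 (hor (local_rep phi i k u)) (hor (N k (chart_inv i u))) 0 j); last first.
      by move=> y oy; rewrite (nE _ _ _ oy) mxE.
    apply: smooth_onM => //.
      apply: smooth_on_expR => //.
      have := @smooth_on_comp_interval R _ _ (oo i k) I f (ht phi i) 0%N f_smooth.
      rewrite derive1n0; apply; first by move=> *; exact: height_in.
      by apply: smooth_on_sub (sp2 i).2 => y [].
    apply: smooth_on_dstereo => //.
    + by move=> y oy; case: (local_rep_region hkappa oy).
    + move=> l; have /smooth_on_rowP : smooth_on (overlap phi i k) (local_rep phi i k) by case: sphi.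
      move=> /(_ (oo i k) (lshift 1 l)) s.
      by apply: (smooth_on_eq (oo i k) _ s) => y _; rewrite horE.
    + move=> l; have /smooth_on_rowP := Ns i k.
      move=> /(_ (oo i k) (lshift 1 l)) s.
      by apply: (smooth_on_eq (oo i k) _ s) => y _; rewrite horE.
  apply: smooth_on_locally => u iu; have [k ok] := chart_cover iu.
  exists (overlap phi i k) => //.
  exists (fun u => ver (N k (chart_inv i u))); last by move=> y; exact: nuE.
  have /smooth_on_rowP := Ns i k.
  move=> /(_ (oo i k) (rshift 2 0)) s.
  by apply: (smooth_on_eq (oo i k) _ s) => y _; rewrite verE.
- move=> p; have [k dk] := ambient_cover (phi p); have [-> _] := nnu _ _ dk.
  apply: tangentZ.
  have sd : stereo_dom kappa k.1 (pos (phi p)) by apply/chart_domE.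
  rewrite -{1}(stereo_invK sd); apply: dstereo_tangent.
  exact: stereo_proj_region.
- move=> p; have [i [u iu <-]] := M_cover p; have [k ok] := chart_cover iu.
  have ru := local_rep_region hkappa ok.
  have [+ _] := Nn i k u ok; rewrite (inner_ambient hkappa)//.
  rewrite (nE _ _ _ ok) (nuE _ _ _ ok) ambient_formZl ambient_formZr -(htE hkappa ok) => <-.
  rewrite -expr2; congr (_ + _); rewrite mulrA -expRD; congr (expR _ * _); ring.
- by move=> i u X iu; have [k ok] := chart_cover iu; exact: orth ok.
- move=> i u X iu p l; have [k ok] := chart_cover iu.
  have near_ov : \near u, overlap phi i k u by exact: (open_nbhs_nbhs (conj (oo i k) ok)).
  have dN : differentiable (fun u => N k (chart_inv i u)) u by exact: smooth_on_differentiable (Ns i k) _ ok.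
  have := um i k u X ok.
  move=> /(umbilical_at hkappa I_open f_smooth M_good sphi (n := fun y => n (chart_inv i y))
    (nu := fun y => nu (chart_inv i y)) (rho (chart_inv i u)) ok dN); apply.
  + by apply: filterS near_ov => y; exact: nE.
  + by apply: filterS near_ov => y; exact: nuE.
  + exact: orth ok.
Qed.

(** The vector [e^(-f) n] is tangent to the quadric, so that it has components in
    every chart, which with [nu] make up a unit normal field. *)
Lemma umbilical_of_data n nu rho :
  smooth_map phi -> immersed -> umbilical_data n nu rho -> totally_umbilical phi.
Proof.
move=> sphi im [sd tn un on Dn].
have [cphi _] := sphi.
have oo i k : open (overlap phi i k) by exact: open_overlap.
split; first exact/immersionP.
pose e p := expR (- f (height (phi p))).
pose N (k : idx P) p : 'rV[R]_(2 + 1) :=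
  row_mx (dproj k.1 (pos (phi p)) (e p *: n p)) (const_mx (nu p)).
have Nh k p : hor (N k p) = dproj k.1 (pos (phi p)) (e p *: n p) by rewrite hor_row.
have Nv k p : ver (N k p) = nu p by rewrite ver_row.
have Nd (k : idx P) p : chart_dom k (phi p) ->
  dstereo kappa k.1 (stereo_proj k.1 (pos (phi p))) (hor (N k p)) = e p *: n p.
  by move=> /chart_domE dk; rewrite Nh dstereo_dproj//; exact: tangentZ.
have lrE i (k : idx P) u : hor (local_rep phi i k u) = stereo_proj k.1 (pos (phi (chart_inv i u))).
  exact: hor_chart_map.
have nE i k u : overlap phi i k u -> n (chart_inv i u) = expR (f (ht phi i u)) *:
    dstereo kappa k.1 (hor (local_rep phi i k u)) (hor (N k (chart_inv i u))).
  by move=> [_ dk]; rewrite lrE Nd// scalerA /e expRN mulfV ?gt_eqF ?expR_gt0// scale1r.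
have [sp1 sp2] := (smooth_mapP hkappa M_good phi).1 sphi.
have Ns i k : smooth_on (overlap phi i k) (fun u => N k (chart_inv i u)).
  have [sn snu _] := sd i.
  have ov : overlap phi i k `<=` chart_image i by move=> y [].
  have spr j : smooth_on (overlap phi i k) (fun u => pos (phi (chart_inv i u)) 0 j : R).
    by apply: smooth_on_sub ov _; case: (sp2 i).
  have se : smooth_on (overlap phi i k) (fun u => e (chart_inv i u)).
    apply: smooth_on_expR => //; apply: smooth_onN => //.
    have := @smooth_on_comp_interval R _ _ (oo i k) I f (ht phi i) 0%N f_smooth.
    rewrite derive1n0; apply; first by move=> *; exact: height_in.
    by apply: smooth_on_sub ov _; case: (sp2 i).
  have sen j : smooth_on (overlap phi i k) (fun u => (e (chart_inv i u) *: n (chart_inv i u)) 0 j : R).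
    have s := smooth_onM (oo i k) se (smooth_on_sub ov (sn j)).
    by apply: (smooth_on_eq (oo i k) _ s) => y _; rewrite mxE.
  have sden : smooth_on (overlap phi i k) (fun u =>
     (1 + stereo_sign k.1 * pos (phi (chart_inv i u)) 0 2%:R)^-1).
    apply: smooth_onV => //.
      by move=> u [_ /chart_domE[_ d]]; rewrite gt_eqF.
    apply: smooth_onD => //; first exact: smooth_on_cst.
    by apply: smooth_onM => //; exact: smooth_on_cst.
  have sden2 : smooth_on (overlap phi i k) (fun u =>
     ((1 + stereo_sign k.1 * pos (phi (chart_inv i u)) 0 2%:R) ^+ 2)^-1).
    apply: (smooth_on_eq (oo i k) _ (smooth_onX (oo i k) 2 sden)) => y _.
    by rewrite exprVn.
  have scomp j : smooth_on (overlap phi i k) (fun u =>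
      2 * (e (chart_inv i u) *: n (chart_inv i u)) 0 j
        * (1 + stereo_sign k.1 * pos (phi (chart_inv i u)) 0 2%:R)^-1
      - 2 * pos (phi (chart_inv i u)) 0 j
          * (stereo_sign k.1 * (e (chart_inv i u) *: n (chart_inv i u)) 0 2%:R)
          * ((1 + stereo_sign k.1 * pos (phi (chart_inv i u)) 0 2%:R) ^+ 2)^-1).
    apply: smooth_onB => //; apply: smooth_onM => //; apply: smooth_onM => //.
    - exact: smooth_on_cst.
    - by apply: smooth_onM => //; exact: smooth_on_cst.
    - by apply: smooth_onM => //; exact: smooth_on_cst.
  apply/smooth_on_rowP => // j.
  rewrite -(fintype.splitK j); case: (fintype.split j) => l; rewrite /unsplit.
    have [->|->] := ord2_cases l.
    - apply: (smooth_on_eq (oo i k) _ (scomp 0)) => y _.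
      by rewrite -horE Nh /dproj row2E.
    - apply: (smooth_on_eq (oo i k) _ (scomp 1)) => y _.
      by rewrite -horE Nh /dproj row2E.
  apply: (smooth_on_eq (oo i k) _ (smooth_on_sub ov snu)) => y _.
  by rewrite ord1 -verE Nv.
exists N, rho; split.
- split.
    split=> [j k p dj dk|]; last exact: Ns.
    have [h1 h2] := chart_change hkappa I_open (N j p) dj dk.
    apply: hor_ver_inj; last by rewrite h2 !Nv.
    have rk : stereo_region kappa k.1 (stereo_proj k.1 (pos (phi p))).
      by apply: stereo_proj_region => //; apply/chart_domE.
    by apply: (dstereo_inj rk); rewrite h1 !Nd.
  move=> i k u ok G; have ru := local_rep_region hkappa ok.
  have e0 : expR (f (ht phi i u)) != 0 by rewrite gt_eqF// expR_gt0.
  have e2 : expR (2 * f (ht phi i u)) = expR (f (ht phi i u)) * expR (f (ht phi i u)).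
    by rewrite -expRD; congr expR; ring.
  split.
    rewrite (inner_ambient hkappa)// -(htE hkappa ok) Nv -[RHS](un (chart_inv i u)).
    by rewrite (nE _ _ _ ok) ambient_formZl ambient_formZr e2 -expr2 mulrA.
  move=> X; rewrite (inner_ambient hkappa)// -(derive_prE hkappa M_good sphi)//.
  rewrite -(derive_htE hkappa M_good sphi)// Nv -(htE hkappa ok).
  have := on i u X; case: (ok) => iu _ /(_ iu).
  rewrite (nE _ _ _ ok) ambient_formZl /dsc expRN => h.
  rewrite -(mulr0 (expR (f (ht phi i u)))) -h e2.
  by field.
- by move=> i; case: (sd i).
- move=> i k u X ok; have iu : chart_image i u by case: ok.
  have near_ov : \near u, overlap phi i k u by exact: (open_nbhs_nbhs (conj (oo i k) ok)).
  have dN : differentiable (fun u => N k (chart_inv i u)) u by exact: smooth_on_differentiable (Ns i k) _ ok.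
  apply/(umbilical_at hkappa I_open f_smooth M_good sphi (n := fun y => n (chart_inv i y))
    (nu := fun y => nu (chart_inv i y)) (rho (chart_inv i u)) ok dN).
  + by apply: filterS near_ov => y; exact: nE.
  + by apply: filterS near_ov => y _; rewrite Nv.
  + exact: on.
  + exact: Dn.
Qed.

End one_map.
End umbilical_data.

(** * Symmetry of second derivatives and functions with zero derivative *)

Section line.
Context {R : realType} {n : nat}.
Implicit Types (F : 'rV[R]_n -> R) (x v : 'rV[R]_n).

Lemma has_derive_line F x v s : differentiable F (s *: v + x) ->
  is_derive s 1 (fun r : R => F (r *: v + x)) ('D_v F (s *: v + x)).
Proof.
move=> dF; have dv : derivable F (s *: v + x) v by exact: diff_derivable.
have E : (fun h : R => F ((h *: (1 : R) + s) *: v + x)) = (fun h => F (h *: v + (s *: v + x))).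
  by apply/funext => h; rewrite scalerDl addrA [h%:A]mulr1.
split.
  by apply/derivable1P; rewrite E; exact: (derivable1P F (s *: v + x) v).1.
rewrite /derive; apply: congr1; apply: (congr1 (fun g : R -> R => g x0 @[x0 --> 0^'])).
by apply/funext => h; rewrite /= scalerDl addrA [h%:A]mulr1.
Qed.

Lemma MVT_line F x v h : 0 < h ->
  (forall s, 0 <= s <= h -> differentiable F (s *: v + x)) ->
  exists2 s, 0 < s < h & F (h *: v + x) - F x = h * 'D_v F (s *: v + x).
Proof.
move=> h0 dF.
have hd s : 0 <= s <= h -> is_derive s 1 (fun r : R => F (r *: v + x)) ('D_v F (s *: v + x)).
  by move=> hs; apply: has_derive_line; exact: dF.
have [||s + E] := @MVT R (fun r : R => F (r *: v + x)) (fun s => 'D_v F (s *: v + x)) 0 h h0.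
- by move=> s; rewrite in_itv /= => /andP[s0 sh]; apply: hd; rewrite !ltW.
- apply: derivable_within_continuous => s; rewrite in_itv /= => hs.
  by case: (hd s hs).
rewrite in_itv /= => hs; exists s => //.
by move: E; rewrite scale0r add0r subr0 mulrC.
Qed.

Lemma smooth_on_near_ball (U : set 'rV[R]_n) x : open U -> U x ->
  exists2 r, 0 < r & forall v, `|v| < r -> U (v + x).
Proof.
move=> Uo Ux; have /nbhs_ballP[r r0 rU] := open_nbhs_nbhs (conj Uo Ux).
exists r => // v vr; apply: rU; rewrite -ball_normE /ball_ /=.
by rewrite opprD addrCA subrr addr0 normrN.
Qed.

(** The second difference of [F] along two directions, divided by the square of
    the step, tends to either of the mixed derivatives. *)
Lemma second_difference (U : set 'rV[R]_n) F x i j h r :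
  open U -> smooth_on U F -> (forall v, `|v| < r -> U (v + x)) -> 0 < h ->
  h * (`|delta_mx 0 i : 'rV[R]_n| + `|delta_mx 0 j : 'rV[R]_n|) < r ->
  exists2 v : 'rV[R]_n, `|v| <= h * (`|delta_mx 0 i : 'rV[R]_n| + `|delta_mx 0 j : 'rV[R]_n|) &
  F (h *: delta_mx 0 i + (h *: delta_mx 0 j + x)) - F (h *: delta_mx 0 j + x)
    - (F (h *: delta_mx 0 i + x) - F x) = h ^+ 2 * partial j (partial i F) (v + x).
Proof.
move=> Uo sF Ur h0 hr; set ei : 'rV[R]_n := delta_mx 0 i; set ej : 'rV[R]_n := delta_mx 0 j.
have bd s t : 0 <= s <= h -> 0 <= t <= h ->
    `|s *: ei + t *: ej| <= h * (`|ei| + `|ej|).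
  move=> /andP[s0 sh] /andP[t0 th].
  rewrite (le_trans (ler_normD _ _))// !normrZ !ger0_norm// mulrDr.
  by rewrite lerD// ler_wpM2r.
have Ust s t : 0 <= s <= h -> 0 <= t <= h -> U (s *: ei + (t *: ej + x)).
  by move=> hs ht; rewrite addrA; apply: Ur; exact: le_lt_trans (bd _ _ hs ht) hr.
have h00 : 0 <= (0 : R) <= h by rewrite lexx ltW.
have hh : 0 <= h <= h by rewrite lexx ltW.
pose G y := F (h *: ej + y) - F y.
have dF y : U y -> differentiable F y by move=> Uy; exact: (smooth_on_differentiable sF).
have dsh y : U (h *: ej + y) -> differentiable (fun y => F (h *: ej + y)) y.
  move=> Uy; apply: (@differentiable_comp _ _ _ _ (fun y => h *: ej + y) F).
    by apply: differentiableD => //; exact: differentiable_cst.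
  exact: dF.
have U1 s : 0 <= s <= h -> U (h *: ej + (s *: ei + x)).
  by move=> hs; rewrite addrCA; exact: Ust.
have U2 s : 0 <= s <= h -> U (s *: ei + x).
  by move=> hs; have := Ust s 0 hs h00; rewrite scale0r add0r.
have [|s hs Es] := @MVT_line G x ei h h0.
  by move=> s hs; apply: differentiableB; [apply: dsh; exact: U1|apply: dF; exact: U2].
have hs' : 0 <= s <= h by case/andP: hs => ? ?; rewrite !ltW.
have E2 : 'D_ei (fun y => F (h *: ej + y)) (s *: ei + x) = 'D_ei F (h *: ej + (s *: ei + x)).
  rewrite /derive; apply: congr1; apply: (congr1 (fun g : R -> R => g x0 @[x0 --> 0^'])).
  by apply/funext => k /=; rewrite addrCA.
have DG : 'D_ei G (s *: ei + x) = 'D_ei F (h *: ej + (s *: ei + x)) - 'D_ei F (s *: ei + x).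
  have hd1 := differentiable_has_derive ei (dsh _ (U1 s hs')).
  have hd2 := differentiable_has_derive ei (dF _ (U2 s hs')).
  have [_ E1] := has_deriveB hd1 hd2.
  by rewrite -E2; exact: E1.
have DP y : 'D_ei F y = partial i F y by [].
have [|t ht Et] := @MVT_line (partial i F) (s *: ei + x) ej h h0.
  move=> t ht; rewrite addrCA.
  by apply: (smooth_on_differentiable (smooth_on_partial i sF)); exact: Ust.
have ht' : 0 <= t <= h by case/andP: ht => ? ?; rewrite !ltW.
exists (s *: ei + t *: ej); first exact: bd.
have swap (a b c d : R) : a - b - (c - d) = a - c - (b - d) by ring.
rewrite -(addrA (s *: ei)) expr2 -(mulrA h h).
by move: Es; rewrite DG !DP Et /G [t *: ej + _]addrCA swap [h *: ej + (h *: ei + x)]addrCA.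
Qed.

(** The second difference of the function is symmetric in the two directions. *)
Lemma schwarz (U : set 'rV[R]_n) F x i j : open U -> smooth_on U F -> U x ->
  partial i (partial j F) x = partial j (partial i F) x.
Proof.
move=> Uo sF Ux; have [r r0 rU] := smooth_on_near_ball Uo Ux.
apply/eqP; rewrite -subr_eq0; apply/negPn/negP => ne0.
set d := `|partial i (partial j F) x - partial j (partial i F) x|.
have d0 : 0 < d by rewrite normr_gt0.
have near_val k l : exists2 q, 0 < q & forall v, `|v| < q ->
    `|partial k (partial l F) (v + x) - partial k (partial l F) x| < d / 2.
  have /differentiable_continuous c : differentiable (partial k (partial l F)) x.
    by apply: (smooth_on_differentiable (smooth_on_partial k (smooth_on_partial l sF))).
  have d20 : 0 < d / 2 by rewrite divr_gt0.
  move/cvgrPdist_lt: c => /(_ _ d20)/nbhs_ballP[q q0 qB].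
  exists q => // v vq; have bv : ball x q (v + x).
    by rewrite -ball_normE /ball_ /= opprD addrCA subrr addr0 normrN.
  by rewrite distrC; exact: (qB _ bv).
have [q1 q10 B1] := near_val i j; have [q2 q20 B2] := near_val j i.
pose N := `|delta_mx 0 i : 'rV[R]_n| + `|delta_mx 0 j : 'rV[R]_n| + 1.
have N0 : 0 < N by rewrite ltr_wpDl// addr_ge0.
pose q := Num.min r (Num.min q1 q2).
have q0 : 0 < q by rewrite !lt_min r0 q10 q20.
pose h := q / (2 * N).
have h0 : 0 < h by rewrite divr_gt0// mulr_gt0.
have hN : h * N < q.
  rewrite (_ : h * N = q / 2); first by rewrite ltr_pdivrMr// ltr_pMr// ltr1n.
  by rewrite /h; field; rewrite gt_eqF.
have hN' : h * (`|delta_mx 0 i : 'rV[R]_n| + `|delta_mx 0 j : 'rV[R]_n|) < q.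
  by apply: le_lt_trans hN; rewrite ler_pM2l// lerDl.
have hr : h * (`|delta_mx 0 i : 'rV[R]_n| + `|delta_mx 0 j : 'rV[R]_n|) < r.
  by apply: lt_le_trans hN' _; rewrite ge_min lexx.
have hq1 : h * (`|delta_mx 0 i : 'rV[R]_n| + `|delta_mx 0 j : 'rV[R]_n|) < q1.
  by apply: lt_le_trans hN' _; rewrite !ge_min lexx orbT.
have hq2 : h * (`|delta_mx 0 i : 'rV[R]_n| + `|delta_mx 0 j : 'rV[R]_n|) < q2.
  by apply: lt_le_trans hN' _; rewrite !ge_min lexx !orbT.
have [v vb Ev] := second_difference Uo sF rU h0 hr.
rewrite addrC in hr; have [w wb Ew] := second_difference Uo sF rU h0 hr.
rewrite addrC in wb.
have Evw : partial j (partial i F) (v + x) = partial i (partial j F) (w + x).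
  have h2 : h ^+ 2 != 0 by rewrite expf_neq0// gt_eqF.
  have swap (a b c e : R) : a - b - (c - e) = a - c - (b - e) by ring.
  have E : h ^+ 2 * partial j (partial i F) (v + x) = h ^+ 2 * partial i (partial j F) (w + x).
    refine (etrans (esym Ev) (etrans _ Ew)).
    by rewrite [h *: delta_mx 0 i + (h *: _ + x)]addrCA; exact: swap.
  exact: (mulfI h2 E).
have b1 := B1 w (le_lt_trans wb hq1); have b2 := B2 v (le_lt_trans vb hq2).
have : d < d.
  rewrite {1}/d [ltRHS](splitr d).
  rewrite (_ : partial i (partial j F) x - _ =
    (partial j (partial i F) (v + x) - partial j (partial i F) x)
    - (partial i (partial j F) (w + x) - partial i (partial j F) x)); last first.
    have canc (a b c : R) : a - b = c - b - (c - a) by ring.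
    by rewrite Evw; exact: canc.
  exact: le_lt_trans (ler_normB _ _) (ltrD b2 b1).
by rewrite ltxx.
Qed.

Lemma zero_derive_near (U : set 'rV[R]_n) F x : open U -> U x ->
  (forall y, U y -> differentiable F y) -> (forall y v, U y -> 'D_v F y = 0) ->
  \forall y \near x, F y = F x.
Proof.
move=> Uo Ux dF DF; have [r r0 rU] := smooth_on_near_ball Uo Ux.
apply/nbhs_ballP; exists r => // y; rewrite -ball_normE /ball_ /= => xy.
have sU s : 0 <= s <= 1 -> U (s *: (y - x) + x).
  move=> /andP[s0 s1]; apply: rU; rewrite normrZ ger0_norm//.
  by rewrite -normrN opprB; apply: le_lt_trans xy; rewrite ler_piMl.
have [|s hs E] := @MVT_line F x (y - x) 1 ltr01.
  by move=> s hs; apply: dF; exact: sU.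
have hs' : 0 <= s <= 1 by case/andP: hs => ? ?; rewrite !ltW.
move: E; rewrite scale1r subrK DF ?mulr0; last exact: sU.
by move/eqP; rewrite subr_eq0 => /eqP.
Qed.

End line.

Lemma connected_locally_constant {T : topologicalType} {S : Type} (G : T -> S) :
  connected [set: T] -> (forall p, \forall q \near p, G q = G p) ->
  forall p q, G p = G q.
Proof.
move=> cT lG p q.
have oB (B : set S) : open (G @^-1` B).
  rewrite openE => y By; have := lG y.
  by apply: filterS => z; rewrite /preimage /= => ->.
have E : G @^-1` [set G p] = [set: T].
  apply: cT; first by exists p.
    by exists (G @^-1` [set G p]); [exact: oB|rewrite setTI].
  exists (G @^-1` [set G p]); last by rewrite setTI.
  by rewrite -openC preimage_setC; exact: oB.
have : [set: T] q by [].
by rewrite -E => ->.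
Qed.

(** * The Codazzi equation *)

(** Commuting the second derivatives of the normal field, given by the
    Weingarten formula, shows that the differential of the principal curvature
    minus [kappa * nu * ds] is proportional to that of every coordinate of an
    immersion, hence vanishes. *)
Lemma codazzi {R : realType} (kappa : R) (U : set 'rV[R]_2)
    (nu l : 'rV[R]_2 -> R) (s : 'I_2 -> 'rV[R]_2 -> R)
    (p n : 'I_3 -> 'rV[R]_2 -> R) :
  open U -> smooth_on U nu -> smooth_on U l -> (forall a, smooth_on U (s a)) ->
  (forall j, smooth_on U (p j)) -> (forall j, smooth_on U (n j)) ->
  (forall a b y, U y -> partial b (s a) y = partial a (s b) y) ->
  (forall j a y, U y -> partial a (n j) y =
     l y * partial a (p j) y + kappa * nu y * s a y * p j y) ->
  (forall a y, U y -> partial a nu y = l y * s a y) ->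
  (forall y (X : 'rV[R]_2), U y -> (forall j, X 0 0 * partial 0 (p j) y + X 0 1 * partial 1 (p j) y = 0) ->
     X 0 0 * s 0 y + X 0 1 * s 1 y = 0 -> X = 0) ->
  forall a y, U y -> partial a l y = kappa * nu y * s a y.
Proof.
move=> Uo snu sl ss sp sn symm hn hnu imm.
have hdp F a y : smooth_on U F -> U y -> has_derive y (delta_mx 0 a) F (partial a F y).
  by move=> sF Uy; apply: differentiable_has_derive; exact: (smooth_on_differentiable sF).
have D2n j a b y : U y -> partial b (partial a (n j)) y =
    partial b l y * partial a (p j) y + l y * partial b (partial a (p j)) y
    + ((kappa * partial b nu y * s a y + kappa * nu y * partial b (s a) y) * p j y
       + kappa * nu y * s a y * partial b (p j) y).
  move=> Uy; rewrite (partial_eq_on Uo (hn j a))// /partial.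
  have hd : has_derive y (delta_mx 0 b)
    (fun y => l y * partial a (p j) y + kappa * nu y * s a y * p j y)
    (partial b l y * partial a (p j) y + l y * partial b (partial a (p j)) y
    + ((kappa * partial b nu y * s a y + kappa * nu y * partial b (s a) y) * p j y
       + kappa * nu y * s a y * partial b (p j) y)).
    apply: has_derive_conv; eexists.
      apply: has_deriveD; apply: has_deriveM.
      - exact: hdp.
      - by apply: hdp => //; exact: smooth_on_partial.
      - apply: has_deriveM; last exact: hdp.
        by apply: has_deriveM; [exact: has_derive_cst|exact: hdp].
      - exact: hdp.
    by cbv beta; rewrite mul0r add0r.
  by case: hd.
have D2nu a b y : U y -> partial b (partial a nu) y =
    partial b l y * s a y + l y * partial b (s a) y.
  move=> Uy; rewrite (partial_eq_on Uo (hnu a))// /partial.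
  have hd : has_derive y (delta_mx 0 b) (fun y => l y * s a y)
     (partial b l y * s a y + l y * partial b (s a) y).
    by apply: has_deriveM; exact: hdp.
  by case: hd.
move=> a y Uy.
pose al b := partial b l y - kappa * nu y * s b y.
have alp j : al 1 * partial 0 (p j) y - al 0 * partial 1 (p j) y = 0.
  have := schwarz 1 0 Uo (sn j) Uy; rewrite !D2n// (schwarz 1 0 Uo (sp j) Uy) !hnu//.
  rewrite (symm 1 0 y Uy) /al => h.
  have aux (l0 l1 P0 P1 L k v s0 s1 q S Q : R) :
    l1 * P0 + L * Q + ((k * (L * s1) * s0 + k * v * S) * q + k * v * s0 * P1) =
    l0 * P1 + L * Q + ((k * (L * s0) * s1 + k * v * S) * q + k * v * s1 * P0) ->
    (l1 - k * v * s1) * P0 - (l0 - k * v * s0) * P1 = 0.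
    move=> E; rewrite -(subrr (l0 * P1 + L * Q + ((k * (L * s0) * s1 + k * v * S) * q + k * v * s1 * P0))).
    by rewrite -[X in _ = X - _]E; ring.
  exact: aux h.
have als : al 1 * s 0 y - al 0 * s 1 y = 0.
  have := schwarz 1 0 Uo snu Uy; rewrite !D2nu// (symm 1 0 y Uy) /al => h.
  have aux (l0 l1 L k v s0 s1 S : R) : l1 * s0 + L * S = l0 * s1 + L * S ->
    (l1 - k * v * s1) * s0 - (l0 - k * v * s0) * s1 = 0.
    by move=> /addIr E; rewrite !mulrBl E; ring.
  exact: aux h.
have /matrixP X0 : row2 (al 1) (- al 0) = 0.
  apply: (imm y) => // [j|]; rewrite !row2E mulNr; [exact: alp|exact: als].
have al1 : al 1 = 0 by have := X0 0 0; rewrite row2E mxE.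
have al0 : al 0 = 0 by have /eqP := X0 0 1; rewrite row2E mxE oppr_eq0 => /eqP.
have [->|->] := ord2_cases a.
- exact: subr0_eq al0.
- exact: subr0_eq al1.
Qed.

Section constant_vector.
Context {R : realType}.
Variable kappa : R.
Hypothesis hkappa : kappa = -1 \/ kappa = 0 \/ kappa = 1.
Variables (I : set R) (I0 : I !=set0) (f : R -> R).
Hypothesis I_open : open I.
Hypothesis f_smooth : smooth_on_interval I f.
Notation P := (warped_product (space_form kappa) f I0).
Context {M : manifold R 2}.
Hypothesis M_good : good_charts M.
Variable phi : M -> P.
Hypothesis phi_smooth : smooth_map phi.
Hypothesis phi_imm : immersed phi.
Variables (n : M -> 'rV[R]_3) (nu rho : M -> R).
Hypothesis data : umbilical_data phi n nu rho.
Implicit Types (i : idx M).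

Lemma smooth_pr i j : smooth_on (chart_image i) (fun u => pr phi i u 0 j : R).
Proof. by have [_ /(_ i)[]] := (smooth_mapP hkappa M_good phi).1 phi_smooth. Qed.

Lemma smooth_ht i : smooth_on (chart_image i) (fun u => ht phi i u : R).
Proof. by have [_ /(_ i)[]] := (smooth_mapP hkappa M_good phi).1 phi_smooth. Qed.

Lemma chart_open (i : idx M) : open (chart_image i).
Proof. by case: (M_good i). Qed.

Lemma has_derive_at i (F : 'rV[R]_2 -> R) u X : smooth_on (chart_image i) F ->
  chart_image i u -> has_derive u X F ('D_X F u).
Proof.
by move=> sF iu; apply: differentiable_has_derive; exact: (smooth_on_differentiable sF).
Qed.

Lemma derive_prj i j u X : chart_image i u ->
  ('D_X (pr phi i) u) 0 j = 'D_X (fun y => pr phi i y 0 j : R) u.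
Proof.
move=> iu; apply: derive_row; apply: diff_derivable; apply/differentiable_rowP => l.
exact: (smooth_on_differentiable (@smooth_pr i l)).
Qed.

Lemma smooth_f_ht m i : smooth_on (chart_image i) (fun u => (f^`(m))%classic (ht phi i u) : R).
Proof.
apply: (@smooth_on_comp_interval R _ _ (@chart_open i) I f (ht phi i) m f_smooth); last exact: smooth_ht.
by move=> *; exact: height_in.
Qed.

Definition lamf i u : R := lam f (nu (chart_inv i u)) (rho (chart_inv i u)) (ht phi i u).

Lemma smooth_nu i : smooth_on (chart_image i) (fun u => nu (chart_inv i u) : R).
Proof. by case: data => /(_ i)[]. Qed.

Lemma smooth_n i j : smooth_on (chart_image i) (fun u => n (chart_inv i u) 0 j : R).
Proof. by case: data => /(_ i)[]. Qed.

Lemma smooth_lamf i : smooth_on (chart_image i) (lamf i).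
Proof.
have Uo := @chart_open i; have [/(_ i)[_ snu srho] _ _ _ _] := data.
apply: smooth_onN => //; apply: smooth_onM => //; last first.
  by apply: smooth_on_expR => //; have := @smooth_f_ht 0%N i; rewrite derive1n0.
by apply: smooth_onD => //; apply: smooth_onM => //; exact: smooth_f_ht.
Qed.

Definition dspartial i (a : 'I_2) (u : 'rV[R]_2) : R := dsc phi i u (delta_mx 0 a).

Lemma smooth_dspartial i a : smooth_on (chart_image i) (dspartial i a).
Proof.
have Uo := @chart_open i; apply: smooth_onM => //.
  by apply: smooth_on_expR => //; apply: smooth_onN => //;
    have := @smooth_f_ht 0%N i; rewrite derive1n0.
exact: (smooth_on_partial a (@smooth_ht i)).
Qed.

(** The form [ds] is closed, as a multiple of [dt] by a function of [t]. *)
Lemma dspartial_symm i a b u : chart_image i u ->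
  partial b (dspartial i a) u = partial a (dspartial i b) u.
Proof.
have Uo := @chart_open i.
have D c d y : chart_image i y -> partial d (dspartial i c) y =
    - (expR (- f (ht phi i y)) * (f^`(1))%classic (ht phi i y)) *
      partial d (ht phi i) y * partial c (ht phi i) y
    + expR (- f (ht phi i y)) * partial d (partial c (ht phi i)) y.
  move=> iy.
  have hf : has_derive (ht phi i y) 1 f ((f^`(1))%classic (ht phi i y)).
    by apply: (has_derive_interval f_smooth); exact: height_in.
  have hd : has_derive y (delta_mx 0 d) (dspartial i c)
    (- (expR (- f (ht phi i y)) * (f^`(1))%classic (ht phi i y)) *
      partial d (ht phi i) y * partial c (ht phi i) y
    + expR (- f (ht phi i y)) * partial d (partial c (ht phi i)) y).
    apply: has_derive_conv; eexists.
      apply: has_deriveM.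
        apply: (has_derive_comp (is_derive_expR _)); apply: has_deriveN.
        apply: (has_derive_comp hf); apply: (has_derive_at _ (@smooth_ht i) iy).
      apply: (has_derive_at _ (smooth_on_partial c (@smooth_ht i)) iy).
    by cbv beta; rewrite /partial; ring.
  by case: hd.
have aux (k x y g z : R) : - k * x * y + g * z = - k * y * x + g * z by ring.
move=> iu; rewrite (D a b u iu) (D b a u iu).
have E : partial a (partial b (ht phi i)) u = partial b (partial a (ht phi i)) u.
  exact: (schwarz a b Uo (@smooth_ht i) iu).
by rewrite E; exact: aux.
Qed.

Lemma dsc_sum i u X : chart_image i u ->
  dsc phi i u X = X 0 0 * dspartial i 0 u + X 0 1 * dspartial i 1 u.
Proof.
move=> iu; rewrite /dspartial /dsc derive_partialE; last first.
  exact: (smooth_on_differentiable (@smooth_ht i)).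
by rewrite sum2E /partial /GRing.scale /=; ring.
Qed.

Lemma derive_sum i (F : 'rV[R]_2 -> R) u X : smooth_on (chart_image i) F ->
  chart_image i u -> 'D_X F u = X 0 0 * partial 0 F u + X 0 1 * partial 1 F u.
Proof.
move=> sF iu; rewrite derive_partialE; last exact: (smooth_on_differentiable sF).
by rewrite sum2E.
Qed.

Lemma derive_lamf i u X : chart_image i u ->
  'D_X (lamf i) u = kappa * nu (chart_inv i u) * dsc phi i u X.
Proof.
move=> iu; rewrite (derive_sum X (@smooth_lamf i) iu) dsc_sum//.
have [_ _ _ _ D] := data.
have K a y : chart_image i y -> partial a (lamf i) y =
    kappa * nu (chart_inv i y) * dspartial i a y.
  apply: (@codazzi R kappa (chart_image i) (fun y => nu (chart_inv i y)) (lamf i)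
    (dspartial i) (fun j y => pr phi i y 0 j) (fun j y => n (chart_inv i y) 0 j)).
  - exact: chart_open.
  - exact: smooth_nu.
  - exact: smooth_lamf.
  - exact: smooth_dspartial.
  - exact: smooth_pr.
  - exact: smooth_n.
  - by move=> *; exact: dspartial_symm.
  - move=> j c z iz; have [/(_ j) + _] := D i z (delta_mx 0 c) iz.
    by rewrite derive_prj.
  - by move=> c z iz; have [_ +] := D i z (delta_mx 0 c) iz.
  - move=> z Y iz hp hs; apply: (phi_imm iz).
      apply/rowP => j; rewrite derive_prj// mxE -(hp j).
      exact: (derive_sum _ (@smooth_pr i j) iz).
    have : dsc phi i z Y = 0 by rewrite dsc_sum.
    by rewrite /dsc => /eqP; rewrite mulf_eq0 gt_eqF ?expR_gt0//= => /eqP.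
by rewrite !K//; ring.
Qed.

(** By the Weingarten formula and [derive_lamf], the derivatives
    [lam dP + kappa nu ds P] of [n] and of [lam P] agree. *)
Lemma derive_axis i u X j : chart_image i u ->
  'D_X (fun y => n (chart_inv i y) 0 j - lamf i y * pr phi i y 0 j : R) u = 0.
Proof.
move=> iu; have [_ _ _ _ /(_ i u X iu)[/(_ j) D _]] := data.
have hd : has_derive u X (fun y => n (chart_inv i y) 0 j - lamf i y * pr phi i y 0 j) 0.
  apply: has_derive_conv; eexists.
    apply: has_deriveB; first exact: (has_derive_at _ (@smooth_n i j) iu).
    by apply: has_deriveM; [exact: (has_derive_at _ (@smooth_lamf i) iu)|
      exact: (has_derive_at _ (@smooth_pr i j) iu)].
  by cbv beta; rewrite D derive_lamf// derive_prj// /lamf; ring.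
by case: hd.
Qed.

End constant_vector.

(** * Primitives on an interval *)

Section primitive.
Context {R : realType}.
Variables (I : set R).
Hypotheses (I_open : open I) (I_itv : is_interval I).
Local Notation mu := (@lebesgue_measure R).

Lemma open_interval_lt t : I t -> exists2 a, I a & a < t.
Proof.
move=> It; have /nbhs_ballP[e e0 eI] := open_nbhs_nbhs (conj I_open It).
exists (t - e / 2); last by rewrite ltrBlDr ltrDl divr_gt0.
apply: eI; rewrite /ball /= opprB addrCA subrr addr0 gtr0_norm ?divr_gt0//.
by rewrite ltr_pdivrMr// ltr_pMr// ltr1n.
Qed.

Lemma open_interval_gt t : I t -> exists2 a, I a & t < a.
Proof.
move=> It; have /nbhs_ballP[e e0 eI] := open_nbhs_nbhs (conj I_open It).
exists (t + e / 2); last by rewrite ltrDl divr_gt0.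
apply: eI; rewrite /ball /= opprD addNKr normrN gtr0_norm ?divr_gt0//.
by rewrite ltr_pdivrMr// ltr_pMr// ltr1n.
Qed.

(** The integral from [t0], written near [t] as a difference of integrals from a
    point of [I] on the left of [t0] and of [t]. *)
Lemma primitive_exists (g : R -> R) t0 : I t0 -> {in I, continuous g} ->
  exists s : R -> R, forall t, I t -> is_derive t 1 s (g t).
Proof.
move=> It0 cg.
have sub a b x : I a -> I b -> a <= x <= b -> I x.
  by move=> Ia Ib axb; exact: (I_itv Ia Ib).
have int a b : I a -> I b -> mu.-integrable `[a, b]%classic (EFin \o g).
  move=> Ia Ib; apply: continuous_compact_integrable; first exact: segment_compact.
  apply: continuous_in_subspaceT => x; rewrite inE /= in_itv /= => xab.
  by apply: cg; apply: mem_set; exact: sub Ia Ib xab.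
pose F a x := (\int[mu]_(t in `[a, x]) g t)%R.
pose s x := if t0 <= x then (\int[mu]_(t in `]t0, x]) g t)%R
  else - (\int[mu]_(t in `]x, t0]) g t)%R.
have sE a x : I a -> I x -> a < t0 -> a < x -> s x = F a x - F a t0.
  move=> Ia Ix at0 ax; rewrite /s /F; case: ifPn => [t0x|].
    by rewrite Rintegral_itvB//; [exact: int|rewrite bnd_simp ltW].
  rewrite -ltNge => xt0; rewrite -opprB; congr (- _); symmetry.
  apply: Rintegral_itvB; [exact: int|by rewrite bnd_simp ltW|by rewrite bnd_simp ltW].
exists s => t It.
have Im : I (Num.min t t0) by case: (leP t t0).
have [a Ia am] := open_interval_lt Im; have [u Iu tu] := open_interval_gt It.
move: am; rewrite lt_min => /andP[at_ at0].
have [dF FE] : derivable (F a) t 1 /\ ((F a)^`())%classic t = g t.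
  apply: (@continuous_FTC1 R g (BLeft a) t u tu) => //; first exact: int.
  by apply: cg; exact: mem_set.
have hF : is_derive t 1 (fun x => F a x - F a t0) (g t).
  apply: has_derive_conv; eexists.
    apply: has_deriveB; last exact: has_derive_cst.
    exact: (derivableP dF).
  by rewrite subr0 -FE derive1E.
apply: near_eq_is_derive hF; near=> x; rewrite (sE a)//.
  by near: x; exact: (open_nbhs_nbhs (conj I_open It)).
by near: x; exact: lt_nbhsr.
Unshelve. all: by end_near. Qed.

End primitive.

(** * Generalized trigonometric functions *)

Section oscillator.
Context {R : realType}.

(** [S] and [C] are [sin] and [1 - cos] for [D = 1], [sinh] and [cosh - 1] for
    [D = -1], and [x] and [x^2/2] for [D = 0]. *)
Definition oscillator (D : R) (S C : R -> R) : Prop :=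
  [/\ S 0 = 0, C 0 = 0, forall x : R, is_derive x 1 S (1 - D * C x) &
      forall x : R, is_derive x 1 C (S x)].

Lemma has_derive_scale (w x : R) : has_derive x 1 (fun y => w * y) w.
Proof.
apply: has_derive_conv; eexists.
  by apply: has_deriveM; [exact: has_derive_cst|exact: is_derive_id].
by rewrite mul0r add0r mulr1.
Qed.

Lemma oscillator_exists (D : R) : exists S C, oscillator D S C.
Proof.
have [D0|D0|->] := ltgtP D 0.
- pose w := Num.sqrt (- D).
  have w0 : w != 0 by rewrite sqrtr_eq0 -ltNge oppr_gt0.
  have w2 : D = - (w * w) by rewrite -expr2 sqr_sqrtr ?opprK// oppr_ge0 ltW.
  have hp (x : R) : has_derive x 1 (fun y => expR (w * y)) (expR (w * x) * w).
    exact: (has_derive_comp (is_derive_expR _) (has_derive_scale w x)).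
  have hm (x : R) : has_derive x 1 (fun y => expR (- w * y)) (expR (- w * x) * - w).
    exact: (has_derive_comp (is_derive_expR _) (has_derive_scale (- w) x)).
  exists (fun x => (expR (w * x) - expR (- w * x)) * (2 * w)^-1).
  exists (fun x => (expR (w * x) + expR (- w * x) - 2) * (2 * (w * w))^-1); split.
  + by rewrite !mulr0 subrr mul0r.
  + by rewrite !mulr0 expR0 (_ : 1 + 1 - 2 = 0) ?mul0r//; ring.
  + move=> x; apply: has_derive_conv; eexists.
      apply: has_deriveM; last exact: has_derive_cst.
      by apply: has_deriveB; [exact: hp|exact: hm].
    by cbv beta; rewrite w2; field.
  + move=> x; apply: has_derive_conv; eexists.
      apply: has_deriveM; last exact: has_derive_cst.
      by apply: has_deriveB; [apply: has_deriveD; [exact: hp|exact: hm]|exact: has_derive_cst].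
    by cbv beta; field.
- pose w := Num.sqrt D.
  have w0 : w != 0 by rewrite sqrtr_eq0 -ltNge.
  have w2 : D = w * w by rewrite -expr2 sqr_sqrtr// ltW.
  have hs (x : R) : has_derive x 1 (fun y => sin (w * y)) (cos (w * x) * w).
    exact: (has_derive_comp (is_derive_sin _) (has_derive_scale w x)).
  have hc (x : R) : has_derive x 1 (fun y => cos (w * y)) (- sin (w * x) * w).
    exact: (has_derive_comp (is_derive_cos _) (has_derive_scale w x)).
  exists (fun x => sin (w * x) * w^-1).
  exists (fun x => (1 - cos (w * x)) * (w * w)^-1); split.
  + by rewrite mulr0 sin0 mul0r.
  + by rewrite mulr0 cos0 subrr mul0r.
  + move=> x; apply: has_derive_conv; eexists.
      by apply: has_deriveM; [exact: hs|exact: has_derive_cst].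
    by cbv beta; rewrite w2; field.
  + move=> x; apply: has_derive_conv; eexists.
      apply: has_deriveM; last exact: has_derive_cst.
      by apply: has_deriveB; [exact: has_derive_cst|exact: hc].
    by cbv beta; field.
- exists id, (fun x => x ^+ 2 * 2^-1); split => //.
  + by rewrite expr0n mul0r.
  + by move=> x; rewrite mul0r subr0; exact: is_derive_id.
  + move=> x; apply: has_derive_conv; eexists.
      by apply: has_deriveM; [apply: has_deriveX; exact: is_derive_id|exact: has_derive_cst].
    by cbv beta => /=; field.
Qed.

Section theory.
Variables (D : R) (S C : R -> R).
Hypothesis SC : oscillator D S C.

Let dS (x : R) : has_derive x 1 S (1 - D * C x).
Proof. by case: SC => _ _ h _; exact: h. Qed.
Let dC (x : R) : has_derive x 1 C (S x).
Proof. by case: SC => _ _ _ h; exact: h. Qed.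

Lemma oscillator_sqr x : S x ^+ 2 = 2 * C x - D * C x ^+ 2.
Proof.
have [S0 C0 _ _] := SC.
apply/eqP; rewrite -subr_eq0; apply/eqP.
have -> : 0 = S 0 ^+ 2 - (2 * C 0 - D * C 0 ^+ 2) by rewrite S0 C0 expr0n !mulr0 !subr0.
apply: (@is_derive_0_is_cst R (fun x => S x ^+ 2 - (2 * C x - D * C x ^+ 2))) => y.
apply: has_derive_conv; eexists.
  apply: has_deriveB; first by apply: has_deriveX; exact: (dS y).
  apply: has_deriveB.
    by apply: has_deriveM; [exact: has_derive_cst|exact: (dC y)].
  apply: has_deriveM; first exact: has_derive_cst.
  by apply: has_deriveX; exact: (dC y).
by cbv beta => /=; ring.
Qed.

(** Variation of constants: the combinations of [F] and [G] with the fundamental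
    solutions are constant, and the determinant of the latter is one. *)
Lemma oscillator_unique (F G : R -> R) : F 0 = 0 -> G 0 = 0 ->
  (forall x : R, has_derive x 1 F (- (D * G x))) -> (forall x : R, has_derive x 1 G (F x)) ->
  forall x, F x = 0 /\ G x = 0.
Proof.
move=> F0 G0 dF dG x; have [S0 C0 _ _] := SC.
have hc (y : R) : has_derive y 1 (fun y => 1 - D * C y) (- (D * S y)).
  apply: has_derive_conv; eexists.
    apply: has_deriveB; first exact: has_derive_cst.
    by apply: has_deriveM; [exact: has_derive_cst|exact: dC].
  by cbv beta; ring.
have E1 : F x * (1 - D * C x) + D * (G x * S x) = 0.
  have -> : 0 = F 0 * (1 - D * C 0) + D * (G 0 * S 0) by rewrite F0 G0 !mul0r mulr0 addr0.
  apply: (@is_derive_0_is_cst R (fun x => F x * (1 - D * C x) + D * (G x * S x))) => y.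
  apply: has_derive_conv; eexists.
    apply: has_deriveD; first by apply: has_deriveM; [exact: dF|exact: hc].
    apply: has_deriveM; first exact: has_derive_cst.
    by apply: has_deriveM; [exact: dG|exact: dS].
  by cbv beta; ring.
have E2 : G x * (1 - D * C x) - F x * S x = 0.
  have -> : 0 = G 0 * (1 - D * C 0) - F 0 * S 0 by rewrite F0 G0 !mul0r subr0.
  apply: (@is_derive_0_is_cst R (fun x => G x * (1 - D * C x) - F x * S x)) => y.
  apply: has_derive_conv; eexists.
    apply: has_deriveB; apply: has_deriveM; [exact: dG|exact: hc|exact: dF|exact: dS].
  by cbv beta; ring.
have det : (1 - D * C x) ^+ 2 + D * S x ^+ 2 = 1 by rewrite oscillator_sqr; ring.
split.
  transitivity ((F x * (1 - D * C x) + D * (G x * S x)) * (1 - D * C x)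
    - D * S x * (G x * (1 - D * C x) - F x * S x)).
    by rewrite -[LHS]mulr1 -[X in _ * X = _]det; ring.
  by rewrite E1 E2; ring.
transitivity ((F x * (1 - D * C x) + D * (G x * S x)) * S x
  + (1 - D * C x) * (G x * (1 - D * C x) - F x * S x)).
  by rewrite -[LHS]mulr1 -[X in _ * X = _]det; ring.
by rewrite E1 E2; ring.
Qed.

(** In the variable [a], the differences of both sides solve the linear system
    of [oscillator_unique]. *)
Lemma oscillator_add a b :
  S (a + b) = S a * (1 - D * C b) + (1 - D * C a) * S b /\
  C (a + b) = C a + C b + S a * S b - D * C a * C b.
Proof.
have [S0 C0 _ _] := SC.
have hsh (x : R) : has_derive x 1 (fun x => x + b) 1.
  apply: has_derive_conv; eexists.
    by apply: has_deriveD; [exact: is_derive_id|exact: has_derive_cst].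
  by rewrite addr0.
have hSb (x : R) : has_derive x 1 (fun x => S (x + b)) ((1 - D * C (x + b)) * 1).
  exact: (has_derive_comp (F := fun x => x + b) (dS (x + b)) (hsh x)).
have hCb (x : R) : has_derive x 1 (fun x => C (x + b)) (S (x + b) * 1).
  exact: (has_derive_comp (F := fun x => x + b) (dC (x + b)) (hsh x)).
pose F a := S (a + b) - (S a * (1 - D * C b) + (1 - D * C a) * S b).
pose G a := C (a + b) - (C a + C b + S a * S b - D * C a * C b).
have dF (x : R) : has_derive x 1 F (- (D * G x)).
  apply: has_derive_conv; eexists.
    apply: has_deriveB; first exact: hSb.
    apply: has_deriveD; apply: has_deriveM; try exact: has_derive_cst; first exact: dS.
    apply: has_deriveB; first exact: has_derive_cst.
    by apply: has_deriveM; [exact: has_derive_cst|exact: dC].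
  by rewrite /G; cbv beta; ring.
have dG (x : R) : has_derive x 1 G (F x).
  apply: has_derive_conv; eexists.
    apply: has_deriveB; first exact: hCb.
    apply: has_deriveB.
      apply: has_deriveD; first by apply: has_deriveD; [exact: dC|exact: has_derive_cst].
      by apply: has_deriveM; [exact: dS|exact: has_derive_cst].
    apply: has_deriveM; last exact: has_derive_cst.
    by apply: has_deriveM; [exact: has_derive_cst|exact: dC].
  by rewrite /F; cbv beta; ring.
have F0 : F 0 = 0 by rewrite /F add0r S0 C0; ring.
have G0 : G 0 = 0 by rewrite /G add0r S0 C0; ring.
have [h1 h2] := oscillator_unique F0 G0 dF dG a.
split; first exact: subr0_eq h1.
exact: subr0_eq h2.
Qed.

Lemma smooth_oscillator n (U : set 'rV[R]_n) (F : 'rV[R]_n -> R) : open U ->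
  smooth_on U F -> smooth_on U (fun x => S (F x)) /\ smooth_on U (fun x => C (F x)).
Proof.
move=> Uo /smooth_onP CF.
suff H k : Cn k U (fun x => S (F x)) /\ Cn k U (fun x => C (F x)).
  by split; apply/smooth_onP => k; case: (H k).
elim: k => [|k [IS IC]].
  split; [apply: (@Cn_comp0 _ _ _ S)|apply: (@Cn_comp0 _ _ _ C)] => // x _.
    by case: (dS (F x)).
  by case: (dC (F x)).
have Cc : Cn k U (fun x => 1 - D * C (F x)).
  have c1 := Cn_cst Uo k (1 : R); have cD := Cn_cst Uo k (- D).
  by apply: Cn_eq (CnD Uo c1 (CnM Uo cD IC)) => // x _; rewrite mulNr.
split.
  by apply: (@Cn_compS _ _ _ Uo k S (fun y => 1 - D * C y)) => // x _; exact: dS.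
by apply: (@Cn_compS _ _ _ Uo k C S) => // x _; exact: dC.
Qed.

End theory.
End oscillator.

(** * First integrals *)

(** The bilinear form against [A] when [kappa ^+ 2 = 1]. On the plane [z = 1],
    for [kappa = 0], the third coordinate of [A] is instead the coefficient of
    the function [- (x^2 + y^2) / 2]: the level sets are circles and lines. *)
Definition height_fun {R : realType} (kappa : R) (A x : 'rV[R]_3) : R :=
  A 0 0 * x 0 0 + A 0 1 * x 0 1
  + A 0 2%:R * (kappa * x 0 2%:R - (1 - kappa ^+ 2) * (x 0 0 ^+ 2 + x 0 1 ^+ 2) / 2).

Definition dheight_fun {R : realType} (kappa : R) (A x v : 'rV[R]_3) : R :=
  A 0 0 * v 0 0 + A 0 1 * v 0 1
  + A 0 2%:R * (kappa * v 0 2%:R - (1 - kappa ^+ 2) * (x 0 0 * v 0 0 + x 0 1 * v 0 1)).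

Lemma has_derive_height_fun {R : realType} {V : normedModType R} (kappa : R)
    (A v : 'rV[R]_3) (c : V -> 'rV[R]_3) u X :
  (forall j, has_derive u X (fun y => c y 0 j : R) (v 0 j)) ->
  has_derive u X (fun y => height_fun kappa A (c y)) (dheight_fun kappa A (c u) v).
Proof.
move=> hc; apply: has_derive_conv; eexists.
  apply: has_deriveD.
    apply: has_deriveD; (apply: has_deriveM; [exact: has_derive_cst|exact: hc]).
  apply: has_deriveM; first exact: has_derive_cst.
  apply: has_deriveB; first by apply: has_deriveM; [exact: has_derive_cst|exact: hc].
  apply: has_deriveM; last exact: has_derive_cst.
  apply: has_deriveM; first exact: has_derive_cst.
  by apply: has_deriveD; apply: has_deriveX; exact: hc.
by rewrite /dheight_fun; cbv beta => /=; field.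
Qed.

(** The component of [A] along the position does not contribute to the
    derivative in a tangent direction: the position is orthogonal to the tangent
    vectors if [kappa ^+ 2 = 1], and if [kappa = 0] its contribution cancels with
    that of the quadratic term of [height_fun]. *)
Lemma dheight_funE {R : realType} (kappa l : R) (A x n v : 'rV[R]_3) :
  kappa = -1 \/ kappa = 0 \/ kappa = 1 -> quadric kappa x ->
  tangent kappa x n -> tangent kappa x v -> A = n - l *: x ->
  dheight_fun kappa A x v = ambient_form kappa n v.
Proof.
move=> hk [Q pos] tn tv ->; rewrite /dheight_fun /ambient_form !mxE.
move: tn tv; rewrite /tangent; case: hk => [k|[k|k]]; rewrite k in Q pos *.
- move=> _ tv.
  apply/eqP; rewrite -subr_eq0; apply/eqP.
  transitivity (l * (-1 * (x 0 0 * v 0 0 + x 0 1 * v 0 1) + x 0 2%:R * v 0 2%:R)); first by ring.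
  by rewrite tv mulr0.
- have z0 : 0 < x 0 2%:R by apply: pos.
  rewrite !mul0r !add0r => /eqP; rewrite mulf_eq0 gt_eqF//= => /eqP n2 _.
  have x2 : x 0 2%:R = 1.
    by move: Q; rewrite mul0r add0r => /eqP; rewrite sqrf_eq1 => /orP[|] /eqP // E; lra.
  by rewrite n2 x2; ring.
- move=> _ tv.
  apply/eqP; rewrite -subr_eq0; apply/eqP.
  transitivity (- l * (1 * (x 0 0 * v 0 0 + x 0 1 * v 0 1) + x 0 2%:R * v 0 2%:R)); first by ring.
  by rewrite tv mulr0.
Qed.

(** A function on a connected manifold with zero derivative in all charts is
    constant. *)
Lemma constant_of_charts {R : realType} {m : nat} (M : manifold R m) (F : M -> R) :
  smooth_manifold M -> connected [set: M] ->
  (forall i u, chart_image i u -> differentiable (fun y => F (chart_inv i y)) u) ->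
  (forall (i : idx M) u X, chart_image i u -> 'D_X (fun y => F (chart_inv i y)) u = 0) ->
  forall p q, F p = F q.
Proof.
move=> sM cM dF DF; have good := smooth_manifold_good sM.
have [_ cov ho hc _] := sM.
apply: connected_locally_constant => // p.
have [i di] := cov p; have [odi oim] := ho i; have [ki cmap cinv] := hc i.
have im : chart_image i (chart_map i p) by exists p.
have := zero_derive_near oim im (dF i) (fun y v => DF i y v).
rewrite ki// => /(cmap p di); rewrite nbhs_simpl /= => near1.
have near2 : nbhs p (chart_dom i) by exact: (open_nbhs_nbhs (conj odi di)).
by apply: filterS2 near1 near2 => q; rewrite /preimage /= => + dq; rewrite ki.
Qed.

Section first_integral.
Context {R : realType}.
Variable kappa : R.
Hypothesis hkappa : kappa = -1 \/ kappa = 0 \/ kappa = 1.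
Variables (I : set R) (I0 : I !=set0) (f : R -> R).
Hypothesis I_open : open I.
Hypothesis f_smooth : smooth_on_interval I f.
Notation P := (warped_product (space_form kappa) f I0).
Context {M : manifold R 2}.
Hypothesis M_smooth : smooth_manifold M.
Hypothesis M_connected : connected [set: M].
Variable phi : M -> P.
Hypothesis phi_smooth : smooth_map phi.
Hypothesis phi_imm : immersed phi.
Variables (n : M -> 'rV[R]_3) (nu rho : M -> R).
Hypothesis data : umbilical_data phi n nu rho.
Variables (s S C : R -> R).
Hypothesis ds : forall t, I t -> is_derive t 1 s (expR (- f t)).
Hypothesis SC : oscillator (- kappa) S C.
Implicit Types (p : M) (i : idx M).

Let good := smooth_manifold_good M_smooth.
Let x p := pos (phi p).
Let t p := height (phi p).
Let L p := lam f (nu p) (rho p) (t p).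

Definition axis p : 'rV[R]_3 := n p - L p *: x p.

Lemma axis_constant p q : axis p = axis q.
Proof.
apply/rowP => j.
apply: (constant_of_charts (F := fun p => axis p 0 j) M_smooth M_connected) => i u.
  have s1 : smooth_on (chart_image i) (fun y => n (chart_inv i y) 0 j - lamf phi nu rho i y * pr phi i y 0 j).
    have Uo : open (chart_image i) by case: (good i).
    apply: smooth_onB => //; first exact: (smooth_n data).
    apply: smooth_onM => //; first exact: (smooth_lamf hkappa f_smooth good phi_smooth data).
    exact: (smooth_pr hkappa good phi_smooth).
  move=> iu; have := smooth_on_differentiable s1 iu.
  by congr (differentiable _ _); apply/funext => y; rewrite /axis !mxE.
move=> X iu; rewrite -(derive_axis hkappa f_smooth good phi_smooth phi_imm data X j iu).
by congr ('D_X _ u); apply/funext => y; rewrite /axis !mxE.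
Qed.

(** The coefficients [coef1] and [coef2] solve the linear system
      [nu = coef1 (1 + kappa C) + coef2 S],
      [lam = kappa coef1 S + coef2 (1 + kappa C)],
    whose determinant is one. *)
Definition coef1 p : R := nu p * (1 + kappa * C (s (t p))) - L p * S (s (t p)).
Definition coef2 p : R := L p * (1 + kappa * C (s (t p))) - kappa * nu p * S (s (t p)).
Definition coef0 (A : 'rV[R]_3) p : R :=
  - height_fun kappa A (x p) - nu p * S (s (t p)) + L p * C (s (t p)).

Lemma coef_identities A p :
  height_fun kappa A (x p) + (coef0 A p + coef1 p * S (s (t p)) + coef2 p * C (s (t p))) = 0 /\
  coef1 p * (1 + kappa * C (s (t p))) + coef2 p * S (s (t p)) = nu p.
Proof.
have S2 := oscillator_sqr SC (s (t p)); rewrite mulNr opprK in S2.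
rewrite /coef0 /coef1 /coef2; move: S2.
set c := C _; set z := S _; set h := height_fun _ _ _; move=> S2.
split.
  transitivity (L p * (2 * c + kappa * c ^+ 2 - z ^+ 2)); first by ring.
  by rewrite S2 subrr mulr0.
transitivity (nu p * (1 + kappa * (2 * c + kappa * c ^+ 2 - z ^+ 2))); first by ring.
by rewrite S2 subrr mulr0 addr0 mulr1.
Qed.

Section at_point.
Variables (i : idx M) (u X : 'rV[R]_2).
Hypothesis iu : chart_image i u.

Let D := dsc phi i u X.
Let p0 := chart_inv i u.
Let Uo : open (chart_image i). Proof. by case: (good i). Qed.

Let hd_t : has_derive u X (fun y => t (chart_inv i y)) ('D_X (ht phi i) u).
Proof. exact: (has_derive_at X (smooth_ht hkappa good phi_smooth (i := i)) iu). Qed.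

Let hd_s : has_derive u X (fun y => s (t (chart_inv i y))) D.
Proof.
have ht := ds (height_in (phi p0)).
exact: (has_derive_comp (F := fun y => t (chart_inv i y)) ht hd_t).
Qed.

Let hd_S : has_derive u X (fun y => S (s (t (chart_inv i y)))) ((1 + kappa * C (s (t p0))) * D).
Proof.
have [_ _ dS _] := SC; have := dS (s (t p0)); rewrite mulNr opprK => h.
exact: (has_derive_comp (F := fun y => s (t (chart_inv i y))) h hd_s).
Qed.

Let hd_C : has_derive u X (fun y => C (s (t (chart_inv i y)))) (S (s (t p0)) * D).
Proof.
have [_ _ _ dC] := SC; have h := dC (s (t p0)).
exact: (has_derive_comp (F := fun y => s (t (chart_inv i y))) h hd_s).
Qed.

Let hd_L : has_derive u X (fun y => L (chart_inv i y)) (kappa * nu p0 * D).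
Proof.
have := has_derive_at X (smooth_lamf hkappa f_smooth good phi_smooth data (i := i)) iu.
by rewrite (derive_lamf hkappa f_smooth good phi_smooth phi_imm data X iu).
Qed.

Let hd_nu : has_derive u X (fun y => nu (chart_inv i y)) (L p0 * D).
Proof.
have := has_derive_at X (smooth_nu data (i := i)) iu.
by have [_ _ _ _ /(_ i u X iu)[_ ->]] := data.
Qed.

Lemma has_derive_coef1 : has_derive u X (fun y => coef1 (chart_inv i y)) 0.
Proof.
apply: has_derive_conv; eexists.
  apply: has_deriveB; last by apply: has_deriveM; [exact: hd_L|exact: hd_S].
  apply: has_deriveM; first exact: hd_nu.
  apply: has_deriveD; first exact: has_derive_cst.
  by apply: has_deriveM; [exact: has_derive_cst|exact: hd_C].
cbv beta; rewrite -/p0.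
have aux (a b c d k e : R) : a * d * (1 + k * b) + e * (0 + (0 * b + k * (c * d)))
   - (k * e * d * c + a * ((1 + k * b) * d)) = 0 by ring.
exact: aux.
Qed.

Lemma has_derive_coef2 : has_derive u X (fun y => coef2 (chart_inv i y)) 0.
Proof.
apply: has_derive_conv; eexists.
  apply: has_deriveB.
    apply: has_deriveM; first exact: hd_L.
    apply: has_deriveD; first exact: has_derive_cst.
    by apply: has_deriveM; [exact: has_derive_cst|exact: hd_C].
  apply: has_deriveM; last exact: hd_S.
  by apply: has_deriveM; [exact: has_derive_cst|exact: hd_nu].
cbv beta; rewrite -/p0.
have aux (a b c d k e : R) : k * e * d * (1 + k * b) + a * (0 + (0 * b + k * (c * d)))
   - ((0 * e + k * (a * d)) * c + k * e * ((1 + k * b) * d)) = 0 by ring.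
exact: aux.
Qed.

Lemma has_derive_coef0 A : A = axis p0 ->
  has_derive u X (fun y => coef0 A (chart_inv i y)) 0.
Proof.
move=> AE.
have hx j : has_derive u X (fun y => x (chart_inv i y) 0 j) (('D_X (pr phi i) u) 0 j).
  have := has_derive_at X (smooth_pr hkappa good phi_smooth (i := i) j) iu.
  by rewrite -(derive_prj hkappa good phi_smooth j X iu).
have tX : tangent kappa (x p0) ('D_X (pr phi i) u).
  have [k ok] := chart_cover phi iu.
  rewrite (derive_prE hkappa good phi_smooth X ok) /x -/(pr phi i u) (prE hkappa ok).
  by apply: dstereo_tangent; case: (local_rep_region hkappa ok).
have [_ tn _ /(_ i u X iu) orth _] := data.
have E := dheight_funE hkappa (pos_quadric (phi p0)) (tn p0) tX AE.
apply: has_derive_conv; eexists.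
  apply: has_deriveD; last by apply: has_deriveM; [exact: hd_L|exact: hd_C].
  apply: has_deriveB; last by apply: has_deriveM; [exact: hd_nu|exact: hd_S].
  apply: has_deriveN; exact: (has_derive_height_fun (c := fun y => x (chart_inv i y)) kappa A hx).
cbv beta; rewrite -/p0 E.
have -> : ambient_form kappa (n p0) ('D_X (pr phi i) u) = - (nu p0 * D).
  by apply/eqP; rewrite -addr_eq0; apply/eqP; exact: orth.
have aux (a b c d k e : R) : - - (e * d) - (a * d * c + e * ((1 + k * b) * d))
   + (k * e * d * b + a * (c * d)) = 0 by ring.
exact: aux.
Qed.

End at_point.

Lemma has_derive0_constant (F : M -> R) :
  (forall i u X, chart_image i u -> has_derive u X (fun y => F (chart_inv i y)) 0) ->
  (forall i, smooth_on (chart_image i) (fun y => F (chart_inv i y) : R)) ->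
  forall p q, F p = F q.
Proof.
move=> hd sm; apply: (constant_of_charts M_smooth M_connected) => i u.
  by move=> iu; exact: (smooth_on_differentiable (sm i)).
by move=> X iu; case: (hd i u X iu).
Qed.

Lemma smooth_s_ht i : smooth_on (chart_image i) (fun y => s (t (chart_inv i y)) : R).
Proof.
have Uo : open (chart_image i) by case: (good i).
have sh := smooth_ht hkappa good phi_smooth (i := i).
apply: (smooth_on_comp_primitive Uo (h := s) (g := fun y => expR (- f y)) _ sh).
  by move=> y _; apply: ds; exact: height_in.
apply: smooth_on_expR => //; apply: smooth_onN => //.
by have := smooth_f_ht hkappa f_smooth good phi_smooth 0%N (i := i); rewrite derive1n0.
Qed.

(** The coefficients have zero derivative, hence are constant as the surface is
    connected. *)
Lemma first_integral : exists (A : 'rV[R]_3) (c0 c1 c2 : R), forall p,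
  [/\ axis p = A,
      height_fun kappa A (x p) + (c0 + c1 * S (s (t p)) + c2 * C (s (t p))) = 0 &
      c1 * (1 + kappa * C (s (t p))) + c2 * S (s (t p)) = nu p].
Proof.
have [[q _]|noM] := pselect (exists q : M, True); last first.
  by exists 0, 0, 0, 0 => p; exfalso; apply: noM; exists p.
exists (axis q), (coef0 (axis q) q), (coef1 q), (coef2 q) => p.
have Uo i : open (chart_image i) by case: (good i).
have sSC i := smooth_oscillator SC (Uo i) (@smooth_s_ht i).
have sL i := smooth_lamf hkappa f_smooth good phi_smooth data (i := i).
have snu i := smooth_nu data (i := i).
have sC1 i : smooth_on (chart_image i) (fun y => 1 + kappa * C (s (t (chart_inv i y))) : R).
  apply: smooth_onD => //; first exact: smooth_on_cst.
  by apply: smooth_onM; [exact: Uo|exact: smooth_on_cst|case: (sSC i)].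
have E1 : coef1 p = coef1 q.
  apply: has_derive0_constant => [i u X iu|i]; first exact: has_derive_coef1.
  apply: smooth_onB; [exact: Uo|by apply: smooth_onM; [exact: Uo|exact: snu|exact: sC1]|].
  by apply: smooth_onM; [exact: Uo|exact: sL|case: (sSC i)].
have E2 : coef2 p = coef2 q.
  apply: has_derive0_constant => [i u X iu|i]; first exact: has_derive_coef2.
  apply: smooth_onB => //; first by apply: smooth_onM => //; exact: sL.
  apply: smooth_onM => //; last by case: (sSC i).
  by apply: smooth_onM => //; exact: smooth_on_cst.
have E0 : coef0 (axis q) p = coef0 (axis q) q.
  apply: (has_derive0_constant (F := coef0 (axis q))) => [i u X iu|i].
    by apply: has_derive_coef0 => //; exact: axis_constant.
  have sx j := smooth_pr hkappa good phi_smooth (i := i) j.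
  apply: smooth_onD => //; last by apply: smooth_onM; [exact: Uo|exact: sL|case: (sSC i)].
  apply: smooth_onB => //; last by apply: smooth_onM; [exact: Uo|exact: snu|case: (sSC i)].
  apply: smooth_onN => //; apply: smooth_onD => //.
    by apply: smooth_onD; [exact: Uo| |]; (apply: smooth_onM; [exact: Uo|exact: smooth_on_cst|exact: sx]).
  apply: smooth_onM => //; first exact: smooth_on_cst.
  apply: smooth_onB => //; first by apply: smooth_onM; [exact: Uo|exact: smooth_on_cst|exact: sx].
  apply: smooth_onM => //; last exact: smooth_on_cst.
  apply: smooth_onM => //; first exact: smooth_on_cst.
  by apply: smooth_onD; [exact: Uo| |]; (apply: smooth_onX; [exact: Uo|exact: sx]).
have [I1 I2] := coef_identities (axis q) p.
by split; [exact: axis_constant|rewrite -E0 -E1 -E2|rewrite -E1 -E2].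
Qed.

End first_integral.

(** * One-parameter groups of isometries *)

Section rotation.
Context {R : realType}.
Variable kappa : R.
Hypothesis hkappa : kappa = -1 \/ kappa = 0 \/ kappa = 1.
Variable B : 'rV[R]_3.
Implicit Types (p v w : 'rV[R]_3).

(** The generator of the isotropy group of [B]: for [kappa = 1] this is the
    cross product with [B]. *)
Definition gen p : 'rV[R]_3 :=
  row3 (B 0 1 * p 0 2%:R - B 0 2%:R * p 0 1) (B 0 2%:R * p 0 0 - B 0 0 * p 0 2%:R)
       (kappa * (B 0 0 * p 0 1 - B 0 1 * p 0 0)).

(** The square of the angular speed of the rotations generated by [gen]; it is
    negative for the hyperbolic ones, and zero for the parabolic ones and for the
    translations of the plane. *)
Definition freq : R := B 0 2%:R ^+ 2 + kappa * (B 0 0 ^+ 2 + B 0 1 ^+ 2).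

Variables (S C : R -> R).
Hypothesis SC : oscillator freq S C.

(** The exponential of [s] times the generator, which satisfies
    [gen^3 = - freq * gen]. *)
Definition rot (s : R) p : 'rV[R]_3 := p + (S s *: gen p + C s *: gen (gen p)).

Lemma rotE s p j : rot s p 0 j = p 0 j + (S s * gen p 0 j + C s * gen (gen p) 0 j).
Proof. by rewrite /rot !mxE. Qed.

Lemma gen_linear r p v : gen (p + r *: v) = gen p + r *: gen v.
Proof.
have E (a b : 'rV[R]_3) j : (a + r *: b) 0 j = a 0 j + r * b 0 j by rewrite !mxE.
by apply: row3P; rewrite E /gen !row3E !E; ring.
Qed.

Lemma gen3 p : gen (gen (gen p)) = - freq *: gen p.
Proof.
have E (a : 'rV[R]_3) j : (- freq *: a) 0 j = - freq * a 0 j by rewrite !mxE.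
by apply: row3P; rewrite E /gen /freq !row3E; ring.
Qed.

Lemma rot0 p : rot 0 p = p.
Proof. by have [S0 C0 _ _] := SC; rewrite /rot S0 C0 !scale0r !addr0. Qed.

Lemma rotD s t p : rot (s + t) p = rot s (rot t p).
Proof.
have [ES EC] := oscillator_add SC s t.
have g1 : gen (rot t p) = (1 - freq * C t) *: gen p + S t *: gen (gen p).
  rewrite /rot addrA !gen_linear gen3; apply/rowP => j; rewrite !mxE; ring.
have g2 : gen (gen (rot t p)) = (1 - freq * C t) *: gen (gen p) + (- freq * S t) *: gen p.
  rewrite g1 -[_ *: gen p]add0r gen_linear gen_linear gen3.
  have -> : gen 0 = 0 by apply: row3P; rewrite row3E !mxE; ring.
  by apply/rowP => j; rewrite !mxE; ring.
have E (a b : R) (v w : 'rV[R]_3) j : (a *: v + b *: w) 0 j = a * v 0 j + b * w 0 j.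
  by rewrite !mxE.
by apply/rowP => j; rewrite !rotE g2 g1 !E ES EC; ring.
Qed.

(** For [kappa ^+ 2 = 1] this is [kappa] times the ambient form; for
    [kappa = 0] it only sees the third coordinates. *)
Definition pairing p v : R := kappa * (p 0 0 * v 0 0 + p 0 1 * v 0 1) + p 0 2%:R * v 0 2%:R.

Let sqr0 s : S s ^+ 2 - 2 * C s + freq * C s ^+ 2 = 0.
Proof. by rewrite (oscillator_sqr SC); ring. Qed.

Lemma rot_pairing s v w : pairing (rot s v) (rot s w) = pairing v w.
Proof.
apply/eqP; rewrite -subr_eq0; apply/eqP.
transitivity (pairing (gen v) (gen w) * (S s ^+ 2 - 2 * C s + freq * C s ^+ 2)).
  by rewrite /pairing !rotE /gen /freq !row3E; ring.
by rewrite sqr0 mulr0.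
Qed.

Lemma rot_tangent s p v : tangent kappa p v -> tangent kappa (rot s p) (rot s v).
Proof. by have := rot_pairing s p v; rewrite /pairing /tangent => ->. Qed.

Lemma tangent_flat p v : kappa = 0 -> quadric kappa p -> tangent kappa p v -> v 0 2%:R = 0.
Proof.
move=> k [_ pos]; rewrite /tangent k mul0r add0r => /eqP.
by rewrite mulf_eq0 gt_eqF ?pos ?k//= => /eqP.
Qed.

(** If [kappa ^+ 2 = 1] the form is a multiple of [pairing]. If [kappa = 0] the
    tangent vectors are horizontal, and are rotated by a plane rotation. *)
Lemma rot_form s p v w : quadric kappa p -> tangent kappa p v -> tangent kappa p w ->
  ambient_form kappa (rot s v) (rot s w) = ambient_form kappa v w.
Proof.
move=> Q tv tw.
have [k0|k2] : kappa = 0 \/ kappa ^+ 2 = 1.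
- by case: hkappa => [->|[->|->]]; [right; ring|left|right; ring].
- have v2 := tangent_flat k0 Q tv; have w2 := tangent_flat k0 Q tw.
  apply/eqP; rewrite -subr_eq0; apply/eqP.
  transitivity (B 0 2%:R ^+ 2 * (v 0 0 * w 0 0 + v 0 1 * w 0 1)
     * (S s ^+ 2 - 2 * C s + freq * C s ^+ 2)).
    by rewrite /ambient_form !rotE /gen /freq !row3E v2 w2 k0; ring.
  by rewrite sqr0 mulr0.
have E a b : ambient_form kappa a b = kappa * pairing a b.
  rewrite /ambient_form /pairing.
  transitivity (kappa ^+ 2 * (a 0 0 * b 0 0 + a 0 1 * b 0 1) + kappa * (a 0 2%:R * b 0 2%:R)).
    by rewrite k2 mul1r.
  by ring.
by rewrite !E rot_pairing.
Qed.

Lemma continuous_oscillator : continuous S /\ continuous C.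
Proof.
have [_ _ dS dC] := SC; split=> x.
  by apply/differentiable_continuous/derivable1_diffP; case: (dS x).
by apply/differentiable_continuous/derivable1_diffP; case: (dC x).
Qed.

Lemma rot_quadric s p : quadric kappa p -> quadric kappa (rot s p).
Proof.
have P (q : 'rV[R]_3) : kappa * (q 0 0 ^+ 2 + q 0 1 ^+ 2) + q 0 2%:R ^+ 2 = pairing q q.
  by rewrite /pairing; ring.
move=> [Q pos].
have Qr r : kappa * (rot r p 0 0 ^+ 2 + rot r p 0 1 ^+ 2) + rot r p 0 2%:R ^+ 2 = 1.
  by rewrite P rot_pairing -P.
split=> // k0; have z0 := pos k0.
have [k|[k|k]] := hkappa; [|by rewrite rotE !row3E k !mul0r !mulr0 !addr0|by lra].
(* The height does not vanish along the orbit, so that it keeps its sign. *)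
have nz r : rot r p 0 2%:R != 0.
  apply/eqP => E; have := Qr r; rewrite k E.
  have := sqr_ge0 (rot r p 0 0); have := sqr_ge0 (rot r p 0 1).
  by set X := _ ^+ 2; set Y := _ ^+ 2; rewrite expr0n /=; lra.
rewrite ltNge; apply/negP => neg.
pose F r := rot (r * s) p 0 2%:R.
have cF : continuous F.
  have [cS cC] := continuous_oscillator.
  have cl : continuous (fun r : R => r * s) by move=> r; apply: cvgM; [exact: cvg_id|exact: cvg_cst].
  have cS' : continuous (fun r : R => S (r * s)).
    by move=> r; apply: (cvg_comp (fun r => r * s) S); [exact: cl|exact: cS].
  have cC' : continuous (fun r : R => C (r * s)).
    by move=> r; apply: (cvg_comp (fun r => r * s) C); [exact: cl|exact: cC].
  rewrite (_ : F = (fun r => p 0 2%:R + (S (r * s) * gen p 0 2%:R + C (r * s) * gen (gen p) 0 2%:R))).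
    move=> r; apply: cvgD; first exact: cvg_cst.
    by apply: cvgD; apply: cvgM; [exact: cS'|exact: cvg_cst|exact: cC'|exact: cvg_cst].
  by apply/funext => r; rewrite /F rotE.
have F0 : 0 < F 0 by rewrite /F mul0r rot0.
have F1 : F 1 <= 0 by rewrite /F mul1r.
have [] := @IVT R F 0 1 0 ler01.
- exact: continuous_subspaceT.
- by rewrite ge_min le_max F1 (ltW F0) orbT.
- by move=> r _ /eqP; apply/negP; exact: nz.
Qed.

(** The generator preserves the form and annihilates [B] if [kappa ^+ 2 = 1]. If
    [kappa = 0] the group is that of the rotations around the common center of
    the level sets of [height_fun], or of the translations along them. *)
Lemma rot_height_fun s A p : A = B \/ A = 0 -> quadric kappa p ->
  height_fun kappa A (rot s p) = height_fun kappa A p.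
Proof.
case=> [->|->] Q; last by rewrite /height_fun !mxE !mul0r.
have [k0|k2] : kappa = 0 \/ kappa ^+ 2 = 1.
- by case: hkappa => [->|[->|->]]; [right; ring|left|right; ring].
- have [q pos] := Q.
  have z1 : p 0 2%:R = 1.
    have z0 : 0 < p 0 2%:R by apply: pos; rewrite k0.
    move: q; rewrite k0 mul0r add0r => /eqP; rewrite sqrf_eq1 => /orP[|] /eqP // E; lra.
  apply/eqP; rewrite -subr_eq0; apply/eqP.
  transitivity (- (B 0 2%:R / 2) * ((B 0 1 - B 0 2%:R * p 0 1) ^+ 2 + (B 0 2%:R * p 0 0 - B 0 0) ^+ 2)
     * (S s ^+ 2 - 2 * C s + freq * C s ^+ 2)).
    by rewrite /height_fun !rotE /gen /freq !row3E k0 z1; field.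
  by rewrite sqr0 mulr0.
have E a : height_fun kappa B a = B 0 0 * a 0 0 + B 0 1 * a 0 1 + B 0 2%:R * kappa * a 0 2%:R.
  by rewrite /height_fun k2 subrr mul0r mul0r subr0 mulrA.
have E0 a : B 0 0 * gen a 0 0 + B 0 1 * gen a 0 1 + B 0 2%:R * kappa * gen a 0 2%:R = 0.
  rewrite /gen !row3E.
  transitivity (B 0 2%:R * (B 0 1 * a 0 0 - B 0 0 * a 0 1) * (1 - kappa ^+ 2)); first by ring.
  by rewrite k2 subrr mulr0.
rewrite !E !rotE.
transitivity (B 0 0 * p 0 0 + B 0 1 * p 0 1 + B 0 2%:R * kappa * p 0 2%:R
  + S s * (B 0 0 * gen p 0 0 + B 0 1 * gen p 0 1 + B 0 2%:R * kappa * gen p 0 2%:R)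
  + C s * (B 0 0 * gen (gen p) 0 0 + B 0 1 * gen (gen p) 0 1 + B 0 2%:R * kappa * gen (gen p) 0 2%:R)).
  by ring.
by rewrite !E0 !mulr0 !addr0.
Qed.

Lemma has_derive_gen {V : normedModType R} (c : V -> 'rV[R]_3) (v : 'rV[R]_3) x X :
  (forall j, has_derive x X (fun y => c y 0 j : R) (v 0 j)) ->
  forall j, has_derive x X (fun y => gen (c y) 0 j : R) (gen v 0 j).
Proof.
move=> hc j.
have hl (a b : R) i l : has_derive x X (fun y => a * c y 0 i - b * c y 0 l) (a * v 0 i - b * v 0 l).
  apply: has_derive_conv; eexists.
    by apply: has_deriveB; (apply: has_deriveM; [exact: has_derive_cst|exact: hc]).
  by cbv beta; ring.
have [->|[->|->]] := ord3_cases j.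
- rewrite row3E; have := hl (B 0 1) (B 0 2%:R) 2%:R 1.
  by congr has_derive; apply/funext => y; rewrite row3E.
- rewrite row3E; have := hl (B 0 2%:R) (B 0 0) 0 2%:R.
  by congr has_derive; apply/funext => y; rewrite row3E.
rewrite row3E; have := has_deriveM (has_derive_cst kappa x X) (hl (B 0 0) (B 0 1) 1 0).
rewrite mul0r add0r; congr has_derive; apply/funext => y; by rewrite row3E.
Qed.

Lemma has_derive_rot {V : normedModType R} s (c : V -> 'rV[R]_3) (v : 'rV[R]_3) x X :
  (forall j, has_derive x X (fun y => c y 0 j : R) (v 0 j)) ->
  forall j, has_derive x X (fun y => rot s (c y) 0 j : R) (rot s v 0 j).
Proof.
move=> hc j; have h1 := has_derive_gen hc; have h2 := has_derive_gen h1.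
have hd : has_derive x X (fun y => c y 0 j + (S s * gen (c y) 0 j + C s * gen (gen (c y)) 0 j)) (rot s v 0 j).
  apply: has_derive_conv; eexists.
    apply: has_deriveD; first exact: hc.
    by apply: has_deriveD; apply: has_deriveM; [exact: has_derive_cst|exact: h1|
       exact: has_derive_cst|exact: h2].
  by cbv beta; rewrite !mul0r !add0r rotE.
by move: hd; congr has_derive; apply/funext => y; rewrite rotE.
Qed.

Lemma smooth_on_gen m (U : set 'rV[R]_m) (c : 'rV[R]_m -> 'rV[R]_3) : open U ->
  (forall j, smooth_on U (fun y => c y 0 j : R)) ->
  forall j, smooth_on U (fun y => gen (c y) 0 j : R).
Proof.
move=> Uo sc j.
have sl (a b : R) i l : smooth_on U (fun y => a * c y 0 i - b * c y 0 l : R).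
  by apply: smooth_onB; [exact: Uo| |]; (apply: smooth_onM; [exact: Uo|exact: smooth_on_cst|exact: sc]).
have [->|[->|->]] := ord3_cases j.
- by apply: (smooth_on_eq Uo _ (sl (B 0 1) (B 0 2%:R) 2%:R 1)) => y _; rewrite row3E.
- by apply: (smooth_on_eq Uo _ (sl (B 0 2%:R) (B 0 0) 0 2%:R)) => y _; rewrite row3E.
have s1 := smooth_onM Uo (smooth_on_cst Uo kappa) (sl (B 0 0) (B 0 1) 1 0).
by apply: (smooth_on_eq Uo _ s1) => y _; rewrite row3E.
Qed.

Lemma smooth_on_rot m (U : set 'rV[R]_m) (r : 'rV[R]_m -> R) (c : 'rV[R]_m -> 'rV[R]_3) :
  open U -> smooth_on U r -> (forall j, smooth_on U (fun y => c y 0 j : R)) ->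
  forall j, smooth_on U (fun y => rot (r y) (c y) 0 j : R).
Proof.
move=> Uo sr sc j; have [sS sC] := smooth_oscillator SC Uo sr.
have s1 := smooth_on_gen Uo sc; have s2 := smooth_on_gen Uo s1.
have s3 := smooth_onD Uo (sc j) (smooth_onD Uo (smooth_onM Uo sS (s1 j)) (smooth_onM Uo sC (s2 j))).
by apply: (smooth_on_eq Uo _ s3) => y _; rewrite rotE.
Qed.

Lemma continuous_gen (X : topologicalType) (c : X -> 'rV[R]_3) x :
  (forall j, {for x, continuous (fun y => c y 0 j : R)}) ->
  forall j, {for x, continuous (fun y => gen (c y) 0 j : R)}.
Proof.
move=> sc j.
have sl (a b : R) i l : {for x, continuous (fun y => a * c y 0 i - b * c y 0 l : R)}.
  by apply: cvgB; apply: cvgM; [exact: cvg_cst|exact: sc|exact: cvg_cst|exact: sc].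
have [->|[->|->]] := ord3_cases j.
- rewrite (_ : (fun y => _) = fun y => B 0 1 * c y 0 2%:R - B 0 2%:R * c y 0 1); first exact: sl.
  by apply/funext => y; rewrite row3E.
- rewrite (_ : (fun y => _) = fun y => B 0 2%:R * c y 0 0 - B 0 0 * c y 0 2%:R); first exact: sl.
  by apply/funext => y; rewrite row3E.
rewrite (_ : (fun y => _) = fun y => kappa * (B 0 0 * c y 0 1 - B 0 1 * c y 0 0)).
  by apply: cvgM; [exact: cvg_cst|exact: sl].
by apply/funext => y; rewrite row3E.
Qed.

Lemma continuous_rot (X : topologicalType) (r : X -> R) (c : X -> 'rV[R]_3) x :
  {for x, continuous r} -> (forall j, {for x, continuous (fun y => c y 0 j : R)}) ->
  forall j, {for x, continuous (fun y => rot (r y) (c y) 0 j : R)}.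
Proof.
move=> sr sc j; have [cS cC] := continuous_oscillator.
have s1 := continuous_gen sc; have s2 := continuous_gen s1.
rewrite (_ : (fun y => _) = fun y => c y 0 j + (S (r y) * gen (c y) 0 j + C (r y) * gen (gen (c y)) 0 j)).
  apply: cvgD; first exact: sc.
  apply: cvgD; apply: cvgM; [|exact: s1| |exact: s2].
    by apply: (cvg_comp r S); [exact: sr|exact: cS].
  by apply: (cvg_comp r C); [exact: sr|exact: cC].
by apply/funext => y; rewrite rotE.
Qed.

Lemma rot_fixed p : (forall s, rot s p = p) -> gen p = 0.
Proof.
move=> fx; have [S0 C0 dS dC] := SC; apply/rowP => j.
have hd : has_derive (0 : R) 1 (fun s => p 0 j + (S s * gen p 0 j + C s * gen (gen p) 0 j)) (gen p 0 j).
  apply: has_derive_conv; eexists.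
    apply: has_deriveD; first exact: has_derive_cst.
    by apply: has_deriveD; apply: has_deriveM; [exact: dS|exact: has_derive_cst|exact: dC|exact: has_derive_cst].
  by cbv beta; rewrite S0 C0; ring.
have E : (fun s => p 0 j + (S s * gen p 0 j + C s * gen (gen p) 0 j)) = (fun=> p 0 j).
  by apply/funext => s; rewrite -rotE fx.
have [_ hg] := hd; rewrite [RHS]mxE -hg E.
by have [_ ->] := has_derive_cst (p 0 j) (0 : R) (1 : R).
Qed.

End rotation.

Section action.
Context {R : realType}.
Variable kappa : R.
Hypothesis hkappa : kappa = -1 \/ kappa = 0 \/ kappa = 1.
Variables (I : set R) (I0 : I !=set0) (f : R -> R).
Hypothesis I_open : open I.
Notation P := (warped_product (space_form kappa) f I0).
Variables (B : 'rV[R]_3) (S C : R -> R).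
Hypothesis SC : oscillator (freq kappa B) S C.
Local Notation rot := (rot kappa B S C).
Implicit Types (p : P).

Definition act (s : R) (p : P) : P := (insubd (pole kappa) (rot s (pos p)), p.2).

Lemma pos_act s p : pos (act s p) = rot s (pos p).
Proof.
rewrite {1}/pos /act /= val_insubd mem_set//.
exact: (rot_quadric hkappa SC s (pos_quadric p)).
Qed.

Lemma height_act s p : height (act s p) = height p.
Proof. by []. Qed.

Lemma act0 p : act 0 p = p.
Proof. by apply: ambient_eq; rewrite ?pos_act ?rot0. Qed.

Lemma actD s t p : act (s + t) p = act s (act t p).
Proof. by apply: ambient_eq; rewrite // !pos_act rotD. Qed.

Let good : good_charts P. Proof. exact: ambient_good. Qed.

Lemma line_prod_good : good_charts (prod_manifold (line R) P).
Proof.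
case=> -[] k.
have E : chart_image ((tt, k) : idx (prod_manifold (line R) P)) =
    [set u : 'rV[R]_(1 + (2 + 1)) | ambient_region k (rsubmx u)].
  apply/seteqP; split=> u.
    move=> [[t p] [_ dp] <-]; rewrite /= row_mxKr.
    exact: chart_map_region.
  move=> /(chart_imageE hkappa) [p dp pE].
  exists (lsubmx u 0 0, p); first by split.
  rewrite -[RHS]hsubmxK; congr row_mx => //.
  by apply/rowP => j; rewrite !ord1 mxE.
rewrite E; split.
  apply: (@open_comp _ _ (@rsubmx R 1 1 (2 + 1)) (ambient_region k)).
    by move=> u _; exact: continuous_rsubmx.
  exact: open_ambient_region.
move=> u ru.
have c1 : {for u, continuous (fun u : 'rV[R]_(1 + (2 + 1)) => lsubmx u 0 0)}.
  apply: (@continuous_comp _ _ _ (@lsubmx R 1 1 (2 + 1)) (fun v => v 0 0)).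
    exact: continuous_lsubmx.
  exact: coord_continuous.
have c2 : {for u, continuous (fun u : 'rV[R]_(1 + (2 + 1)) => chart_inv k (rsubmx u) : P)}.
  apply: (@continuous_comp _ _ _ (@rsubmx R 1 1 (2 + 1)) (chart_inv k)).
    exact: continuous_rsubmx.
  by have [_] := good k; apply; apply/(chart_imageE hkappa).
exact: (cvg_pair c1 c2).
Qed.

Lemma smooth_act_joint :
  smooth_map (fun q : prod_manifold (line R) P => (act q.1 q.2 : P)).
Proof.
apply/(smooth_mapP hkappa line_prod_good); split.
  move=> [r p]; apply: continuous_ambient => [j|].
    rewrite (_ : (fun y => _) = (fun y : R * P => rot y.1 (pos y.2) 0 j)); last first.
      by apply/funext => y; rewrite pos_act.
    apply: (continuous_rot SC (r := fun y : R * P => y.1) (c := fun y : R * P => pos y.2)).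
      exact: cvg_fst.
    move=> l; apply: (@continuous_comp _ _ _ (fun y : R * P => y.2) (fun p => pos p 0 l)).
      exact: cvg_snd.
    exact: continuous_pos.
  apply: (@continuous_comp _ _ _ (fun y : R * P => y.2) (fun p : P => height p)).
    exact: cvg_snd.
  exact: continuous_height.
move=> [[] k].
pose U : set 'rV[R]_(1 + (2 + 1)) := [set u | ambient_region k (rsubmx u)].
have Uo : open U.
  apply: (@open_comp _ _ (@rsubmx R 1 1 (2 + 1)) (ambient_region k)).
    by move=> u _; exact: continuous_rsubmx.
  exact: open_ambient_region.
have imU : chart_image ((tt, k) : idx (prod_manifold (line R) P)) `<=` U.
  move=> u [[t p] [_ dp] <-]; rewrite /U /= row_mxKr.
  exact: chart_map_region.
have sr j : smooth_on U (fun u => (rsubmx u : 'rV_(2 + 1)) 0 j : R).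
  by apply: (smooth_on_eq Uo _ (smooth_on_coord Uo (rshift 1 j))) => y _; rewrite mxE.
have sl : smooth_on U (fun u => (lsubmx u : 'rV_1) 0 0 : R).
  by apply: (smooth_on_eq Uo _ (smooth_on_coord Uo (lshift (2 + 1) 0))) => y _; rewrite mxE.
have sp j : smooth_on U (fun u => pos (chart_inv k (rsubmx u)) 0 j : R).
  apply: (smooth_on_eq Uo (F := fun u => stereo_inv kappa k.1 (hor (rsubmx u)) 0 j)).
    by move=> u ru; rewrite (pos_chart_inv hkappa).
  apply: smooth_on_stereo_region => //; first by move=> u [].
  by move=> l; apply: (smooth_on_eq Uo _ (sr (lshift 1 l))) => y _; rewrite horE.
split=> [j|]; apply: (smooth_on_sub imU).
  apply: (smooth_on_eq Uo _ (smooth_on_rot SC Uo sl sp j)) => u _.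
  by rewrite /pr /= pos_act.
apply: (smooth_on_eq Uo _ (sr (rshift 2 0))) => u ru.
by rewrite -verE /ht /= height_act height_chart_inv.
Qed.

Lemma smooth_act s : smooth_map (act s).
Proof.
apply/(smooth_mapP hkappa good); split.
  move=> p; apply: continuous_ambient => [j|].
    rewrite (_ : (fun y => _) = (fun y : P => rot s (pos y) 0 j)); last first.
      by apply/funext => y; rewrite pos_act.
    apply: (continuous_rot SC (r := fun=> s) (c := fun y : P => pos y)).
      exact: cvg_cst.
    by move=> l; exact: continuous_pos.
  exact: continuous_height.
move=> k; have Uo : open (chart_image k) by case: (good k).
have sub : chart_image k `<=` ambient_region k by move=> v /(chart_imageE hkappa).
split=> [j|].
  have sp l : smooth_on (chart_image k) (fun v => pos (chart_inv k v) 0 l : R).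
    exact: (smooth_on_sub sub (@smooth_on_pos_chart_inv R kappa hkappa I I0 f I_open k l)).
  apply: (smooth_on_eq Uo _ (smooth_on_rot SC Uo (smooth_on_cst Uo s) sp j)) => u _.
  by rewrite /pr pos_act.
exact: (smooth_on_sub sub (@smooth_on_height_chart_inv R kappa I I0 f I_open k)).
Qed.

(** The inverse is the opposite time. The group acts by [rot] on the horizontal
    position, which preserves the form on tangent vectors, and leaves the height fixed. *)
Lemma isometry_act s : Defs.isometry (act s).
Proof.
split; first exact: smooth_act.
  exists (act (- s)); split; last exact: smooth_act.
  - by move=> p; rewrite -actD addNr act0.
  - by move=> p; rewrite -actD subrr act0.
move=> i j u v w ou; have ru := local_rep_region hkappa ou.
have iu : ambient_region i u by apply/(chart_imageE hkappa); case: ou.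
have [ri _] := iu.
have sa := smooth_act s.
have Dp z : dstereo kappa j.1 (hor (local_rep (act s) i j u)) (hor ('D_z (local_rep (act s) i j) u)) =
    rot s (dstereo kappa i.1 (hor u) (hor z)).
  apply/rowP => l; have [_ <-] := has_derive_pr hkappa good sa z ou l.
  have [_ E] := has_derive_rot kappa B S C s (fun l => has_derive_pos_chart_inv hkappa I_open z l iu) l.
  transitivity ('D_z (fun y => rot s (pos (chart_inv i y)) 0 l) u); last exact: E.
  by congr ('D_z _ u); apply/funext => y; rewrite /pr pos_act.
have Dh z : ver ('D_z (local_rep (act s) i j) u) = ver z.
  have [_ <-] := has_derive_ht hkappa good sa z ou.
  have [_ E] := has_derive_ver z u.
  transitivity ('D_z (fun y => ver y) u); last exact: E.
  apply: near_eq_derive; near=> y.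
  have ry : ambient_region i y.
    near: y; exact: (open_nbhs_nbhs (conj (@open_ambient_region R kappa I I0 f I_open i) iu)).
  by rewrite /ht height_act height_chart_inv.
have hE : ver (local_rep (act s) i j u) = ver u.
  by rewrite -(htE hkappa ou) /ht height_act height_chart_inv.
have Q := stereo_inv_quadric hkappa ri.
have tz (z : 'rV[R]_(2 + 1)) : tangent kappa (stereo_inv kappa i.1 (hor u)) (dstereo kappa i.1 (hor u) (hor z)).
  exact: dstereo_tangent.
have K (p1 p2 q1 q2 : 'rV[R]_3) (x1 x2 y1 y2 t1 t2 : R) :
    p1 = rot s q1 -> p2 = rot s q2 -> x1 = y1 -> x2 = y2 -> t1 = t2 ->
    ambient_form kappa (rot s q1) (rot s q2) = ambient_form kappa q1 q2 ->
    expR (2 * f t1) * ambient_form kappa p1 p2 + x1 * x2 =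
    expR (2 * f t2) * ambient_form kappa q1 q2 + y1 * y2.
  by move=> -> -> -> -> -> ->.
have main (a c : 'rV[R]_(2 + 1)) :
    dstereo kappa j.1 (hor (local_rep (act s) i j u)) (hor a) = rot s (dstereo kappa i.1 (hor u) (hor v)) ->
    dstereo kappa j.1 (hor (local_rep (act s) i j u)) (hor c) = rot s (dstereo kappa i.1 (hor u) (hor w)) ->
    ver a = ver v -> ver c = ver w ->
    inner (metric j (local_rep (act s) i j u)) a c = inner (metric i u) v w.
  move=> ha hc va vc.
  refine (etrans (inner_ambient hkappa a c ru) (etrans _ (esym (inner_ambient hkappa v w iu)))).
  exact: (K _ _ _ _ _ _ _ _ _ _ ha hc va vc hE (rot_form hkappa SC s Q (tz v) (tz w))).
exact: main (Dp v) (Dp w) (Dh v) (Dh w).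
Unshelve. all: by end_near. Qed.

Definition ambient_point (x : 'rV[R]_3) : P := (insubd (pole kappa) x, interval_point I0).

Lemma pos_ambient_point x : quadric kappa x -> pos (ambient_point x) = x.
Proof. by move=> Q; rewrite /pos /= val_insubd mem_set. Qed.

(** If the action is trivial, then [gen B] vanishes at the pole and at a point
    with a nonzero first coordinate, which forces [B = 0]. *)
Lemma act_nontrivial : B != 0 -> exists s p, act s p <> p.
Proof.
move=> B0; apply: contrapT => nex.
have fixd x : quadric kappa x -> gen kappa B x = 0.
  move=> Q; apply: (rot_fixed SC) => s; apply: contrapT => ne; apply: nex.
  exists s, (ambient_point x) => /(congr1 (@pos _ _ _ _ _)).
  by rewrite pos_act !pos_ambient_point.
have g0 : gen kappa B (row3 0 0 1) = 0.
  by apply: fixd; have /set_mem := quadric_pole kappa.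
have B1 : B 0 1 = 0.
  have := congr1 (fun v : 'rV[R]_3 => v 0 0) g0.
  by rewrite /gen !row3E mxE mulr1 mulr0 subr0.
have B00 : B 0 0 = 0.
  have := congr1 (fun v : 'rV[R]_3 => v 0 1) g0.
  by rewrite /gen !row3E mxE mulr1 mulr0 sub0r => /eqP; rewrite oppr_eq0 => /eqP.
have [x Q x0] : exists2 x : 'rV[R]_3, quadric kappa x & x 0 0 != 0.
  case: hkappa => [k|[k|k]].
  - exists (row3 (3 / 4) 0 (5 / 4)); last by rewrite row3E mulf_neq0 ?invr_neq0 ?pnatr_eq0.
    by rewrite /quadric /= !row3E k; split=> [|_]; [field|lra].
  - exists (row3 1 0 1); last by rewrite row3E oner_neq0.
    by rewrite /quadric /= !row3E k; split=> [|_]; [ring|lra].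
  - exists (row3 1 0 0); last by rewrite row3E oner_neq0.
    by rewrite /quadric /= !row3E k; split=> [|]; [ring|lra].
have B2 : B 0 2%:R = 0.
  have := congr1 (fun v : 'rV[R]_3 => v 0 1) (fixd x Q).
  rewrite /gen !row3E mxE B00 mul0r subr0 => /eqP.
  by rewrite mulf_eq0 (negbTE x0) orbF => /eqP.
by move/eqP: B0; apply; apply: row3P; rewrite mxE.
Qed.

Lemma act_group : B != 0 -> one_parameter_group_of_isometries act.
Proof.
move=> B0; split.
- exact: isometry_act.
- exact: act0.
- by move=> s t p; rewrite /= actD.
- exact: smooth_act_joint.
- exact: act_nontrivial.
Qed.

End action.

(** * Local surjectivity *)

Section sup_norm.
Context {R : realType} {n : nat}.
Implicit Types (v : 'rV[R]_n).

Lemma coord_le_norm v j : `|v 0 j| <= `|v|.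
Proof.
rewrite [leRHS]/Num.Def.normr/= mx_normrE.
exact: (le_bigmax _ (fun ij : 'I_1 * 'I_n => `|v ij.1 ij.2|) (0, j)).
Qed.

Lemma norm_leP v c : 0 <= c -> (forall j, `|v 0 j| <= c) -> `|v| <= c.
Proof.
move=> c0 h; rewrite [leLHS]/Num.Def.normr/= mx_normrE.
by apply: bigmax_le => // -[i j] _ /=; rewrite ord1.
Qed.

Lemma norm_ltP v c : 0 < c -> (forall j, `|v 0 j| < c) -> `|v| < c.
Proof.
move=> c0 h; rewrite [ltLHS]/Num.Def.normr/= mx_normrE.
by apply/bigmax_ltP; split=> // -[i j] _ /=; rewrite ord1.
Qed.

Lemma norm_ge_coord v c : 0 < c -> c <= `|v| -> exists j, c <= `|v 0 j|.
Proof.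
move=> c0 cv; apply: contrapT => nex.
have : `|v| < c.
  apply: norm_ltP => // j; rewrite ltNge; apply/negP => h; apply: nex; by exists j.
by rewrite ltNge cv.
Qed.

Lemma mulmx_bounded (A : 'M[R]_n) : exists2 K, 0 < K & forall v, `|v *m A| <= K * `|v|.
Proof.
exists (\sum_i \sum_j `|A i j| + 1).
  by rewrite ltr_wpDl// sumr_ge0// => i _; rewrite sumr_ge0.
move=> v; apply: norm_leP => [|j].
  by rewrite mulr_ge0// addr_ge0// sumr_ge0// => i _; rewrite sumr_ge0.
rewrite mxE (le_trans (ler_norm_sum _ _ _))// mulrDl mul1r ler_wpDr// mulr_suml.
apply: ler_sum => i _; rewrite normrM mulrC ler_pM//; last exact: coord_le_norm.
by rewrite (bigD1 j)//= lerDl sumr_ge0.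
Qed.

End sup_norm.

Section local_surjectivity.
Context {R : realType} {n : nat}.
Variables (G : 'rV[R]_n -> 'rV[R]_n) (U : set 'rV[R]_n) (u0 : 'rV[R]_n).
Hypotheses (Uo : open U) (Uu0 : U u0).
Hypothesis dG : forall u, U u -> differentiable G u.
Hypothesis injG : forall u X, U u -> 'D_X G u = 0 -> X = 0.

Lemma jacobian_unit u : U u -> jacobian G u \in unitmx.
Proof.
move=> Uu; rewrite -row_free_unit -kermx_eq0; apply/eqP/row_matrixP => i.
rewrite row0; apply: (injG Uu); rewrite deriveEjacobian; last exact: dG.
by apply/sub_kermxP; exact: row_sub.
Qed.

(** The jacobian of [G] at [u0] is bounded below, and dominates the error of the
    linear approximation near [u0]. *)
Lemma separation : exists2 c, 0 < c & exists2 r, 0 < r &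
  forall u, `|u - u0| < r -> c * `|u - u0| <= `|G u - G u0|.
Proof.
have [K K0 hK] := mulmx_bounded (invmx (jacobian G u0)).
exists (2 * K)^-1; first by rewrite invr_gt0 mulr_gt0.
have [_ /eqaddoP/(_ (2 * K)^-1)] := (diff_locallyP _ _).1 (dG Uu0).
rewrite invr_gt0 mulr_gt0// => /(_ isT)/nbhs_ballP[r r0 rB].
exists r => // u ur; have := rB (u - u0).
rewrite -ball_normE /ball_ /= sub0r normrN => /(_ ur).
rewrite !fctE /= subrK -deriveE; last exact: dG.
rewrite deriveEjacobian; last exact: dG.
set v := u - u0 => h.
have vE : v = (v *m jacobian G u0) *m invmx (jacobian G u0) by rewrite mulmxK// jacobian_unit.
have hv : K^-1 * `|v| <= `|v *m jacobian G u0| by rewrite ler_pdivrMl// {1}vE.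
have : `|v *m jacobian G u0| <= `|G u - G u0| + `|G u - (G u0 + v *m jacobian G u0)|.
  rewrite -[X in `|X| <= _](subKr (G u - G u0)) (le_trans (ler_normB _ _))//.
  by rewrite opprD addrA.
move=> /(le_trans hv) h2.
have : (2 * K)^-1 * `|v| + (2 * K)^-1 * `|v| = K^-1 * `|v|.
  by field; rewrite gt_eqF.
move=> E; have := le_trans h2 (lerD (lexx _) h).
by rewrite -E lerD2r.
Qed.

(** The point of a small ball whose image is nearest to [y] is interior to the
    ball, so that the derivative of the square of the distance vanishes there;
    as the differential of [G] is onto, the distance is zero. *)
Theorem local_surjectivity r : 0 < r -> exists2 eta, 0 < eta &
  forall y, `|y - G u0| < eta -> exists2 u, `|u - u0| < r /\ U u & G u = y.
Proof.
move=> r0; have [c c0 [r1 r10 sep]] := separation.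
have [r2 r20 r2U] := smooth_on_near_ball Uo Uu0.
pose q := Num.min r (Num.min r1 r2) / 2.
have q0 : 0 < q by rewrite divr_gt0// !lt_min r0 r10 r20.
have qlt : q < Num.min r (Num.min r1 r2).
  by rewrite ltr_pdivrMr// ltr_pMr ?ltr1n// !lt_min r0 r10 r20.
have [qr qr1 qr2] : [/\ q < r, q < r1 & q < r2].
  by move: qlt; rewrite !lt_min => /and3P[].
pose K : set 'rV[R]_n := [set u | `|u - u0| <= q].
have KU u : K u -> U u by move=> Ku; rewrite -(subrK u0 u); apply: r2U; exact: le_lt_trans qr2.
have Ku0 : K u0 by rewrite /K /= subrr normr0 ltW.
have cK : compact K.
  apply: bounded_closed_compact.
    exists (q + `|u0|); split; first exact: num_real.
    move=> x xb u Ku.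
    have nu : `|u| <= q + `|u0|.
      by rewrite -{1}(subrK u0 u) (le_trans (ler_normD _ _))// lerD2r.
    exact: le_trans nu (ltW xb).
  have := @closed_comp _ _ (fun u : 'rV[R]_n => `|u - u0|) [set x | x <= q].
  apply; last exact: closed_le.
  move=> u _.
  have cu : {for u, continuous (fun u : 'rV[R]_n => u - u0)}.
    by apply: differentiable_continuous; apply: differentiableB.
  exact: (cvg_norm cu).
(* A value of the squared distance on the boundary of the ball is at least
   [((n + 1) * eta) ^+ 2], and it is at most [n * eta ^+ 2] at [u0]. *)
pose eta := c * q / (n%:R + 2).
have n20 : 0 < n%:R + 2 :> R by rewrite ltr_wpDl.
have eta0 : 0 < eta by rewrite divr_gt0// mulr_gt0.
exists eta => // y yG.
pose Q u := \sum_j (G u 0 j - y 0 j) ^+ 2.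
have dGj u j : U u -> differentiable (fun u => G u 0 j : R) u.
  by move=> /dG/differentiable_rowP.
have hQ u X : U u -> has_derive u X Q (\sum_j 2 * (G u 0 j - y 0 j) * ('D_X G u) 0 j).
  move=> Uu; rewrite (_ : Q = \sum_j (fun u => (G u 0 j - y 0 j) ^+ 2)); last first.
    by apply/funext => v; rewrite fct_sumE.
  apply: is_derive_sum => j; apply: has_derive_conv; eexists.
    apply: has_deriveX; apply: has_deriveB; last exact: has_derive_cst.
    exact: (has_derive_row X j (dG Uu)).
  by cbv beta => /=; ring.
have dQ u : U u -> differentiable Q u.
  move=> Uu.
  have -> : Q = \sum_j (fun u => (G u 0 j - y 0 j) * (G u 0 j - y 0 j)).
    by apply/funext => v; rewrite fct_sumE; apply: eq_bigr => j _; rewrite expr2.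
  apply: differentiable_sum => j; apply: differentiableM;
    by apply: differentiableB; [exact: dGj|exact: differentiable_cst].
have [||v Kv vmin] := @EVT_min_rV R n Q K _ cK.
- by exists u0.
- apply: continuous_in_subspaceT => u /set_mem Ku.
  exact/differentiable_continuous/dQ/KU.
have {}Kv : K v by exact: set_mem.
have Qv : Q v <= Q u0 by apply: vmin; exact: mem_set.
have hy j : `|G u0 0 j - y 0 j| <= eta.
  rewrite distrC; have := coord_le_norm (y - G u0) j.
  by rewrite !mxE => /le_trans; apply; exact: ltW.
have Qu0 : Q u0 <= n%:R * eta ^+ 2.
  have -> : n%:R * eta ^+ 2 = \sum_(j < n) eta ^+ 2.
    by rewrite sumr_const card_ord mulr_natl.
  by apply: ler_sum => j _; rewrite -(real_normK (num_real _)) lerXn2r ?nnegrE ?(ltW eta0).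
have vint : `|v - u0| < q.
  rewrite lt_neqAle Kv andbT; apply/eqP => vq.
  have := sep v; rewrite vq => /(_ qr1) h.
  have [j hj] := norm_ge_coord (mulr_gt0 c0 q0) h.
  have cqE : c * q = (n%:R + 2) * eta by rewrite /eta; field; rewrite gt_eqF.
  have hvj : (n%:R + 1) * eta <= `|G v 0 j - y 0 j|.
    have : `|G v 0 j - G u0 0 j| <= `|G v 0 j - y 0 j| + `|G u0 0 j - y 0 j|.
      have -> : G v 0 j - G u0 0 j = (G v 0 j - y 0 j) - (G u0 0 j - y 0 j) by ring.
      exact: ler_normB.
    move: hj; rewrite !mxE cqE => h1 h2; have := le_trans h1 (le_trans h2 (lerD (lexx _) (hy j))).
    rewrite (_ : (n%:R + 2) * eta = (n%:R + 1) * eta + eta); last by ring.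
    by rewrite lerD2r.
  have : ((n%:R + 1) * eta) ^+ 2 <= n%:R * eta ^+ 2.
    apply: (le_trans _ (le_trans Qv Qu0)); rewrite /Q (bigD1 j)//=.
    rewrite ler_wpDr ?sumr_ge0//; first by move=> *; exact: sqr_ge0.
    rewrite -[leRHS](real_normK (num_real _)) lerXn2r ?nnegrE//.
    by rewrite mulr_ge0 ?addr_ge0// ltW.
  rewrite exprMn ler_pM2r ?exprn_gt0//; apply/negP; rewrite -ltNge.
  by rewrite expr2 mulrDl mul1r ltr_wpDl ?mulr_ge0 ?addr_ge0// ltrDl.
have DQ X : 'D_X Q v = 0.
  pose d := (q - `|v - u0|) / (`|X| + 1).
  have X1 : 0 < `|X| + 1 by rewrite ltr_wpDl.
  have d0 : 0 < d by rewrite divr_gt0// subr_gt0.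
  have inK (s : R) : `|s| < d -> K (s *: X + v).
    move=> sd; rewrite /K /= -addrA (le_trans (ler_normD _ _))// normrZ -lerBrDr.
    move: sd; rewrite ltr_pdivlMr// => /ltW; apply: le_trans.
    by rewrite ler_wpM2l// lerDl.
  have sd (s : R) : s \in `](- d), d[ -> `|s| < d by rewrite in_itv /= ltr_norml.
  have hl (s : R) : `|s| < d -> is_derive s 1 (fun s : R => Q (s *: X + v)) ('D_X Q (s *: X + v)).
    by move=> /inK /KU Us; apply: has_derive_line; exact: dQ.
  have d00 : `|0 : R| < d by rewrite normr0.
  have hd : - d < d by rewrite gtrN.
  have := @derive1_at_min R (fun s : R => Q (s *: X + v)) (- d) d 0 (ltW hd).
  case.
  - by move=> s /sd /hl [].
  - by rewrite in_itv /= oppr_lt0 d0.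
  - by move=> s /sd /inK Ks; rewrite scale0r add0r; apply: vmin; exact: mem_set.
  - move=> _ E; have [_ E'] := hl 0 d00.
    by move: E'; rewrite E scale0r add0r.
have Uv := KU v Kv.
exists v; first by split=> //; exact: lt_trans qr.
apply/rowP => j; apply/eqP; rewrite -subr_eq0.
pose X := (G v - y) *m invmx (jacobian G v).
have DX : 'D_X G v = G v - y by rewrite deriveEjacobian ?mulmxKV ?jacobian_unit//; exact: dG.
have [_] := hQ v X Uv; rewrite DQ DX => /esym E.
have pos i : true -> 0 <= 2 * (G v 0 i - y 0 i) * (G v - y) 0 i.
  by move=> _; rewrite !mxE -mulrA -expr2 mulr_ge0 ?sqr_ge0.
have := psumr_eq0P pos E (i := j) isT.
by rewrite !mxE -mulrA -expr2 => /eqP; rewrite mulf_eq0 pnatr_eq0 /= sqrf_eq0.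
Qed.

End local_surjectivity.

Section level_set.
Context {R : realType} {m : nat}.
Variables (F : 'rV[R]_m.+1 -> R) (V : set 'rV[R]_m.+1).
Hypotheses (Vo : open V) (sF : smooth_on V F).
Variables (c : 'rV[R]_m -> 'rV[R]_m.+1) (W : set 'rV[R]_m) (u0 : 'rV[R]_m).
Hypotheses (Wo : open W) (Wu0 : W u0).
Hypothesis cV : forall u, W u -> V (c u).
Hypothesis dc : forall u, W u -> differentiable c u.
Hypothesis injc : forall u X, W u -> 'D_X c u = 0 -> X = 0.
Hypothesis Fc : forall u, W u -> F (c u) = 0.
Variable l : 'I_m.+1.
Hypothesis Fl : partial l F (c u0) != 0.

Let el : 'rV[R]_m.+1 := delta_mx 0 l.

Lemma derive_level u X : W u -> 'D_('D_X c u) F (c u) = 0.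
Proof.
move=> Wu; have dF : differentiable F (c u) by exact: (smooth_on_differentiable sF (cV Wu)).
have dFc : differentiable (F \o c) u by exact: differentiable_comp (dc Wu) dF.
have E : 'D_X (F \o c) u = 0.
  transitivity ('D_X (fun=> 0 : R) u); last by have [_ ->] := has_derive_cst (0 : R) u X.
  apply: near_eq_derive; apply: filterS (open_nbhs_nbhs (conj Wo Wu)) => y; exact: Fc.
move: E; rewrite deriveE// diff_comp//; last exact: dc.
by rewrite /= -!deriveE//; exact: dc.
Qed.

Lemma regular_ball : exists2 r, 0 < r & forall v, `|v - c u0| < r ->
  V v /\ partial l F v != 0.
Proof.
have [r r0 rV] := smooth_on_near_ball Vo (cV Wu0).
have cont : {for c u0, continuous (partial l F)}.
  apply: differentiable_continuous.
  exact: (smooth_on_differentiable (smooth_on_partial l sF) (cV Wu0)).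
have nz : \forall v \near c u0, partial l F v != 0.
  move: cont => /(_ [set y | y != 0]); apply.
  apply: open_nbhs_nbhs; split=> //; exact: open_neq.
have /nbhs_ballP[r' r'0 r'V] := nz.
exists (Num.min r r'); first by rewrite lt_min r0.
move=> v; rewrite lt_min => /andP[vr vr']; split.
  by rewrite -(subrK (c u0) v); exact: rV.
by apply: r'V; rewrite -ball_normE /ball_ /= distrC.
Qed.

(** An immersed hypersurface contained in a regular level set fills a
    neighborhood of each of its points in it: after dropping a coordinate along
    which the function varies, the immersion becomes a local diffeomorphism, and
    the function is injective along that coordinate. *)
Theorem level_set_filled : exists2 e, 0 < e &
  forall v, `|v - c u0| < e -> F v = 0 -> exists2 u, W u & c u = v.
Proof.
have [r r0 rV] := regular_ball.
pose W' := W `&` [set u | `|c u - c u0| < r].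
have W'o : open W'.
  rewrite openE => u [Wu ur]; apply: filterI; first exact: (open_nbhs_nbhs (conj Wo Wu)).
  have : {for u, continuous (fun u => `|c u - c u0|)}.
    apply: (@continuous_comp _ _ _ (fun u => c u - c u0) (fun v => `|v|)); last exact: norm_continuous.
    apply: differentiable_continuous; apply: differentiableB => //; exact: dc.
  move=> /(_ [set x | x < r]); apply.
  by apply: open_nbhs_nbhs; split=> //; exact: open_lt.
have W'u0 : W' u0 by split=> //=; rewrite subrr normr0.
pose G u : 'rV[R]_m := col' l (c u).
have GE u j : G u 0 j = c u 0 (lift l j) by rewrite /G mxE.
have dG u : W' u -> differentiable G u.
  move=> [Wu _]; apply/differentiable_rowP => j.
  rewrite (_ : (fun _ => _) = (fun y => c y 0 (lift l j))); last by apply/funext => y; rewrite GE.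
  by have /differentiable_rowP := dc Wu.
have iG u X : W' u -> 'D_X G u = 0 -> X = 0.
  move=> W'u DG; have [Wu ur] := W'u; apply: (injc Wu).
  have Dj j : ('D_X c u) 0 (lift l j) = 0.
    have [_ <-] := has_derive_row X (lift l j) (dc Wu).
    have [_ E] := has_derive_row X j (dG u W'u).
    move: E; rewrite DG mxE => E; rewrite -[RHS]E.
    by congr ('D_X _ u); apply/funext => y; rewrite GE.
  have Del : 'D_X c u = ('D_X c u) 0 l *: el.
    apply/rowP => k; rewrite !mxE /=; case: (unliftP l k) => [j ->|->].
      by rewrite Dj eq_sym (negbTE (neq_lift _ _)) mulr0.
    by rewrite eqxx mulr1.
  have dF : differentiable F (c u) by exact: (smooth_on_differentiable sF (cV Wu)).
  have := derive_level X Wu; rewrite Del deriveE// linearZ -deriveE// => /eqP.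
  rewrite mulf_eq0 => /orP[/eqP ->|]; first by rewrite scale0r.
  by have [_ /negbTE] := rV (c u) ur; rewrite /partial => ->.
have [eta eta0 surj] := local_surjectivity W'o W'u0 dG iG ltr01.
have line (x y : 'rV[R]_m.+1) h : `|x - c u0| < r -> `|y - c u0| < r -> 0 < h -> y = h *: el + x ->
    F x = 0 -> F y = 0 -> False.
  move=> xr yr h0 yE Fx Fy.
  have seg s : 0 <= s <= h -> `|s *: el + x - c u0| < r.
    move=> /andP[s0 sh].
    have -> : s *: el + x - c u0 = (1 - s / h) *: (x - c u0) + (s / h) *: (y - c u0).
      have -> : y - c u0 = h *: el + (x - c u0) by rewrite yE addrA.
      rewrite -addrA; move: (x - c u0) => d.
      rewrite (scalerDr (s / h)) scalerA divfK ?gt_eqF// scalerBl scale1r.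
      by rewrite [RHS]addrC -[RHS]addrA (addrCA ((s / h) *: d)) subrr addr0.
    have sh0 : 0 <= s / h by rewrite divr_ge0// ltW.
    have sh1 : 0 <= 1 - s / h by rewrite subr_ge0 ler_pdivrMr// mul1r.
    pose mx := Num.max `|x - c u0| `|y - c u0|.
    have mr : mx < r by rewrite gt_max xr.
    apply: le_lt_trans mr; rewrite (le_trans (ler_normD _ _))// 2!normrZ (ger0_norm sh0) (ger0_norm sh1).
    rewrite [leRHS](_ : mx = (1 - s / h) * mx + s / h * mx); last by ring.
    by apply: lerD; apply: ler_wpM2l => //; rewrite /mx le_max lexx ?orbT.
  have [z z_in E] : exists2 z, 0 < z < h & F (h *: el + x) - F x = h * 'D_el F (z *: el + x).
    apply: (MVT_line h0) => z hz; have [Vz _] := rV _ (seg z hz).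
    exact: (smooth_on_differentiable sF Vz).
  move: E; rewrite -yE Fx Fy subr0 => /esym/eqP; rewrite mulf_eq0 gt_eqF//=.
  have /seg/rV[_] : 0 <= z <= h by case/andP: z_in => a b; rewrite !ltW.
  by move=> /negbTE; rewrite /partial => ->.
exists (Num.min eta r); first by rewrite lt_min eta0.
move=> v; rewrite lt_min => /andP[veta vr] Fv.
have [u [_ [Wu ur]] Gu] : exists2 u, `|u - u0| < 1 /\ W' u & G u = col' l v.
  apply: surj; apply: norm_ltP => // j.
  have := coord_le_norm (v - c u0) (lift l j).
  by rewrite !mxE => /le_lt_trans; apply.
exists u => //.
have vE : v = (v 0 l - c u 0 l) *: el + c u.
  apply/rowP => k; rewrite !mxE /=; case: (unliftP l k) => [j ->|->].
    have := congr1 (fun w : 'rV[R]_m => w 0 j) Gu; rewrite GE mxE => ->.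
    by rewrite eq_sym (negbTE (neq_lift _ _)) mulr0 add0r.
  by rewrite eqxx mulr1 subrK.
have [h|h|h] := ltgtP (v 0 l - c u 0 l) 0; last by rewrite vE h scale0r add0r.
  exfalso; apply: (line v (c u) (- (v 0 l - c u 0 l))) => //; first by rewrite oppr_gt0.
    by rewrite scaleNr {2}vE addKr.
  exact: Fc.
by exfalso; apply: (line (c u) v _ ur vr h vE) => //; exact: Fc.
Qed.

End level_set.

(** * Invariance of the surface *)

Section invariance.
Context {R : realType}.
Variable kappa : R.
Hypothesis hkappa : kappa = -1 \/ kappa = 0 \/ kappa = 1.
Variables (I : set R) (I0 : I !=set0) (f : R -> R).
Hypothesis I_open : open I.
Hypothesis f_smooth : smooth_on_interval I f.
Notation P := (warped_product (space_form kappa) f I0).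
Variables (s S C : R -> R).
Hypothesis ds : forall t, I t -> is_derive t 1 s (expR (- f t)).
Hypothesis SC : oscillator (- kappa) S C.
Variables (A : 'rV[R]_3) (c0 c1 c2 : R).
Implicit Types (p q : P) (k : idx P).

Definition level p : R := height_fun kappa A (pos p) +
  (c0 + c1 * S (s (height p)) + c2 * C (s (height p))).

Lemma has_derive_level k v X : ambient_region k v -> has_derive v X (fun y => level (chart_inv k y))
  (dheight_fun kappa A (pos (chart_inv k v : P)) (dstereo kappa k.1 (hor v) (hor X)) +
   (c1 * (1 + kappa * C (s (ver v))) + c2 * S (s (ver v))) * (expR (- f (ver v)) * ver X)).
Proof.
move=> rv; have [_ Iv] := rv.
have hd_t : has_derive v X (fun y => height (chart_inv k y : P)) (ver X).
  apply: near_eq_is_derive (has_derive_ver X v).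
  apply: filterS (open_nbhs_nbhs (conj (@open_ambient_region R kappa I I0 f I_open k) rv)) => y ry.
  by rewrite height_chart_inv.
have E : height (chart_inv k v : P) = ver v by rewrite height_chart_inv.
have hd_s : has_derive v X (fun y => s (height (chart_inv k y : P))) (expR (- f (ver v)) * ver X).
  have := ds Iv; rewrite -{1}E => h.
  exact: (has_derive_comp (F := fun y => height (chart_inv k y : P)) h hd_t).
have [_ _ dS dC] := SC.
have hd_S := has_derive_comp (F := fun y => s (height (chart_inv k y : P))) (dS _) hd_s.
have hd_C := has_derive_comp (F := fun y => s (height (chart_inv k y : P))) (dC _) hd_s.
have hp := has_derive_pos_chart_inv hkappa I_open X (I0 := I0) (f := f) _ rv.
apply: has_derive_conv; eexists.
  apply: has_deriveD; first exact: (has_derive_height_fun kappa A hp).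
  apply: has_deriveD; last by apply: has_deriveM; [exact: has_derive_cst|exact: hd_C].
  apply: has_deriveD; first exact: has_derive_cst.
  by apply: has_deriveM; [exact: has_derive_cst|exact: hd_S].
cbv beta; rewrite E.
have aux (h a b c d g k0 : R) : h + (0 + (0 * a + b * ((1 - - k0 * c) * d)) + (0 * c + g * (a * d)))
  = h + (b * (1 + k0 * c) + g * a) * d by ring.
exact: aux.
Qed.

Lemma smooth_level k : smooth_on (ambient_region k) (fun y => level (chart_inv k y)).
Proof.
have Uo := @open_ambient_region R kappa I I0 f I_open k.
have sp j := @smooth_on_pos_chart_inv R kappa hkappa I I0 f I_open k j.
have sh := @smooth_on_height_chart_inv R kappa I I0 f I_open k.
have ss : smooth_on (ambient_region k) (fun y => s (height (chart_inv k y : P)) : R).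
  apply: (smooth_on_comp_primitive Uo (h := s) (g := fun y => expR (- f y)) _ sh).
    by move=> y _; apply: ds; exact: height_in.
  apply: smooth_on_expR => //; apply: smooth_onN => //.
  have := @smooth_on_comp_interval R _ _ Uo I f _ 0%N f_smooth _ sh.
  by rewrite derive1n0; apply => y _; exact: height_in.
have [sS sC] := smooth_oscillator SC Uo ss.
have sc a : smooth_on (ambient_region k) (fun=> a : R) by exact: smooth_on_cst.
apply: smooth_onD => //; last first.
  by apply: smooth_onD => //; [apply: smooth_onD => //|]; apply: smooth_onM.
apply: smooth_onD => //; first by apply: smooth_onD => //; apply: smooth_onM.
apply: smooth_onM => //; apply: smooth_onB => //; first exact: smooth_onM.
apply: smooth_onM => //; apply: smooth_onM => //.
by apply: smooth_onD => //; apply: smooth_onX.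
Qed.

Section surface.
Context {M : manifold R 2}.
Hypothesis M_good : good_charts M.
Hypothesis M_cover : forall p : M, exists i, exists2 u, chart_image i u & chart_inv i u = p.
Variable phi : M -> P.
Hypothesis phi_smooth : smooth_map phi.
Hypothesis phi_imm : immersion phi.
Variables (n : M -> 'rV[R]_3) (nu rho : M -> R).
Hypothesis data : umbilical_data phi n nu rho.
Hypothesis phi_level : forall x, [/\ axis phi n nu rho x = A, level (phi x) = 0 &
  c1 * (1 + kappa * C (s (height (phi x)))) + c2 * S (s (height (phi x))) = nu x].

(** The derivative of the first integral in the direction of the unit normal of
    the surface is one. *)
Lemma level_regular i k u : overlap phi i k u ->
  exists l, partial l (fun y => level (chart_inv k y)) (local_rep phi i k u) != 0.
Proof.
move=> ok; have ru := local_rep_region hkappa ok; set v := local_rep phi i k u in ru *.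
set x := chart_inv i u; have xE : chart_inv k v = phi x by rewrite /v (chart_invK hkappa)//; case: ok.
have [_ tn un _ _] := data.
have [rh _] := ru; have [Ax _ nux] := phi_level x.
have hE : ver v = height (phi x) by rewrite -(height_chart_inv ru) xE.
have lE : hor v = stereo_proj k.1 (pos (phi x)) by exact: hor_chart_map.
pose X : 'rV[R]_(2 + 1) := row_mx (dproj k.1 (pos (phi x)) (n x)) (const_mx (expR (f (ver v)) * nu x)).
have vX : ver X = expR (f (ver v)) * nu x by rewrite /X ver_row.
have dX : dstereo kappa k.1 (hor v) (hor X) = n x.
  rewrite lE hor_row; apply: dstereo_dproj => //; by apply/chart_domE; case: ok.
have dF : differentiable (fun y => level (chart_inv k y)) v.
  exact: (smooth_on_differentiable (@smooth_level k) ru).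
have DX : 'D_X (fun y => level (chart_inv k y)) v = 1.
  have [_ ->] := has_derive_level X ru.
  rewrite xE dX hE nux -hE vX.
  have tnx := tn x.
  rewrite (dheight_funE hkappa (pos_quadric (phi x)) tnx tnx (esym Ax)) -[RHS](un x).
  have -> : expR (- f (ver v)) * (expR (f (ver v)) * nu x) = nu x.
    by rewrite mulrA -expRD addNr expR0 mul1r.
  by rewrite -expr2.
apply: contrapT => nex.
have p0 l : partial l (fun y => level (chart_inv k y)) v = 0.
  by apply/eqP/negP => /negP h; apply: nex; exists l.
move: DX; rewrite derive_partialE// big1 => [/esym/eqP|l _].
  by rewrite oner_eq0.
by rewrite p0 ?mulr0 ?scaler0.
Qed.

Lemma continuous_chart_map k q : chart_dom k q -> {for q, continuous (chart_map k : P -> 'rV[R]_(2 + 1))}.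
Proof.
move=> /chart_domE[_ dq]; apply: continuous_rowP => j.
have cp b : {for q, continuous (fun y : P => 2 * pos y 0 b / (1 + stereo_sign k.1 * pos y 0 2%:R))}.
  apply: cvgM; first by apply: cvgM; [exact: cvg_cst|exact: continuous_pos].
  apply: cvgV; first by rewrite gt_eqF.
  by apply: cvgD; [exact: cvg_cst|apply: cvgM; [exact: cvg_cst|exact: continuous_pos]].
rewrite -(fintype.splitK j); case: (fintype.split j) => l; rewrite /unsplit.
  have [->|->] := ord2_cases l.
  - rewrite (_ : (fun y => _) = (fun y : P => 2 * pos y 0 0 / (1 + stereo_sign k.1 * pos y 0 2%:R))) //.
    by apply/funext => y; rewrite chart_mapE row_mxEl row2E.
  - rewrite (_ : (fun y => _) = (fun y : P => 2 * pos y 0 1 / (1 + stereo_sign k.1 * pos y 0 2%:R))) //.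
    by apply/funext => y; rewrite chart_mapE row_mxEl row2E.
rewrite (_ : (fun y => _) = (fun y : P => height y)); first exact: continuous_height.
by apply/funext => y; rewrite chart_mapE row_mxEr mxE.
Qed.

(** [level_set_filled] in a chart of the ambient space. *)
Lemma level_filled x : \forall q \near phi x, level q = 0 -> range phi q.
Proof.
have [i [u iu <-]] := M_cover x; have [k ok] := chart_cover phi iu.
have [l Fl] := level_regular ok.
have oo : open (overlap phi i k) by apply: open_overlap => //; case: phi_smooth.
have [|||e e0 fill] := level_set_filled (@open_ambient_region R kappa I I0 f I_open k)
  (@smooth_level k) oo ok _ (@local_rep_differentiable R kappa I I0 f 2 M phi phi_smooth i k) _ _ Fl.
- by move=> y oy; exact: local_rep_region.
- by move=> y X oy; case: phi_imm => _; apply.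
- move=> y oy; have [_ <- _] := phi_level (chart_inv i y).
  by rewrite /local_rep (chart_invK hkappa)//; case: oy.
have dk : nbhs (phi (chart_inv i u)) (chart_dom k).
  by apply: (open_nbhs_nbhs (conj (@open_ambient_dom R kappa I I0 f k) _)); case: ok.
have cl : \forall q \near phi (chart_inv i u), `|chart_map k q - local_rep phi i k u| < e.
  have cm : {for phi (chart_inv i u), continuous (chart_map k : P -> 'rV[R]_(2 + 1))}.
    by apply: continuous_chart_map; case: ok.
  apply: (cm [set v | `|v - local_rep phi i k u| < e]).
  by apply/nbhs_ballP; exists e => // v; rewrite -ball_normE /ball_ /= distrC.
apply: filterS2 dk cl => q dq qe lq.
have [|y oy yE] := fill _ qe; first by rewrite (chart_invK hkappa).
exists (chart_inv i y) => //; have [_ dy] := oy.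
by rewrite -(chart_invK hkappa dy) -(chart_invK hkappa dq) -yE.
Qed.

End surface.
End invariance.

(** * Countably many copies of a manifold *)

Section copies.
Context {R : realType} {m : nat}.
Variable M : manifold R m.

(** The disjoint union, as the product with a discrete countable space. *)
Definition copies : manifold R m :=
  @Manifold R m (nat * M)%type (nat * idx M)%type
    (fun k => [set k.1] `*` chart_dom k.2)
    (fun k p => chart_map k.2 p.2)
    (fun k u => (k.1, chart_inv k.2 u)).

Lemma copies_image (k : idx copies) : chart_image k = chart_image k.2.
Proof.
case: k => k i; apply/seteqP; split=> u [].
  by move=> [l p] [_ dp] <-; exists p.
by move=> p dp <-; exists (k, p).
Qed.

Lemma open_slice k (A : set M) : open A -> open ([set k] `*` A : set copies).
Proof.
move=> Ao; rewrite openE => -[l p] [/= -> Ap]; exists ([set k], A) => //.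
by split; [exact: discrete_set1|exact: open_nbhs_nbhs].
Qed.

Lemma copies_good : good_charts M -> good_charts copies.
Proof.
move=> good [k i]; rewrite copies_image; have [oi ci] := good i; split=> // u iu.
exact: (cvg_pair (cvg_cst k) (ci u iu)).
Qed.

Lemma copies_smooth : smooth_manifold M -> smooth_manifold copies.
Proof.
move=> [[hM [B cB [Bo Bb]]] cov ho hc hs]; split.
- split.
    move=> [k p] [l q] cl.
    have kl : k = l.
      have nbhs_slice a x : nbhs ((a, x) : copies) ([set a] `*` setT).
        by apply: open_nbhs_nbhs; split; [exact: open_slice openT|split].
      by have [[a b] [[/= <- _] [/= <- _]]] := cl _ _ (nbhs_slice k p) (nbhs_slice l q).
    rewrite kl; congr (_, _); apply: hM => U V pU qV.
    have [| |[a b] /= [[_ Ub] [_ Vb]]] := cl (setT `*` U) (setT `*` V); last by exists b.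
    + by exists (setT, U) => //; split=> //; exact: filterT.
    + by exists (setT, V) => //; split=> //; exact: filterT.
  exists ((fun kU => [set kU.1] `*` kU.2) @` (setT `*` B)).
    exact: (sub_countable (card_image_le _ _) (countableX (countableP _) cB)).
  split=> [_ [[k U] [_ /Bo Uo] <-]|[k p] W [[W1 W2] /= [k1 p2] sub]]; first exact: open_slice.
  have [U [BU Up] UW] := Bb p _ p2.
  exists ([set k] `*` U); first by split; [exists (k, U)|].
  by move=> [l q] [/= -> Uq]; apply: sub; split=> /=; [exact: nbhs_singleton k1|exact: UW].
- by move=> [k p]; have [i di] := cov p; exists (k, i).
- move=> [k i]; have [od oi] := ho i; rewrite copies_image; split=> //; exact: open_slice.
- move=> [k i]; have [ki cm ci] := hc i; split.
  + by move=> [l p] [/= -> dp]; rewrite ki.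
  + move=> [l p] [_ dp]; apply: (@continuous_comp _ _ _ (fun q : nat * M => q.2) (chart_map i)).
      exact: cvg_snd.
    exact: cm.
  + move=> u; rewrite copies_image => iu.
    exact: (cvg_pair (cvg_cst k) (ci u iu)).
- move=> [k i] [l j]; apply: smooth_on_sub (hs i j) => u [[a p] [[_ di] [_ dj]] <-].
  by exists p.
Qed.

End copies.

(** * The union of the images of a surface *)

Section orbit.
Context {R : realType}.
Variable kappa : R.
Hypothesis hkappa : kappa = -1 \/ kappa = 0 \/ kappa = 1.
Variables (I : set R) (I0 : I !=set0) (f : R -> R).
Hypothesis I_open : open I.
Hypothesis f_smooth : smooth_on_interval I f.
Notation P := (warped_product (space_form kappa) f I0).
Variables (B : 'rV[R]_3) (S C : R -> R).
Hypothesis SC : oscillator (freq kappa B) S C.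
Local Notation rot := (rot kappa B S C).
Local Notation act := (@act R kappa I I0 f B S C).
Context {M : manifold R 2}.
Hypothesis M_good : good_charts M.
Variable phi : M -> P.
Hypothesis phi_smooth : smooth_map phi.
Hypothesis phi_imm : immersed phi.
Variables (n : M -> 'rV[R]_3) (nu rho : M -> R).
Hypothesis data : umbilical_data phi n nu rho.
Variable r : nat -> R.

(** The [k]-th copy of the surface is moved by the [r k]-th element of the
    group. *)
Definition spread (q : copies M) : P := act (r q.1) (phi q.2).

Lemma rot_lin s a b (v w : 'rV[R]_3) : rot s (a *: v + b *: w) = a *: rot s v + b *: rot s w.
Proof.
have E (v' w' : 'rV[R]_3) j : (a *: v' + b *: w') 0 j = a * v' 0 j + b * w' 0 j by rewrite !mxE.
by apply: row3P; rewrite E !rotE /gen !row3E !E; ring.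
Qed.

Lemma rot_zero s : rot s 0 = 0.
Proof. by have := rot_lin s 0 0 0 0; rewrite !scale0r addr0. Qed.

Lemma pr_spread k i u : pr spread (k, i) u = rot (r k) (pr phi i u).
Proof. by rewrite /pr /= pos_act. Qed.

Let cgood := copies_good M_good.

Lemma smooth_spread : smooth_map spread.
Proof.
have [cphi sphi] := (smooth_mapP hkappa M_good phi).1 phi_smooth.
apply/(smooth_mapP hkappa cgood); split.
  move=> [k p] A nA.
  have [ca _] := smooth_act hkappa I0 f I_open SC (r k).
  have nA' : nbhs p (phi @^-1` (act (r k) @^-1` A)) by apply: cphi; exact: ca.
  exists ([set k], phi @^-1` (act (r k) @^-1` A)) => /=.
    by split=> //; exact: discrete_set1.
  by move=> [l q] [/= -> ].
move=> [k i]; have Uo : open (chart_image i) by case: (M_good i).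
rewrite copies_image; have [sp sh] := sphi i; split=> // j.
apply: (smooth_on_eq Uo _ (smooth_on_rot SC Uo (smooth_on_cst Uo (r k)) sp j)) => u _.
by rewrite pr_spread.
Qed.

Lemma derive_pr_spread k i u X : chart_image i u ->
  'D_X (pr spread (k, i)) u = rot (r k) ('D_X (pr phi i) u).
Proof.
move=> iu; apply/rowP => j.
have iu' : chart_image ((k, i) : idx (copies M)) u by rewrite copies_image.
rewrite (derive_prj hkappa cgood smooth_spread j X iu').
have hp l : has_derive u X (fun y => pr phi i y 0 l) (('D_X (pr phi i) u) 0 l).
  have := has_derive_at X (smooth_pr hkappa M_good phi_smooth (i := i) l) iu.
  by rewrite -(derive_prj hkappa M_good phi_smooth l X iu).
have [_ E] := has_derive_rot kappa B S C (r k) hp j.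
rewrite -[RHS]E; congr ('D_X _ u); apply/funext => y; by rewrite pr_spread.
Qed.

Lemma immersed_spread : immersed spread.
Proof.
move=> [k i] u X iu; have iu' : chart_image i u by move: iu; rewrite copies_image.
rewrite (derive_pr_spread k X iu') => D0 h0; apply: (phi_imm iu') => //.
by rewrite -[LHS](rot0 SC) -(addNr (r k)) (rotD SC) D0 rot_zero.
Qed.

(** The rotations are linear and preserve the form on tangent vectors, so that
    the Weingarten formula is transported with the same [nu] and [rho]. *)
Lemma umbilical_data_spread : umbilical_data spread
  (fun q => rot (r q.1) (n q.2)) (fun q => nu q.2) (fun q => rho q.2).
Proof.
have [sd tn un on Dn] := data.
have tD i u X : chart_image i u -> tangent kappa (pos (phi (chart_inv i u))) ('D_X (pr phi i) u).
  move=> iu; have [k ok] := chart_cover phi iu.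
  rewrite (derive_prE hkappa M_good phi_smooth X ok) -/(pr phi i u) (prE hkappa ok).
  by apply: dstereo_tangent; case: (local_rep_region hkappa ok).
split.
- move=> [k i]; rewrite copies_image; have [sn snu srho] := sd i; split=> // j.
  have Uo : open (chart_image i) by case: (M_good i).
  exact: (smooth_on_rot SC Uo (smooth_on_cst Uo (r k)) sn j).
- by move=> [k p]; rewrite /spread (pos_act hkappa SC); exact: (rot_tangent SC).
- by move=> [k p] /=; rewrite (rot_form hkappa SC (r k) (pos_quadric (phi p)) (tn p) (tn p)).
- move=> [k i] u X iu; have iu' : chart_image i u by move: iu; rewrite copies_image.
  rewrite (derive_pr_spread k X iu') /=.
  by rewrite (rot_form hkappa SC (r k) (pos_quadric _) (tn _) (tD i u X iu')) on.
move=> [k i] u X iu p l; have iu' : chart_image i u by move: iu; rewrite copies_image.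
have [Dnj Dnu] := Dn i u X iu'; split=> // j.
have sn j' : smooth_on (chart_image i) (fun y => n (chart_inv i y) 0 j' : R) by case: (sd i).
rewrite (derive_pr_spread k X iu') pr_spread.
pose w : 'rV[R]_3 := l *: 'D_X (pr phi i) u + (kappa * nu (chart_inv i u) * dsc phi i u X) *: pr phi i u.
have hn j' : has_derive u X (fun y => n (chart_inv i y) 0 j') (w 0 j').
  have := has_derive_at X (sn j') iu'.
  by rewrite Dnj /w !mxE.
have [_ E] := has_derive_rot kappa B S C (r k) hn j.
refine (etrans E _); rewrite rot_lin.
by rewrite mxE [X in X + _]mxE [X in _ + X]mxE.
Qed.

Lemma umbilical_spread : totally_umbilical spread.
Proof.
exact: (umbilical_of_data hkappa I_open f_smooth cgood smooth_spread immersed_spread umbilical_data_spread).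
Qed.

End orbit.

(** * Rational times of the group *)

(** If the orbit of [q] stays in [Q] for a short time, any time is the sum of a
    rational one and of a short one. *)
Lemma act_dense {R : realType} (kappa : R) (hkappa : kappa = -1 \/ kappa = 0 \/ kappa = 1)
    (I : set R) (I0 : I !=set0) (f : R -> R) (B : 'rV[R]_3) (S C : R -> R)
    (SC : oscillator (freq kappa B) S C)
    (Q : set (warped_product (space_form kappa) f I0)) q :
  (\forall q' \near q, (exists t, q' = act B S C t q) -> Q q') ->
  forall t, exists a : rat, exists2 q', Q q' & act B S C t q = act B S C (ratr a) q'.
Proof.
move=> Qnear t.
have c0 : {for 0, continuous (fun t : R => act B S C t q)}.
  apply: continuous_ambient => [j|]; last exact: cst_continuous.
  rewrite (_ : (fun y => _) = (fun t : R => rot kappa B S C t (pos q) 0 j)); last first.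
    by apply/funext => y; rewrite (pos_act hkappa SC).
  apply: (continuous_rot SC (r := fun t : R => t) (c := fun t : R => pos q)).
    exact: cvg_id.
  by move=> l; exact: cst_continuous.
have : \forall t \near (0 : R), Q (act B S C t q).
  pose E : set (warped_product (space_form kappa) f I0) :=
    [set q' | (exists t, q' = act B S C t q) -> Q q'].
  have : nbhs (0 : R) ((fun t => act B S C t q) @^-1` E).
    by apply: c0; rewrite (act0 hkappa SC).
  by apply: filterS => t'; apply; exists t'.
move=> /nbhs_ballP[e /= e0 eQ].
have te : t - e < t by rewrite ltrBlDr ltrDl.
have [a] := rat_in_itvoo te; rewrite in_itv /= => /andP[a1 a2].
exists a, (act B S C (t - ratr a) q).
  apply: eQ; rewrite /ball /= sub0r normrN ger0_norm ?subr_ge0 ?ltW//.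
  by rewrite ltrBlDr -ltrBlDl.
by rewrite -(actD hkappa SC) addrC subrK.
Qed.

Theorem mainTheorem1 (R : realType) (kappa : R)
    (hkappa : kappa = -1 \/ kappa = 0 \/ kappa = 1)
    (I : set R) (I_open : open I) (I_itv : is_interval I) (I0 : I !=set0)
    (f : R -> R) (f_smooth : smooth_on_interval I f)
    (hf : forall t : R, I t ->
            (f^`(2))%classic t + kappa * expR (- 2 * f t) != 0)
    (Sigma : manifold R 2) (Sigma_smooth : smooth_manifold Sigma)
    (Sigma_connected : connected [set: Sigma])
    (phi : Sigma -> warped_product (space_form kappa) f I0)
    (phi_umbilical : totally_umbilical phi) :
  exists (Sigma' : manifold R 2)
         (psi : Sigma' -> warped_product (space_form kappa) f I0)
         (Phi : R -> warped_product (space_form kappa) f I0 ->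
                     warped_product (space_form kappa) f I0),
    [/\ smooth_manifold Sigma' /\ totally_umbilical psi,
        range phi `<=` range psi,
        one_parameter_group_of_isometries Phi &
        forall s : R, Phi s @` range psi = range psi].
Proof.
have good := smooth_manifold_good Sigma_smooth.
have cover (p : Sigma) : exists i, exists2 u, chart_image i u & chart_inv i u = p.
  have [_ cov _ hc _] := Sigma_smooth; have [i di] := cov p.
  by exists i, (chart_map i p); [exists p|case: (hc i) => ->].
have [phi_smooth phi_imm [n [nu [rho data]]]] :=
  umbilical_data_of hkappa I_open f_smooth good cover phi_umbilical.
have [t0 It0] := I0.
have [s ds] : exists s : R -> R, forall t, I t -> is_derive t 1 s (expR (- f t)).
  apply: (primitive_exists I_open I_itv It0) => t /set_mem It.
  apply: (@continuous_comp _ _ _ (fun t => - f t) expR); last exact: continuous_expR.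
  apply: cvgN; apply: differentiable_continuous; apply/derivable1_diffP.
  by have := f_smooth 0%N t It; rewrite derive1n0.
have [S0 [C0 SC0]] := oscillator_exists (- kappa).
have [A [c0 [c1 [c2 phi_level]]]] :=
  first_integral hkappa f_smooth Sigma_smooth Sigma_connected phi_smooth phi_imm data ds SC0.
(* If [A = 0], the surface is a slice, and any nontrivial rotation will do. *)
pose B := if A == 0 then row3 0 0 1 else A.
have AB : A = B \/ A = 0 by rewrite /B; case: eqP; [right|left].
have B0 : B != 0.
  rewrite /B; have [_|//] := eqVneq A 0; apply/eqP => /(congr1 (fun v : 'rV[R]_3 => v 0 2%:R)).
  by rewrite row3E mxE => /eqP; rewrite oner_eq0.
have [S [C SC]] := oscillator_exists (freq kappa B).
pose r k : R := if unpickle k is Some a then ratr (a : rat) else 0.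
have rE (a : rat) : r (pickle a) = ratr a by rewrite /r pickleK.
pose psi := spread B S C phi r.
have orbit p t : range psi (act B S C t (phi p)).
  have near_p : \forall q \near phi p, (exists t, q = act B S C t (phi p)) -> range phi q.
    have := level_filled hkappa I_open f_smooth ds SC0 good cover phi_smooth phi_umbilical.1 data phi_level p.
    apply: filterS => q lq [t' qE]; apply: lq.
    have [_ <- _] := phi_level p; rewrite /level qE (pos_act hkappa SC) height_act.
    by rewrite (rot_height_fun hkappa SC t' AB (pos_quadric _)).
  have [a [_ [p' _ <-] ->]] := act_dense hkappa SC near_p t.
  by exists (pickle a, p') => //; rewrite /psi /spread /= rE.
exists (copies Sigma), psi, (act B S C); split.
- split; first exact: copies_smooth.
  exact: (umbilical_spread hkappa I_open f_smooth SC good phi_smooth phi_imm data).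
- by move=> _ [p _ <-]; rewrite -(act0 hkappa SC (phi p)).
- exact: (act_group hkappa I0 f I_open SC).
move=> t; apply/seteqP; split=> [_ [_ [[k p] _ <-] <-]|_ [[k p] _ <-]].
  by rewrite /psi /spread -(actD hkappa SC).
(* The inverse image is in the union because the orbits are. *)
exists (act B S C (- t + r k) (phi p)) => //.
by rewrite -(actD hkappa SC) addrA subrr add0r.
Qed.
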